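(* Let $(\mathcal{A},\varphi)$ be a non-commutative probability space and let $T_i\in\mathcal{A}$ ($i=1,\dots,N$) be freely independent random variables with Cauchy transforms $G_i(\zeta)=\varphi((\zeta-T_i)^{-1})$. The Cauchy transform $G_i$ is invertible (under composition) at infinity with an inverse of the form $K_i(z)=\frac1z(1+R_i(z))$, i.e. $\varphi((K_i(z)-T_i)^{-1})=z$, and thus $$(K_i(z)-T_i)^{-1}=z\,(1+S_i(z))\qquad\text{with}\qquad \varphi(S_i(z))=0 .$$ Then the resolvent of $T=\sum_i T_i$ at $K(z)=\frac1z\bigl(1+\sum_i R_i(z)\bigr)$ can be written formally as an infinite sum $$\Bigl(K(z)-\sum_i T_i\Bigr)^{-1}=z\Bigl(I+\sum_{n=1}^\infty\ \sum_{i_1\ne i_2\ne\cdots\ne i_n}S_{i_1}S_{i_2}\cdots S_{i_n}\Bigr),$$ where $S_i=S_i(z)$. In particular, the expectation of the resolvent is $\varphi\bigl((K(z)-\sum_i T_i)^{-1}\bigr)=z$, and the additivity $R_{a+b}(z)=R_a(z)+R_b(z)$ for freely independent $a,b$ holds. If in addition $$\sum_i\frac{\|S_i\|_2^2}{1+\|S_i\|_2^2}<1,$$ then the infinite sum above converges in $L^2(\varphi)$ and its norm is $$\begin{aligned} \Bigl\|\Bigl(K(z)-\sum_i T_i\Bigr)^{-1}\Bigr\|_2^2 &=|z|^2\Bigl(1+\sum_{n=1}^\infty\ \sum_{i_1\ne i_2\ne\cdots\ne i_n}\|S_{i_1}\|_2^2\|S_{i_2}\|_2^2\cdots\|S_{i_n}\|_2^2\Bigr)\\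 &=|z|^2\Bigl(1-\sum_i\frac{\|S_i\|_2^2}{1+\|S_i\|_2^2}\Bigr)^{-1}\\ &=|z|^2\Bigl(1-\sum_i\Bigl(1-\frac{|z|^2}{\|(K_i(z)-T_i)^{-1}\|_2^2}\Bigr)\Bigr)^{-1}. \end{aligned}$$ Moreover, boundedness of $\|(K(z)-\sum_i T_i)^{-1}\|_2$ implies boundedness of $\|(K(z)-\sum_i T_i)^{-1}\|$ (operator norm).
   Context: A non-commutative probability space is a pair $(\mathcal{A},\varphi)$ of a complex algebra $\mathcal{A}$ with unit $I$ and a linear functional $\varphi$ on $\mathcal{A}$ with $\varphi(I)=1$; one usually works with $C^*$-algebras and faithful states (positive unital linear functionals). Elements of $\mathcal{A}$ are called random variables, and scalars are identified with multiples of $I$. The Hilbert norm is $\|X\|_2=\varphi(X^*X)^{1/2}$, and $L^2(\varphi)$ is the closure (completion) of $\mathcal{A}$ under this norm; $\|\cdot\|$ denotes the operator norm. Subalgebras $\mathcal{A}_i\subseteq\mathcal{A}$ are freely independent (free) if $\varphi(a_1a_2\cdots a_n)=0$ whenever $a_j\in\mathcal{A}_{i_j}$ with $\varphi(a_j)=0$ and $i_j\ne i_{j+1}$ for $j=1,\dots,n-1$; random variables are freely independent if the subalgebras they generate are. The Cauchy transform of a random variable $a$ is $G_a(\zeta)=\varphi((\zeta-a)^{-1})=\frac1\zeta\sum_{n=0}^\infty\varphi(a^n)\zeta^{-n}$, defined and analytic at least for $|\zeta|>\|a\|$. It has an inverse under composition in some neighbourhood of infinity, of the form $K_a(z)=G_a^{-1}(z)=\frac1z(1+R_a(z))$,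 where $R_a(z)=c_1z+c_2z^2+\cdots$ is analytic. Here $G_i=G_{T_i}$, $K_i=K_{T_i}$, $R_i=R_{T_i}$. The notation $\sum_{i_1\ne i_2\ne\cdots\ne i_n}$ means the sum over all index tuples in which neighbouring indices are different (non-neighbouring indices may coincide).
   Formalization: The L²(φ) part assumes the *-subalgebras generated by the T_i are free (the norm formula fails for T_1=T_2 a Haar unitary); the last sentence assumes φ faithful and tracial (it fails for *-free copies of e_12 under a non-tracial state) and bounds the series' partial sums. *)

(* Defs.v *)
From HB Require Import structures.
From mathcomp Require Import all_boot all_order all_algebra.
From mathcomp Require Import all_classical all_reals all_analysis.
From mathcomp Require Export complex.

Set Implicit Arguments.
Unset Strict Implicit.
Unset Printing Implicit Defensive.

Import Order.TTheory GRing.Theory Num.Theory.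
Import numFieldNormedType.Exports.

Local Open Scope classical_set_scope.
Local Open Scope ring_scope.
Local Open Scope complex_scope.

(* The usual topology of R[i], induced by the modulus. *)
HB.instance Definition _ (R : realType) := NormedModule.copy R[i] R[i]^o.

(* Complex unital C*-algebras. The norm is a separate real-valued operation
   rather than the one of normedModType: the latter cannot be joined with a ring
   structure in the present hierarchy (such a join would have to lie below
   numDomainType). *)
HB.mixin Record isCStarAlgebra (R : realType) A of GRing.UnitAlgebra R[i] A := {
  star : A -> A ;
  cnorm : A -> R ;
  starK : involutive star ;
  starD : forall x y : A, star (x + y) = star x + star y ;
  starZ : forall (c : R[i]) (x : A), star (c *: x) = Num.conj c *: star x ;
  starM : forall x y : A, star (x * y) = star y * star x ;
  cnorm_eq0 : forall x : A, cnorm x = 0 -> x = 0 ;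
  cnormD : forall x y : A, cnorm (x + y) <= cnorm x + cnorm y ;
  cnormZ : forall (c : R[i]) (x : A), (cnorm (c *: x))%:C = `|c| * (cnorm x)%:C ;
  cnormM : forall x y : A, cnorm (x * y) <= cnorm x * cnorm y ;
  cnorm_star : forall x : A, cnorm (star x * x) = cnorm x ^+ 2 ;
  cnorm_complete : forall u : nat -> A,
    (forall e : R, 0 < e -> exists n0 : nat, forall m n : nat,
       (n0 <= m)%N -> (n0 <= n)%N -> cnorm (u m - u n) < e) ->
    exists l : A, (fun n => cnorm (u n - l)) @ \oo --> (0 : R)
}.

#[short(type="cstarAlgType")]
HB.structure Definition CStarAlgebra (R : realType) :=
  { A of isCStarAlgebra R A & GRing.UnitAlgebra R[i] A }.

Section Freeness.
Context {F : fieldType} {A : algType F}.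
Implicit Types (phi : A -> F) (X : set A).

Definition gen_subalgebra X : set A :=
  smallest [set S : set A | GRing.subalg_closed (mem S)] X.

Definition free_sets phi (I : eqType) (B : I -> set A) : Prop :=
  forall (n : nat) (i : nat -> I) (a : nat -> A),
    (forall j, (j <= n)%N -> B (i j) (a j) /\ phi (a j) = 0) ->
    (forall j, (j < n)%N -> i j != i j.+1) ->
    phi (\prod_(0 <= j < n.+1) a j) = 0.

Definition freely_independent phi (I : eqType) (T : I -> A) : Prop :=
  free_sets phi (fun i => gen_subalgebra [set T i]).

End Freeness.

(* [alternating_sum S n] is the sum, over all i_1 <> i_2 <> ... <> i_n, of the
   (ordered) products S_(i_1) S_(i_2) ... S_(i_n). *)
Definition alternating (N n : nat) (w : n.-tuple 'I_N) : bool :=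
  sorted (fun i j => i != j) w.

Definition alternating_sum (A : pzRingType) (N : nat) (S : 'I_N -> A) (n : nat)
    : A :=
  \sum_(w : n.-tuple 'I_N | alternating w) \prod_(i <- w) S i.

(* Formal power series in z over a ring A, as sequences of coefficients. *)
Section FormalSeries.
Context {A : pzRingType}.
Implicit Types f g : nat -> A.

Definition fps_mul f g : nat -> A :=
  fun n => \sum_(i < n.+1) f i * g (n - i)%N.

Definition fps_one : nat -> A := fun n => (n == 0%N)%:R.

Definition fps_inverse f g : Prop :=
  fps_mul f g =1 fps_one /\ fps_mul g f =1 fps_one.

(* 1 + sum_(n >= 1) sum_(i_1 <> ... <> i_n) s_(i_1) ... s_(i_n). When the s_i
   have no constant term, words of length > m do not contribute to the
   coefficient of z^m, whence the bound on n. *)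
Definition fps_alternating_sum (N : nat) (s : 'I_N -> nat -> A) : nat -> A :=
  fun m => fps_one m +
    \sum_(1 <= n < m.+1) \sum_(w : n.-tuple 'I_N | alternating w)
      (\big[fps_mul/fps_one]_(i <- w) s i) m.

End FormalSeries.

Section FormalRTransform.
Context {F : fieldType} {A : algType F}.
Implicit Types (phi : A -> F) (r : nat -> F) (a : A).

(* The formal power series z (K(z) - a) = 1 + r(z) - z a, where
   K(z) = (1 + r(z)) / z. *)
Definition fps_zKsub r a : nat -> A :=
  fun n => fps_one n + (r n)%:A - (n == 1%N)%:R *: a.

(* K(z) = (1 + r(z)) / z satisfies phi ((K(z) - a)^-1) = z as formal series:
   (K(z) - a)^-1 = z u(z) where u is the inverse of z (K(z) - a). *)
Definition formal_R_transform phi a r : Prop :=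
  r 0%N = 0 /\
  exists2 u : nat -> A, fps_inverse (fps_zKsub r a) u &
    (forall n, phi (u n) = fps_one n).

End FormalRTransform.

Section CStarProbability.
Context {R : realType} {A : cstarAlgType R}.
Local Notation C := R[i].
Implicit Types (phi : A -> C) (a x : A) (Rf : C -> C) (z : C).

Definition is_state phi : Prop :=
  phi 1 = 1 /\ forall x, 0 <= phi (star x * x).

Definition faithful phi : Prop := forall x, phi (star x * x) = 0 -> x = 0.

Definition tracial phi : Prop := forall x y, phi (x * y) = phi (y * x).

(* Freeness of the *-subalgebras generated by the T i. *)
Definition star_freely_independent phi (I : eqType) (T : I -> A) : Prop :=
  free_sets phi (fun i => gen_subalgebra [set T i; star (T i)]).

(* As for the norm of a normed module over R[i], the value is a nonnegative real
   number seen in R[i]; [<=] on R[i] only compares numbers with the same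
   imaginary part. *)
Definition norm2 phi x : C := sqrtC (phi (star x * x)).

(* iota : A -> H exhibits the Banach space H as L^2(phi), the (separated)
   completion of A for norm2 phi. *)
Definition is_L2 phi (H : completeNormedModType C) (iota : {linear A -> H})
    : Prop :=
  (forall x, `|iota x| = norm2 phi x) /\ dense (range iota).

(* xi in L^2(phi) satisfies a xi = 1, where a acts on L^2(phi) by the
   continuous extension of left multiplication by a. *)
Definition L2_inverse (H : completeNormedModType C) (iota : {linear A -> H})
    a (xi : H) : Prop :=
  exists2 L : {linear H -> H},
    continuous L /\ (forall x, L (iota x) = iota (a * x)) & L xi = iota 1.

Definition cauchy_transform phi a (zeta : C) : C :=
  phi ((zeta%:A - a)^-1).

Definition K_of Rf z : C := z^-1 * (1 + Rf z).

(* The function Rf is analytic at 0, vanishes there, and K(z) = (1 + Rf(z)) / z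
   is the inverse under composition of the Cauchy transform of a near infinity.
   Only the germ of Rf at 0 is constrained. *)
Definition R_transform phi a Rf : Prop :=
  [/\ exists2 c : nat -> C, c 0%N = 0 &
        \forall z \near (0 : C), series (fun n => c n * z ^+ n) @ \oo --> Rf z,
      \forall z \near (0 : C)^', cauchy_transform phi a (K_of Rf z) = z
    & exists M : C, forall zeta : C, M < `|zeta| ->
        K_of Rf (cauchy_transform phi a zeta) = zeta].

Definition S_of Rf a z : A := z^-1 *: ((K_of Rf z)%:A - a)^-1 - 1.

End CStarProbability.

(* Main.v *)
(** Write [X_i = z (K_i(z) - T_i)], so that [X_i (1 + S_i) = 1] and the resolvent of
    [sum_i T_i] at [K(z)] is the inverse of [z^-1 (1 + sum_i (X_i - 1))]. In any ring,
    multiplying the latter by [z] times the [n]-th partial sum of the alternating series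
    leaves [1 - sum_i X_i W_i], where [W_i] collects the words of length [n + 1] with first
    letter [i]. This one identity gives the formal statement (in the ring of power
    series), the norm convergence near 0, and the [L^2] convergence.

    Freeness extends to norm closures, and makes words with different first letters
    orthogonal; so the squared norm of the partial sums is the same alternating sum in the
    [q_i = ||S_i||_2^2], which converges exactly when [sum_i q_i / (1 + q_i) < 1].

    The R-transform comes from the quadratic recursion obtained by applying [phi] to
    [(1 + r - z a) u = 1], whose solution is unique in a ball.

    Invertibility of the resolvent avoids Haagerup-type inequalities: splitting each
    [(X_i - 1) y] into its components on and off the words starting with [i] gives
    two triangular contractive systems, hence [||y||_2 <= c ||(K - sum_i T_i) y||_2]. Since
    [phi] is faithful, a form bounded below on a closed *-subalgebra comes from an
    invertible element; no functional calculus beyond the square root is needed. *)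

Require Import Defs.
From HB Require Import structures.
From mathcomp Require Import all_boot all_order all_algebra.
From mathcomp Require Import all_classical all_reals all_analysis.
From mathcomp Require Import ring lra.

Set Implicit Arguments.
Unset Strict Implicit.
Unset Printing Implicit Defensive.

Import Order.TTheory GRing.Theory Num.Theory.
Import numFieldNormedType.Exports.

Local Open Scope classical_set_scope.
Local Open Scope ring_scope.
Local Open Scope complex_scope.

(** * Alternating words and the telescoping identity *)

Section AlternatingWords.
Context (B : pzRingType) (N : nat).
Implicit Types (S X : 'I_N -> B).

(* The sum of the alternating words of length [n.+1] with first letter [i]. *)
Fixpoint alt_head S n i : B :=
  if n is n'.+1 then S i * \sum_(j | i != j) alt_head S n' j else S i.

Let alt_after S n i : B :=
  \sum_(w : n.-tuple 'I_N | path (fun i j => i != j) i w) \prod_(j <- w) S j.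

Let sum_tuple_cons n (P : pred (seq 'I_N)) (F : seq 'I_N -> B) :
  \sum_(w : n.+1.-tuple 'I_N | P w) F w =
  \sum_i \sum_(w : n.-tuple 'I_N | P (i :: w)) F (i :: w).
Proof.
rewrite pair_big_dep /=.
rewrite (reindex (fun p : 'I_N * n.-tuple 'I_N => [tuple of p.1 :: p.2])) //=.
exists (fun w => (thead w, [tuple of behead w])) => [[i w] _|w _] /=.
  by congr (_, _); apply: val_inj.
by rewrite -tuple_eta.
Qed.

Let alt_after0 S i : alt_after S 0 i = 1.
Proof.
rewrite /alt_after (big_pred1 [tuple]) ?big_nil // => w.
by rewrite tuple0 /= eqxx.
Qed.

Let alt_afterS S n i :
  alt_after S n.+1 i = \sum_(j | i != j) S j * alt_after S n j.
Proof.
rewrite /alt_after (@sum_tuple_cons n (fun w => path _ i w)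
  (fun w => \prod_(j <- w) S j)) /= [RHS]big_mkcond /=.
apply: eq_bigr => j _; case: ifP => ij; last by rewrite big1.
by rewrite big_distrr /=; apply: eq_bigr => w _; rewrite big_cons.
Qed.

Let alt_headE S n i : alt_head S n i = S i * alt_after S n i.
Proof.
elim: n i => [|n IHn] i /=; first by rewrite alt_after0 mulr1.
by rewrite alt_afterS; congr (_ * _); apply: eq_bigr => j _; exact: IHn.
Qed.

Lemma alternating_sumS S n : alternating_sum S n.+1 = \sum_i alt_head S n i.
Proof.
rewrite /alternating_sum (@sum_tuple_cons n (fun w => sorted _ w)
  (fun w => \prod_(j <- w) S j)) /=.
apply: eq_bigr => i _; rewrite alt_headE big_distrr /=.
by apply: eq_bigr => w _; rewrite big_cons.
Qed.

Lemma sum_neq (F : 'I_N -> B) i : \sum_(j | i != j) F j = \sum_j F j - F i.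
Proof.
rewrite [X in _ = X - _](bigD1 i) //= addrAC subrr add0r.
by apply: eq_bigl => j; rewrite eq_sym.
Qed.

Definition alt_psum S n : B := 1 + \sum_(1 <= m < n.+1) alternating_sum S m.

Lemma alt_psum0 S : alt_psum S 0 = 1.
Proof. by rewrite /alt_psum big_nil addr0. Qed.

Lemma alt_psumS S n : alt_psum S n.+1 = alt_psum S n + \sum_i alt_head S n i.
Proof. by rewrite /alt_psum big_nat_recr //= addrA alternating_sumS. Qed.

(** Since [X i * S i = 1 - X i], the error at length [n + 1] is the sum of the terms
    [X i * a i - a i - (X i - 1) * A], where [a i] is the old head and [A] the sum of all heads: it
    is the old error minus what the new words [A] contribute to the product. *)
Lemma alt_psum_inverse X S : (forall i, X i * (1 + S i) = 1) ->
  forall n, (1 + \sum_i (X i - 1)) * alt_psum S n =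
            1 - \sum_i X i * alt_head S n i.
Proof.
move=> XS; have XSE i : X i * S i = 1 - X i.
  by rewrite -(XS i) mulrDr mulr1 addrAC subrr add0r.
elim=> [|n IHn].
  rewrite alt_psum0 mulr1 -sumrN; congr (1 + _); apply: eq_bigr => i _.
  by rewrite /= XSE opprB.
rewrite alt_psumS mulrDr IHn -addrA; congr (1 + _).
set a := fun i => alt_head S n i; set A := \sum_i a i.
have -> : \sum_i X i * alt_head S n.+1 i = \sum_i (X i * a i - a i - (X i - 1) * A).
  apply: eq_bigr => i _; rewrite /= sum_neq mulrA XSE -/A -/(a i).
  by rewrite mulrBr -[X in _ = _ - X * _]opprB mulNr opprK (mulrBl (a i)) mul1r opprB addrC.
rewrite !sumrB -mulr_suml -/A mulrDl mul1r -[_ - \sum_i 1]sumrB.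
by rewrite !opprB [RHS]addrA addrC addrAC [_ + A]addrC addrA.
Qed.

End AlternatingWords.

(** * Formal power series *)

(* [nat -> A] carries the pointwise product; this alias carries the Cauchy one. *)
Definition fps (A : pzRingType) := nat -> A.

HB.instance Definition _ (A : pzRingType) := GRing.Zmodule.copy (fps A) (nat -> A).

Section FpsRing.
Context (A : pzRingType).
Implicit Types f g h : fps A.

Let fps_mul_rev f g n : fps_mul f g n = \sum_(i < n.+1) f (n - i)%N * g i.
Proof.
rewrite /fps_mul (reindex_inj rev_ord_inj) /=; apply: eq_bigr => i _.
by rewrite subSS subKn // -ltnS.
Qed.

Let fps_mulA : associative (@fps_mul A).
Proof.
move=> f g h; apply/funext => i; rewrite [LHS]/fps_mul [RHS]fps_mul_rev.
pose coef3 j k := f j * (g (i - j - k)%N * h k).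
transitivity (\sum_(j < i.+1) \sum_(k < i.+1 | (k <= i - j)%N) coef3 j k).
  apply: eq_bigr => /= j _; rewrite fps_mul_rev big_distrr /=.
  by rewrite (big_ord_narrow_leq (leq_subr _ _)).
rewrite (exchange_big_dep predT) //=; apply: eq_bigr => k _.
transitivity (\sum_(j < i.+1 | (j <= i - k)%N) coef3 j k).
  apply: eq_bigl => j; rewrite -ltnS -(ltnS j) -!subSn ?leq_ord //.
  by rewrite -subn_gt0 -(subn_gt0 j) -!subnDA addnC.
rewrite (big_ord_narrow_leq (leq_subr _ _)) /fps_mul big_distrl /=.
by apply: eq_bigr => j _; rewrite /coef3 -!subnDA addnC mulrA.
Qed.

Let fps_mul1f : left_id (@fps_one A) (@fps_mul A).
Proof.
move=> f; apply/funext => n; rewrite /fps_mul big_ord_recl /= subn0 mul1r.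
by rewrite big1 ?addr0 // => i _; rewrite /fps_one /= mul0r.
Qed.

Let fps_mulf1 : right_id (@fps_one A) (@fps_mul A).
Proof.
move=> f; apply/funext => n; rewrite fps_mul_rev big_ord_recl /= subn0 mulr1.
by rewrite big1 ?addr0 // => i _; rewrite /fps_one /= mulr0.
Qed.

Let fps_mulDl : left_distributive (@fps_mul A) (+%R : fps A -> fps A -> fps A).
Proof.
move=> f g h; apply/funext => n.
transitivity (fps_mul f h n + fps_mul g h n) => //.
by rewrite /fps_mul -big_split /=; apply: eq_bigr => i _; rewrite -mulrDl.
Qed.

Let fps_mulDr : right_distributive (@fps_mul A) (+%R : fps A -> fps A -> fps A).
Proof.
move=> f g h; apply/funext => n.
transitivity (fps_mul f g n + fps_mul f h n) => //.
by rewrite /fps_mul -big_split /=; apply: eq_bigr => i _; rewrite -mulrDr.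
Qed.

HB.instance Definition _ := @GRing.Zmodule_isPzRing.Build (fps A) (@fps_one A)
  (@fps_mul A) fps_mulA fps_mul1f fps_mulf1 fps_mulDl fps_mulDr.

Lemma fpsD f g n : (f + g) n = f n + g n. Proof. by []. Qed.
Lemma fpsN f n : (- f) n = - f n. Proof. by []. Qed.
Lemma fpsM f g n : (f * g) n = \sum_(i < n.+1) f i * g (n - i)%N.
Proof. by []. Qed.
Lemma fps1E n : (1 : fps A) n = (n == 0%N)%:R. Proof. by []. Qed.

Lemma fps_sumE I (r : seq I) (P : pred I) (F : I -> fps A) n :
  (\sum_(i <- r | P i) F i) n = \sum_(i <- r | P i) F i n.
Proof. by elim/big_rec2: _ => //= i y x _ <-. Qed.

Lemma fps_mulS f g n : (f * g) n.+1 =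
  f 0%N * g n.+1 + \sum_(i < n.+1) f i.+1 * g (n - i)%N.
Proof.
by rewrite fpsM big_ord_recl subn0; congr (_ + _); apply: eq_bigr.
Qed.

Lemma fps_inverseP f g : fps_inverse f g <-> f * g = 1 /\ g * f = 1.
Proof.
by split=> [[fg gf]|[fg gf]]; split; [exact/funext|exact/funext|move=> n..];
   [exact: (congr1 (@^~ n) fg)|exact: (congr1 (@^~ n) gf)].
Qed.

Definition vanishing k f := forall m, (m < k)%N -> f m = 0.

Lemma vanishingM k l f g :
  vanishing k f -> vanishing l g -> vanishing (k + l) (f * g).
Proof.
move=> fk gl m mkl; rewrite fpsM big1 // => i _.
have [/fk->|ki] := ltnP i k; first by rewrite mul0r.
by rewrite gl ?mulr0 // ltn_subLR; [exact: leq_trans mkl (leq_add _ _)|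
  rewrite -ltnS].
Qed.

Lemma vanishing_sum k I (r : seq I) (P : pred I) (F : I -> fps A) :
  (forall i, P i -> vanishing k (F i)) -> vanishing k (\sum_(i <- r | P i) F i).
Proof. by move=> Fk m mk; rewrite fps_sumE big1 // => i /Fk->. Qed.

(* The limit of a sequence of series whose coefficients are eventually constant. *)
Lemma fps_diagonal_inverse f (P : nat -> fps A) :
  (forall n, vanishing n.+1 (P n.+1 - P n)) ->
  (forall n, vanishing n.+1 (f * P n - 1)) ->
  f * (fun m => P m m : A) = 1.
Proof.
move=> Pn fP; apply/funext => m; rewrite fpsM.
have Pmk k : (k <= m)%N -> P m k = P k k.
  move=> /subnK <-; elim: (m - k)%N => // d <-.
  by apply/eqP; rewrite -subr_eq0; apply/eqP; apply: Pn; rewrite ltnS leq_addl.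
rewrite -[RHS]addr0 -[X in _ = _ + X](fP m m) // fpsD addrC fpsN subrK fpsM.
by apply: eq_bigr => i _; rewrite Pmk ?leq_subr.
Qed.

(** A right inverse is the geometric series in [1 - f], whose powers vanish to increasing order. It
    has constant term 1 too, hence a right inverse of its own, which must be [f]. *)
Lemma fps_unit f : f 0%N = 1 -> exists g, f * g = 1 /\ g * f = 1.
Proof.
have right_inverse h : h 0%N = 1 -> exists g, h * g = 1 /\ g 0%N = 1.
  move=> h0; set e := 1 - h; pose P n := \sum_(k < n.+1) e ^+ k.
  have en n : vanishing n (e ^+ n).
    elim: n => [|n IHn] //; rewrite exprS -add1n; apply: vanishingM => // -[] // _.
    by rewrite /e fpsD fpsN h0 fps1E subrr.
  have hP n : h * P n = 1 - e ^+ n.+1.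
    rewrite -[h](subKr 1) -/e /P; elim: n => [|n IHn].
      by rewrite big_ord1 expr0 mulr1 expr1.
    by rewrite big_ord_recr /= mulrDr IHn mulrBl mul1r -exprS addrA subrK.
  exists (fun m => P m m : A); split.
    apply: fps_diagonal_inverse => n; first by rewrite /P big_ord_recr /= addrAC subrr add0r.
    by rewrite hP addrAC subrr add0r => m mn; rewrite fpsN en ?oppr0.
  by rewrite /P big_ord1.
move=> f0; have [g [fg g0]] := right_inverse f f0; exists g; split=> //.
have [k [gk _]] := right_inverse g g0.
suff -> : f = k by [].
by rewrite -[LHS]mulr1 -gk mulrA fg mul1r.
Qed.

Lemma fps_inverse_right f g : f 0%N = 1 -> f * g = 1 -> fps_inverse f g.
Proof.
move=> /fps_unit [h [_ hf]] fg; apply/fps_inverseP; split=> //.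
by rewrite -[g]mul1r -hf -(mulrA h) fg mulr1 hf.
Qed.

Lemma fps_alternating_sumE N (s : 'I_N -> fps A) :
  fps_alternating_sum s = fun m => alt_psum s m m.
Proof.
apply/funext => m; rewrite /alt_psum fpsD; congr (_ + _).
rewrite fps_sumE; apply: eq_bigr => n _.
by rewrite /alternating_sum fps_sumE.
Qed.

End FpsRing.

(** * Centred words over free subalgebras *)

Section FreeWords.
Context {F : fieldType} {A : algType F} (phi : {scalar A}) {I : eqType}.
Variable B : I -> set A.

(* Products [a_0 a_1 ... a_n] of centered elements of neighbouring-distinct
   subalgebras [B i_0, B i_1, ...], indexed by [i_0]. *)
Inductive free_word : I -> set A :=
| free_word1 i a : B i a -> phi a = 0 -> free_word i a
| free_wordS i j a w : i != j -> B i a -> phi a = 0 -> free_word j w ->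
    free_word i (a * w).

Lemma free_word0 i w : free_sets phi B -> free_word i w -> phi w = 0.
Proof.
move=> freeB wi.
have [n [f [a [_ fa f_neq ->]]]] : exists n f a,
    [/\ f 0%N = i, forall j, (j <= n)%N -> B (f j) (a j) /\ phi (a j) = 0,
        forall j, (j < n)%N -> f j != f j.+1 &
        w = \prod_(0 <= j < n.+1) a j].
  elim: wi => {i w} [i a ia a0|i j a w ij ia a0 _ [n [f [b [f0 fb f_neq ->]]]]].
    by exists 0%N, (fun=> i), (fun=> a); split; rewrite ?big_nat1.
  exists n.+1, (fun k => if k is k'.+1 then f k' else i),
    (fun k => if k is k'.+1 then b k' else a).
  split=> //; [by case|by case=> [|k] ?; rewrite ?f0 //; exact: f_neq|].
  by rewrite [RHS]big_nat_recl.
exact: (freeB n f a).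
Qed.

(** The inductive form reduces a linear statement about the span to its generators by one
    induction. *)
Inductive lin_span (W : set A) : set A :=
| lin_span0 : lin_span W 0
| lin_spanD c w x : W w -> lin_span W x -> lin_span W (c *: w + x).

Lemma lin_span_gen (W : set A) w : W w -> lin_span W w.
Proof.
by move=> Ww; rewrite -[w]scale1r -[_ *: _]addr0; apply/lin_spanD/lin_span0.
Qed.

Lemma lin_span_add (W : set A) x y :
  lin_span W x -> lin_span W y -> lin_span W (x + y).
Proof.
elim=> [|c w {}x Ww _ IHx] Wy; first by rewrite add0r.
by rewrite -addrA; apply: lin_spanD => //; exact: IHx.
Qed.

Lemma lin_span_scale (W : set A) c x : lin_span W x -> lin_span W (c *: x).
Proof.
elim=> [|d w {}x Ww _ IHx]; first by rewrite scaler0; exact: lin_span0.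
by rewrite scalerDr scalerA; exact: lin_spanD.
Qed.

Lemma lin_span_opp (W : set A) x : lin_span W x -> lin_span W (- x).
Proof. by rewrite -scaleN1r; exact: lin_span_scale. Qed.

Lemma lin_span_sum (W : set A) (J : Type) (r : seq J) (P : pred J) (f : J -> A) :
  (forall j, P j -> lin_span W (f j)) -> lin_span W (\sum_(j <- r | P j) f j).
Proof.
move=> Wf; elim/big_rec: _ => [|j x Pj Wx]; first exact: lin_span0.
by apply: lin_span_add => //; exact: Wf.
Qed.

(** The algebraic counterpart of the subspace of a free product Hilbert space spanned by the reduced
    words that start in the factor [i]. *)
Definition head_span i : set A := lin_span (free_word i).

Lemma head_span0 i x : free_sets phi B -> head_span i x -> phi x = 0.
Proof.
move=> freeB; elim=> [|c w {}x wi _ IHx]; first by rewrite linear0.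
by rewrite linearP IHx (free_word0 freeB wi) mulr0 addr0.
Qed.

Lemma head_span1 i a : B i a -> phi a = 0 -> head_span i a.
Proof. by move=> ia a0; apply/lin_span_gen/free_word1. Qed.

Lemma head_spanM i j a x : i != j -> B i a -> phi a = 0 -> head_span j x ->
  head_span i (a * x).
Proof.
move=> ij ia a0; elim=> [|c w {}x wj _ IHx]; first by rewrite mulr0; exact: lin_span0.
by rewrite mulrDr -scalerAr; apply: lin_spanD => //; exact: free_wordS wj.
Qed.

End FreeWords.

Section Subalgebras.
Context {F : fieldType} {A : algType F}.
Implicit Types (S X : set A).

Definition subalgebra S := [/\ S 1, forall c x y, S x -> S y -> S (c *: x + y) &
  forall x y, S x -> S y -> S (x * y)].

Lemma subalgebraP S : GRing.subalg_closed (mem S) <-> subalgebra S.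
Proof.
split=> [[S1 SZ SM]|[S1 SZ SM]]; split.
- by have := S1; rewrite inE.
- by move=> c x y Sx Sy; have := SZ c x y; rewrite !inE; apply.
- by move=> x y Sx Sy; have := SM x y; rewrite !inE; apply.
- by rewrite inE.
- by move=> c x y; rewrite !inE; exact: SZ.
- by move=> x y; rewrite !inE; exact: SM.
Qed.

Lemma gen_subalgebraP X : subalgebra (gen_subalgebra X).
Proof.
by split=> [S [/subalgebraP[]]//|c x y Sx Sy S XS|x y Sx Sy S XS];
   have /subalgebraP[_ SZ SM] := XS.1; [apply: SZ|apply: SM];
   first [exact: Sx|exact: Sy].
Qed.

Lemma gen_subalgebra_gen X : X `<=` gen_subalgebra X.
Proof. exact: sub_smallest. Qed.

Lemma gen_subalgebra_min X S : subalgebra S -> X `<=` S -> gen_subalgebra X `<=` S.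
Proof. by move=> /subalgebraP SS XS; exact: smallest_sub. Qed.

Context {S : set A} (algS : subalgebra S).

Lemma subalg1 : S 1. Proof. by case: algS. Qed.
Lemma subalgZD c x y : S x -> S y -> S (c *: x + y).
Proof. by case: algS => _ /(_ c x y). Qed.
Lemma subalgM x y : S x -> S y -> S (x * y).
Proof. by case: algS => _ _ /(_ x y). Qed.
Lemma subalg0 : S 0.
Proof. by rewrite -(subrr 1) -scaleN1r addrC; apply: subalgZD; exact: subalg1. Qed.
Lemma subalgZ c x : S x -> S (c *: x).
Proof. by move=> Sx; rewrite -[_ *: _]addr0; apply: subalgZD => //; exact: subalg0. Qed.
Lemma subalgD x y : S x -> S y -> S (x + y).
Proof. by move=> Sx Sy; rewrite -[x]scale1r; exact: subalgZD. Qed.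
Lemma subalgB x y : S x -> S y -> S (x - y).
Proof. by move=> Sx Sy; rewrite addrC -scaleN1r; exact: subalgZD. Qed.
Lemma subalg_alg c : S c%:A. Proof. exact: subalgZ subalg1. Qed.
Lemma subalg_sum J (r : seq J) (P : pred J) (f : J -> A) :
  (forall j, P j -> S (f j)) -> S (\sum_(j <- r | P j) f j).
Proof.
move=> Sf; elim/big_rec: _ => [|j x Pj Wx]; first exact: subalg0.
by apply: subalgD => //; exact: Sf.
Qed.

End Subalgebras.

(** * The formal R-transform *)

Section FormalRTransformTheory.
Context {F : fieldType} {A : algType F}.
Implicit Types (phi : {scalar A}) (r : nat -> F) (a : A) (u : nat -> A).

Lemma fps_zKsub_rec r a u : r 0%N = 0 ->
  (fps_zKsub r a : fps A) * u = 1 <->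
  u 0%N = 1 /\ forall m, u m.+1 = a * u m - \sum_(j < m.+1) r j.+1 *: u (m - j)%N.
Proof.
move=> r0.
have zK0 : fps_zKsub r a 0%N = 1.
  by rewrite /fps_zKsub /= r0 !scale0r /fps_one /= addr0 subr0.
have zKu m : ((fps_zKsub r a : fps A) * u) m.+1 =
    u m.+1 - (a * u m - \sum_(j < m.+1) r j.+1 *: u (m - j)%N).
  rewrite fps_mulS zK0 mul1r opprB; congr (_ + _).
  transitivity (\sum_(j < m.+1) (r j.+1 *: u (m - j)%N -
                                 (j == 0%N :> nat)%:R *: (a * u (m - j)%N))).
    apply: eq_bigr => j _; rewrite /fps_zKsub /fps_one /= add0r mulrBl.
    by rewrite -!scalerAl mul1r eqSS.
  rewrite sumrB; congr (_ - _); rewrite big_ord_recl /= scale1r subn0.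
  by rewrite big1 ?addr0 // => j _; rewrite scale0r.
split=> [zKu1|[u0 uS]].
  split=> [|m].
    by have := congr1 (@^~ 0%N) zKu1; rewrite /= fpsM big_ord1 zK0 mul1r.
  apply/eqP; rewrite -subr_eq0 -zKu zKu1; exact/eqP.
apply/funext => -[|m]; first by rewrite fpsM big_ord1 zK0 mul1r.
by rewrite zKu uS subrr.
Qed.

(* Applying [phi] to [(1 + r(z) - z a) u(z) = 1] with [phi u(z) = 1] gives
   [r(z) = z phi(a u(z))], whence a recursion for the coefficients of [u]. *)
Fixpoint resolvent_iter phi a k : nat -> A :=
  if k is k'.+1 then fun n =>
    let u := resolvent_iter phi a k' in
    if n is m.+1 then a * u m - \sum_(j < m.+1) phi (a * u j) *: u (m - j)%N else 1
  else fun=> 0.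

(** The recursion uses all earlier coefficients, so it is run with fuel; the iterate with fuel [k]
    is correct at all indices below [k]. *)
Definition resolvent_coef phi a n : A := resolvent_iter phi a n.+1 n.

Definition R_coef phi a n : F :=
  if n is m.+1 then phi (a * resolvent_coef phi a m) else 0.

Let resolvent_iterS phi a k m : resolvent_iter phi a k.+1 m.+1 =
  a * resolvent_iter phi a k m -
  \sum_(j < m.+1) phi (a * resolvent_iter phi a k j) *: resolvent_iter phi a k (m - j).
Proof. by []. Qed.

Lemma resolvent_coefE phi a k n : (n < k)%N ->
  resolvent_iter phi a k n = resolvent_coef phi a n.
Proof.
elim/ltn_ind: n k => -[|m] IH [|k] // mk; rewrite /resolvent_coef !resolvent_iterS.
have E j l : (j <= m)%N -> (m < l)%N ->
    resolvent_iter phi a l j = resolvent_coef phi a j.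
  by move=> jm ml; apply: IH => //; exact: leq_ltn_trans ml.
rewrite E // [in RHS]E //; congr (_ - _); apply: eq_bigr => j _.
by rewrite !E ?leq_subr // -ltnS.
Qed.

Lemma resolvent_coef0 phi a : resolvent_coef phi a 0 = 1.
Proof. by []. Qed.

Lemma resolvent_coefS phi a m : resolvent_coef phi a m.+1 =
  a * resolvent_coef phi a m -
  \sum_(j < m.+1) R_coef phi a j.+1 *: resolvent_coef phi a (m - j).
Proof.
rewrite {1}/resolvent_coef resolvent_iterS.
rewrite resolvent_coefE //; congr (_ - _); apply: eq_bigr => j _.
by rewrite /R_coef !resolvent_coefE // ltnS leq_subr.
Qed.

(** By induction only the summand [j = m] has nonzero expectation, and its coefficient
    [R_coef phi a m.+1] was chosen to be [phi (a * resolvent_coef phi a m)]. *)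
Lemma phi_resolvent_coef phi a n : phi 1 = 1 ->
  phi (resolvent_coef phi a n) = fps_one n.
Proof.
move=> phi1; elim/ltn_ind: n => -[|m] IH; first by rewrite resolvent_coef0.
rewrite resolvent_coefS linearB linear_sum /= big_ord_recr /= subnn.
rewrite resolvent_coef0 linearZ /= phi1 mulr1 big1 ?add0r ?subrr // => j _.
rewrite linearZ /= IH ?ltnS ?leq_subr // /fps_one subn_eq0 leqNgt ltn_ord.
by rewrite mulr0.
Qed.

Lemma formal_R_transform_unique phi a : phi 1 = 1 ->
  exists! r, formal_R_transform phi a r.
Proof.
move=> phi1; exists (R_coef phi a); split.
  split=> //; exists (resolvent_coef phi a) => [|n]; last exact: phi_resolvent_coef.
  apply: fps_inverse_right.
    by rewrite /fps_zKsub /= !scale0r /fps_one /= addr0 subr0.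
  apply/fps_zKsub_rec => //; split=> // m; exact: resolvent_coefS.
move=> r [r0 [u /fps_inverseP[zKu _] phiu]].
have [u0 uS] := (fps_zKsub_rec a u r0).1 zKu.
have rS m : r m.+1 = phi (a * u m).
  apply/eqP; rewrite eq_sym -subr_eq0; apply/eqP.
  have := phiu m.+1; rewrite uS linearB linear_sum /= big_ord_recr /= subnn.
  rewrite u0 linearZ /= phi1 mulr1 big1 ?add0r // => j _.
  rewrite linearZ /= phiu /fps_one subn_eq0 leqNgt ltn_ord.
  by rewrite mulr0.
have uE n : u n = resolvent_coef phi a n.
  elim/ltn_ind: n => -[|m] IH; first by rewrite u0.
  rewrite uS resolvent_coefS IH //; congr (_ - _); apply: eq_bigr => j _.
  by rewrite rS /R_coef !IH // ltnS ?leq_subr // -ltnS.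
by apply/funext => -[|m] //=; rewrite rS uE.
Qed.

End FormalRTransformTheory.

(** * The formal resolvent of a free sum *)

Section FormalSum.
Context {F : fieldType} {A : algType F} (phi : {scalar A}).
Context {N : nat} (T : 'I_N -> A) (r : 'I_N -> nat -> F) (s : 'I_N -> fps A).
Hypothesis phi1 : phi 1 = 1.
Hypothesis freeT : freely_independent phi T.
Hypothesis r0 : forall i, r i 0%N = 0.
Hypothesis zKs : forall i,
  fps_inverse (fps_zKsub (r i) (T i)) (fun n => fps_one n + s i n).
Hypothesis phis : forall i n, phi (s i n) = 0.

Let zK_right i : (fps_zKsub (r i) (T i) : fps A) * (1 + s i) = 1.
Proof. by have /fps_inverseP[] := zKs i. Qed.

(** The recursion exhibits each coefficient as a polynomial in [T i], so that freeness applies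
    coefficientwise. *)
Let s_alg i n : gen_subalgebra [set T i] (s i n).
Proof.
have algT := gen_subalgebraP [set T i].
have [u0 uS] := (fps_zKsub_rec (T i) (1 + s i) (r0 i)).1 (zK_right i).
have : gen_subalgebra [set T i] ((1 + s i) n).
  elim/ltn_ind: n => -[|m] IH; first by rewrite u0; exact: (subalg1 algT).
  rewrite uS; apply: (subalgB algT).
    by apply: (subalgM algT); [exact: gen_subalgebra_gen|exact: IH].
  apply: (subalg_sum algT) => j _; apply: (subalgZ algT); apply: IH.
  by rewrite ltnS leq_subr.
rewrite fpsD => /(subalgB algT) /(_ (subalg_alg algT (n == 0%N)%:R)).
by rewrite fps1E scaler_nat addrAC subrr add0r.
Qed.

Let s0 i : s i 0%N = 0.
Proof.
have [u0 _] := (fps_zKsub_rec (T i) (1 + s i) (r0 i)).1 (zK_right i).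
by move: u0; rewrite fpsD -[X in _ = X]addr0 => /addrI.
Qed.

(** Each letter contributes at least one power of [z]; this is what makes the infinite sum of words
    a well-defined formal series. *)
Let alt_head_vanishing n i : vanishing n.+1 (alt_head s n i).
Proof.
have s1 j : vanishing 1 (s j) by case=> // _; exact: s0.
elim: n i => [|n IHn] i //=; rewrite -addn1 addnC; apply: vanishingM => //.
by apply: vanishing_sum => j _; exact: IHn.
Qed.

Lemma fps_alternating_sum_inverse :
  fps_inverse (fps_zKsub (fun n => \sum_i r i n) (\sum_i T i))
              (fps_alternating_sum s).
Proof.
set X : 'I_N -> fps A := fun i => fps_zKsub (r i) (T i).
have -> : fps_zKsub (fun n => \sum_i r i n) (\sum_i T i) = 1 + \sum_i (X i - 1).
  apply/funext => n; rewrite fpsD fps_sumE /fps_zKsub -addrA; congr (_ + _).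
  rewrite scaler_sumr scaler_suml -sumrB; apply: eq_bigr => i _.
  by rewrite fpsD /X /fps_zKsub fpsN fps1E /fps_one [RHS]addrC !addrA addNr add0r.
have XP := alt_psum_inverse zK_right.
apply: fps_inverse_right.
  rewrite fpsD fps_sumE big1 ?addr0 // => i _.
  by rewrite fpsD fpsN /X /fps_zKsub /= r0 !scale0r addr0 subr0 subrr.
rewrite fps_alternating_sumE; apply: fps_diagonal_inverse => n.
  rewrite alt_psumS addrAC subrr add0r.
  by apply: vanishing_sum => i _; exact: alt_head_vanishing.
rewrite XP addrAC subrr add0r => m mn; rewrite fpsN; apply/eqP; rewrite oppr_eq0.
apply/eqP; move: m mn; apply: vanishing_sum => i _; rewrite -[n.+1]add0n.
by apply: vanishingM => //; exact: alt_head_vanishing.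
Qed.

Lemma phi_fps_alternating_sum n : phi (fps_alternating_sum s n) = fps_one n.
Proof.
pose B i := gen_subalgebra [set T i].
have alt_span m k i : head_span phi B i (alt_head s m i k).
  elim: m k i => [|m IHm] k i /=; first by apply: head_span1; [exact: s_alg|].
  rewrite fpsM; apply: lin_span_sum => l _; rewrite fps_sumE mulr_sumr.
  apply: lin_span_sum => j ij; apply: head_spanM ij _ _ (IHm _ _) => //.
  exact: s_alg.
(* The truncation order is separated from the coefficient index, so that the induction varies it
   alone. *)
rewrite fps_alternating_sumE; move: {1}n => k; elim: k => [|k IHk].
  rewrite alt_psum0 fps1E /fps_one; by case: (n == 0%N); rewrite ?linear0.
rewrite alt_psumS fpsD linearD /= IHk fps_sumE linear_sum big1 ?addr0 // => i _.
exact: head_span0 freeT (alt_span _ _ _).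
Qed.

End FormalSum.

(** * C*-algebras *)

Section ComplexModulus.
Context {R : realType}.
Implicit Types (c d : R[i]).

(** The modulus as an element of [R], where real inequalities and real limits apply. *)
Definition cabs c : R := complex.Re `|c|.

Lemma cabsE c : (cabs c)%:C = `|c|.
Proof. by rewrite /cabs normc_def. Qed.

Lemma cabs_ge0 c : 0 <= cabs c.
Proof. by rewrite -ler0c cabsE. Qed.

Lemma cabs0 : cabs 0 = 0. Proof. by rewrite /cabs normr0. Qed.
Lemma cabs1 : cabs 1 = 1. Proof. by rewrite /cabs normr1. Qed.
Lemma cabsN c : cabs (- c) = cabs c. Proof. by rewrite /cabs normrN. Qed.

Lemma cabsM c d : cabs (c * d) = cabs c * cabs d.
Proof. by apply: complexI; rewrite rmorphM /= !cabsE normrM. Qed.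

Lemma cabsV c : cabs c^-1 = (cabs c)^-1.
Proof. by apply: complexI; rewrite fmorphV /= !cabsE normfV. Qed.

Lemma cabsX c n : cabs (c ^+ n) = cabs c ^+ n.
Proof. by apply: complexI; rewrite rmorphXn /= !cabsE normrX. Qed.

Lemma cabs_eq0 c : (cabs c == 0) = (c == 0).
Proof. by rewrite -(inj_eq (@complexI R)) cabsE normr_eq0. Qed.

Lemma cabs_gt0 c : (0 < cabs c) = (c != 0).
Proof. by rewrite lt_neqAle cabs_ge0 andbT eq_sym cabs_eq0. Qed.

Lemma cabsD c d : cabs (c + d) <= cabs c + cabs d.
Proof. by rewrite -lecR rmorphD /= !cabsE ler_normD. Qed.

Lemma cabs_real (x : R) : cabs x%:C = `|x|.
Proof. by rewrite /cabs normc_def /= expr0n addr0 sqrtr_sqr. Qed.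

Lemma Re_le_cabs c : `|complex.Re c| <= cabs c.
Proof. by rewrite -lecR cabsE normc_ge_Re. Qed.

Lemma conjE c : Num.conj c = conjc c.
Proof.
have [->|c0] := eqVneq c 0; first by rewrite rmorph0 conjc0.
by apply: (mulfI c0); rewrite -normCK sqr_normc.
Qed.

Lemma conj_real (x : R) : Num.conj x%:C = x%:C.
Proof.
by apply/CrealP; rewrite complex_real.
Qed.

Lemma ge0_complex c : 0 <= c -> (complex.Re c)%:C = c.
Proof. by move=> c0; apply: RRe_real; rewrite realE c0. Qed.

Lemma sqr_cabs c : ((cabs c) ^+ 2)%:C = c * Num.conj c.
Proof. by rewrite rmorphXn /= cabsE normCK. Qed.

End ComplexModulus.

Section RealSequences.
Context {R : realType}.
Implicit Types (u v : nat -> R).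

Lemma cvgn0P u : u @ \oo --> (0 : R) <->
  forall e, 0 < e -> exists n0, forall n, (n0 <= n)%N -> `|u n| < e.
Proof.
split=> [/cvgr0Pnorm_lt u0 e /u0 [n0 _ un]|u0].
  by exists n0 => n /un.
by apply/cvgr0Pnorm_lt => e /u0 [n0 un]; exists n0 => // n /un.
Qed.

Lemma cvgn0_le u v : (forall n, 0 <= u n <= v n) -> v @ \oo --> (0 : R) ->
  u @ \oo --> (0 : R).
Proof.
move=> uv v0; apply: (squeeze_cvgr (f := cst 0) (h := v)) => //; last exact: cvg_cst.
by apply: nearW => n; exact: uv.
Qed.

Lemma cvgn0_mull k u : u @ \oo --> (0 : R) -> (fun n => k * u n) @ \oo --> (0 : R).
Proof. by move=> u0; rewrite -(mulr0 k); apply: cvgM => //; exact: cvg_cst. Qed.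

Lemma cvgn_le_cst u l k : u @ \oo --> l -> (forall n, u n <= k) -> l <= k.
Proof. by move=> ul uk; apply: (cvgr_to_le ul); exact: nearW. Qed.

Lemma cvgn0_sum (I : Type) (r : seq I) (P : pred I) (f : I -> nat -> R) :
  (forall i, P i -> f i @ \oo --> (0 : R)) ->
  (fun n => \sum_(i <- r | P i) f i n) @ \oo --> (0 : R).
Proof.
move=> f0; rewrite -(fct_sumE r P f); elim/big_ind: _ => [|u v u0 v0|i /f0//].
  exact: cvg_cst.
by rewrite -(addr0 0); exact: cvgD.
Qed.

Lemma cvgn_geometric (q : R) : 0 <= q -> q < 1 -> (fun n => q ^+ n) @ \oo --> (0 : R).
Proof. by move=> q0 q1; apply: (@cvg_expr R q); rewrite ger0_norm. Qed.

End RealSequences.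

Section CStarNorm.
Context {R : realType} {A : cstarAlgType R}.
Implicit Types (x y : A) (c : R[i]) (u v : nat -> A).

Local Notation nrm := (@cnorm R A).

Lemma cnormZE c x : nrm (c *: x) = cabs c * nrm x.
Proof. by apply: complexI; rewrite cnormZ rmorphM /= cabsE. Qed.

Lemma cnorm0 : nrm 0 = 0.
Proof. by rewrite -(scale0r 0) cnormZE cabs0 mul0r. Qed.

Lemma cnormN x : nrm (- x) = nrm x.
Proof. by rewrite -scaleN1r cnormZE cabsN cabs1 mul1r. Qed.

Lemma cnorm_ge0 x : 0 <= nrm x.
Proof.
have := cnormD x (- x); rewrite subrr cnorm0 cnormN -mulr2n pmulrn_lge0 //.
Qed.

Lemma cnormB x y : nrm (x - y) <= nrm x + nrm y.
Proof. by rewrite -(cnormN y) cnormD. Qed.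

Lemma cnorm_distC x y : nrm (x - y) = nrm (y - x).
Proof. by rewrite -cnormN opprB. Qed.

Lemma cnorm_dist x y z : nrm (x - z) <= nrm (x - y) + nrm (y - z).
Proof. by rewrite -[x - z](subrKA y) cnormD. Qed.

Lemma cnorm_sum I (r : seq I) (P : pred I) (f : I -> A) :
  nrm (\sum_(i <- r | P i) f i) <= \sum_(i <- r | P i) nrm (f i).
Proof.
elim/big_rec2: _ => [|i y x _ xy]; first by rewrite cnorm0.
exact: le_trans (cnormD _ _) (lerD _ _).
Qed.

Lemma star0 : star (0 : A) = 0.
Proof. by have := starZ (0 : R[i]) (0 : A); rewrite !scale0r rmorph0 scale0r. Qed.

Lemma starN x : star (- x) = - star x.
Proof. by rewrite -scaleN1r starZ rmorphN rmorph1 scaleN1r. Qed.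

Lemma starB x y : star (x - y) = star x - star y.
Proof. by rewrite starD starN. Qed.

Lemma star1 : star (1 : A) = 1.
Proof. by rewrite -[LHS]mulr1 -{2}[1]starK -starM mulr1 starK. Qed.

Lemma star_sum I (r : seq I) (P : pred I) (f : I -> A) :
  star (\sum_(i <- r | P i) f i) = \sum_(i <- r | P i) star (f i).
Proof.
by elim/big_rec2: _ => [|i y x _ <-]; [exact: star0|rewrite starD].
Qed.

Lemma star_alg c : star (c%:A : A) = (Num.conj c)%:A.
Proof. by rewrite starZ star1. Qed.

Lemma starZr (a : R) x : star (a%:C *: x) = a%:C *: star x.
Proof. by rewrite starZ conj_real. Qed.

Lemma cnorm_starE x : nrm (star x) = nrm x.
Proof.
have le_star y : nrm y <= nrm (star y).
  have := cnorm_ge0 y; rewrite le_eqVlt => /orP[/eqP <-|y0]; first exact: cnorm_ge0.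
  by rewrite -(ler_pM2r y0) -expr2 -cnorm_star cnormM.
by apply/eqP; rewrite eq_le le_star andbT -{2}[x]starK le_star.
Qed.

Lemma cnorm1 : nrm 1 = 1.
Proof.
have := cnorm_star (1 : A); rewrite star1 mulr1 expr2 => /eqP.
rewrite -{1}[nrm 1]mulr1 -subr_eq0 -mulrBr mulf_eq0 => /orP[/eqP/cnorm_eq0/eqP|].
  by rewrite oner_eq0.
by rewrite subr_eq0 => /eqP <-.
Qed.

Lemma cnorm_alg c : nrm c%:A = cabs c.
Proof. by rewrite cnormZE cnorm1 mulr1. Qed.

Lemma cnormX x n : nrm (x ^+ n) <= nrm x ^+ n.
Proof.
elim: n => [|n IHn]; first by rewrite !expr0 cnorm1.
by rewrite !exprS (le_trans (cnormM _ _)) // ler_wpM2l // cnorm_ge0.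
Qed.

(** [A] carries a norm function but no topology, so convergence is expressed through the real
    sequence of distances. *)
Definition ccvg u x : Prop := (fun n => nrm (u n - x)) @ \oo --> (0 : R).

Lemma ccvg_le u x (t : nat -> R) : (forall n, nrm (u n - x) <= t n) ->
  t @ \oo --> (0 : R) -> ccvg u x.
Proof. by move=> ut; apply: cvgn0_le => n; rewrite cnorm_ge0 ut. Qed.

Lemma ccvg_unique u x y : ccvg u x -> ccvg u y -> x = y.
Proof.
move=> ux uy; apply/eqP; rewrite -subr_eq0; apply/eqP/cnorm_eq0/le_anti.
rewrite cnorm_ge0 andbT.
have h0 : (fun n => nrm (u n - x) + nrm (u n - y)) @ \oo --> (0 : R).
  by rewrite -(addr0 0); exact: cvgD.
apply: (cvgr_to_ge h0); apply: nearW => n.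
by rewrite (cnorm_distC _ x) cnorm_dist.
Qed.

Lemma ccvg_cst x : ccvg (fun=> x) x.
Proof. by rewrite /ccvg subrr cnorm0; exact: cvg_cst. Qed.

Lemma ccvgD u v x y : ccvg u x -> ccvg v y -> ccvg (fun n => u n + v n) (x + y).
Proof.
move=> ux vy; apply: (@ccvg_le _ _ (fun n => nrm (u n - x) + nrm (v n - y))).
  by move=> n; rewrite opprD addrACA cnormD.
by rewrite -(addr0 0); exact: cvgD.
Qed.

Lemma ccvgMl a u x : ccvg u x -> ccvg (fun n => a * u n) (a * x).
Proof.
move=> ux; apply: (@ccvg_le _ _ (fun n => nrm a * nrm (u n - x))).
  by move=> n; rewrite -mulrBr cnormM.
exact: cvgn0_mull.
Qed.

Lemma ccvgMr a u x : ccvg u x -> ccvg (fun n => u n * a) (x * a).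
Proof.
move=> ux; apply: (@ccvg_le _ _ (fun n => nrm a * nrm (u n - x))).
  by move=> n; rewrite -mulrBl mulrC cnormM.
exact: cvgn0_mull.
Qed.

Lemma ccvgZ c u x : ccvg u x -> ccvg (fun n => c *: u n) (c *: x).
Proof.
move=> ux; apply: (@ccvg_le _ _ (fun n => cabs c * nrm (u n - x))).
  by move=> n; rewrite -scalerBr cnormZE.
exact: cvgn0_mull.
Qed.

Lemma ccvgB u v x y : ccvg u x -> ccvg v y -> ccvg (fun n => u n - v n) (x - y).
Proof.
move=> ux /(ccvgZ (-1)) vy; rewrite -scaleN1r.
under [X in ccvg X]eq_fun do rewrite -scaleN1r.
exact: ccvgD.
Qed.

Lemma ccvg_star u x : ccvg u x -> ccvg (fun n => star (u n)) (star x).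
Proof.
move=> ux; apply: (@ccvg_le _ _ (fun n => nrm (u n - x))) => // n.
by rewrite -starB cnorm_starE.
Qed.

Lemma ccvg_norm_le u x k : ccvg u x -> (forall n, nrm (u n) <= k) -> nrm x <= k.
Proof.
move=> ux uk; have h0 : (fun n => nrm (u n - x) + k) @ \oo --> (0 + k).
  by apply: cvgD => //; exact: cvg_cst.
rewrite -(add0r k); apply: (cvgr_to_ge h0); apply: nearW => n.
by rewrite -{1}[x](subKr (u n)) (le_trans (cnormB _ _)) // addrC lerD2l.
Qed.

Lemma ccvgM u v x y : ccvg u x -> ccvg v y -> ccvg (fun n => u n * v n) (x * y).
Proof.
move=> ux vy.
pose t n := (nrm (u n - x) + nrm x) * nrm (v n - y) + nrm (u n - x) * nrm y.
apply: (@ccvg_le _ _ t) => [n|].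
  have -> : u n * v n - x * y = u n * (v n - y) + (u n - x) * y.
    by rewrite mulrBr mulrBl addrA subrK.
  rewrite (le_trans (cnormD _ _)) // lerD ?cnormM // (le_trans (cnormM _ _)) //.
  rewrite ler_wpM2r ?cnorm_ge0 // -{1}[u n](subrK x) cnormD //.
have -> : (0 : R) = (0 + nrm x) * 0 + 0 * nrm y by rewrite mulr0 mul0r addr0.
apply: cvgD; apply: cvgM => //; last exact: cvg_cst.
by apply: cvgD => //; exact: cvg_cst.
Qed.

Lemma ccvg_shift u x k : ccvg u x -> ccvg (fun n => u (n + k)%N) x.
Proof. by move=> ux; apply: (cvg_comp (fun n => n + k)%N _ (cvg_addnr k) ux). Qed.

(** The method of majorants: distances between terms of [u] telescope below those of [t]. It serves
    the Neumann series, the square root and the resolvent series. *)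
Lemma ccvg_dominated u (t : nat -> R) (L : R) :
  (forall n, nrm (u n.+1 - u n) <= t n.+1 - t n) -> t @ \oo --> L ->
  exists2 x, ccvg u x & forall n, nrm (x - u n) <= L - t n.
Proof.
move=> ut tL.
have umn m n : (m <= n)%N -> nrm (u n - u m) <= t n - t m.
  move=> /subnK <-; elim: (n - m)%N => [|d IHd]; first by rewrite !subrr cnorm0.
  rewrite addSn (le_trans (cnorm_dist _ (u (d + m)%N) _)) //.
  by rewrite -[X in _ <= X](subrKA (t (d + m)%N)) lerD.
have [|x ux] := @cnorm_complete R A u.
  move=> e e0; have /cvgrPdist_lt/(_ (e / 2)) tLe := tL.
  have [|n0 _ tn0] := tLe; first by rewrite divr_gt0.
  have key m n : (n0 <= m)%N -> (m <= n)%N -> nrm (u n - u m) < e.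
    move=> n0m mn; have {1}-> : e = e / 2 + e / 2 by rewrite -splitr.
    apply: le_lt_trans (umn _ _ mn) _.
    have -> : t n - t m = (L - t m) - (L - t n) by ring.
    apply: le_lt_trans (ler_norm _) _; apply: le_lt_trans (ler_normB _ _) _.
    by apply: ltrD; apply: tn0 => //=; exact: leq_trans mn.
  exists n0 => m n n0m n0n; have [mn|/ltnW nm] := leqP m n.
    by rewrite cnorm_distC key.
  exact: key.
exists x => // n.
have h0 : (fun k => nrm (u (k + n)%N - x) + (t (k + n)%N - t n)) @ \oo --> (0 + (L - t n)).
  apply: cvgD; first exact: ccvg_shift.
  by apply: cvgB; [apply: (cvg_comp (fun k => k + n)%N _ (cvg_addnr n))|exact: cvg_cst].
rewrite -(add0r (L - _)); apply: (cvgr_to_ge h0); apply: nearW => k.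
by rewrite (le_trans (cnorm_dist _ (u (k + n)%N) _)) // cnorm_distC lerD // umn // leq_addl.
Qed.

Lemma neumann x : nrm x < 1 -> exists y, [/\ (1 - x) * y = 1, y * (1 - x) = 1,
  ccvg (fun n => \sum_(k < n) x ^+ k) y & nrm (y - 1) <= nrm x / (1 - nrm x)].
Proof.
move=> x1; set q := nrm x in x1 *; have q0 : 0 <= q by exact: cnorm_ge0.
have q1 : 0 < 1 - q by rewrite subr_gt0.
pose t n := (1 - q ^+ n) / (1 - q).
have tL : t @ \oo --> (1 - q)^-1.
  have -> : (1 - q)^-1 = (1 - 0) / (1 - q) by rewrite subr0 mul1r.
  apply: cvgM; last exact: cvg_cst.
  by apply: cvgB; [exact: cvg_cst|exact: cvgn_geometric].
have [|y uy ey] := @ccvg_dominated (fun n => \sum_(k < n) x ^+ k) t _ _ tL.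
  move=> n; have -> : t n.+1 - t n = q ^+ n.
    by rewrite /t exprS; field; rewrite gt_eqF.
  by rewrite big_ord_recr /= addrAC subrr add0r cnormX.
have xn0 : ccvg (fun n => 1 - x ^+ n) 1.
  apply: (@ccvg_le _ _ (fun n => q ^+ n)) => [n|].
    by rewrite addrAC subrr add0r cnormN cnormX.
  exact: cvgn_geometric.
have geom n : (1 - x) * (\sum_(k < n) x ^+ k) = 1 - x ^+ n /\
    (\sum_(k < n) x ^+ k) * (1 - x) = 1 - x ^+ n.
  elim: n => [|n [IHl IHr]]; first by rewrite big_ord0 mulr0 mul0r subrr.
  by rewrite big_ord_recr /=; split; [rewrite mulrDr IHl mulrBl mul1r -exprS|
    rewrite mulrDl IHr mulrBr mulr1 -exprSr]; rewrite addrA subrK.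
exists y; split=> //.
- apply: ccvg_unique xn0; under [X in ccvg X]eq_fun => n do rewrite -(geom n).1.
  exact: ccvgMl.
- apply: ccvg_unique xn0; under [X in ccvg X]eq_fun => n do rewrite -(geom n).2.
  exact: ccvgMr.
have := ey 1%N; rewrite big_ord1 expr0 /t expr1 divff ?gt_eqF // => /le_trans; apply.
rewrite le_eqVlt; apply/orP; left; apply/eqP.
by rewrite -[X in _ - X](@divff _ (1 - q)) ?gt_eqF // -[X in X - _]mul1r -mulrBl subKr.
Qed.

Lemma commr_ccvg x u y : ccvg u y -> (forall n, GRing.comm x (u n)) -> GRing.comm x y.
Proof.
move=> uy xu; apply: (@ccvg_unique (fun n => x * u n)); first exact: ccvgMl.
under [X in ccvg X]eq_fun => n do rewrite xu.
exact: ccvgMr.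
Qed.

Definition closed_subalgebra (P : set A) := subalgebra P /\
  forall u x, (forall n, P (u n)) -> ccvg u x -> P x.

(* The iteration [y := (h + y^2) / 2] converges to [1 - sqrt (1 - h)] because its
   increments are dominated by those of the scalar iteration [t := (1 + t^2) / 2]. *)
Lemma cstar_sqrt h : nrm h <= 1 -> exists b, [/\ b * b = 1 - h, nrm (1 - b) <= 1,
  (forall x, GRing.comm x h -> GRing.comm x b), (star h = h -> star b = b) &
  forall P, closed_subalgebra P -> P h -> P b].
Proof.
move=> h1; pose half : R[i] := (2^-1 : R)%:C.
have cabs_half : cabs half = 2^-1 by rewrite cabs_real ger0_norm.
pose y n := iter n (fun y => half *: (h + y * y)) 0.
pose t n : R := iter n (fun t => (1 + t ^+ 2) / 2) 0.
have yS n : y n.+1 = half *: (h + y n * y n) by [].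
have tS n : t n.+1 = (1 + t n ^+ 2) / 2 by [].
have t01 n : 0 <= t n <= 1.
  elim: n => [|n /andP[t0 t1]]; first by rewrite lexx ler01.
  rewrite tS; have : t n ^+ 2 <= 1 by rewrite expr_le1.
  by have := sqr_ge0 (t n); move: (t n ^+ 2) => s; lra.
have yt n : nrm (y n) <= t n.
  elim: n => [|n IHn]; first by rewrite cnorm0.
  rewrite yS tS cnormZE cabs_half mulrC ler_wpM2r ?invr_ge0 //.
  rewrite (le_trans (cnormD _ _)) // lerD // (le_trans (cnormM _ _)) // expr2.
  by rewrite ler_pM ?cnorm_ge0.
have ytS n : nrm (y n.+1 - y n) <= t n.+1 - t n.
  elim: n => [|n IHn].
    rewrite yS /= !subr0 mulr0 addr0 cnormZE cabs_half expr0n addr0 mulrC.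
    by rewrite ler_wpM2r ?invr_ge0.
  rewrite (yS n.+1) [in X in _ - X](yS n) -scalerBr cnormZE cabs_half.
  rewrite opprD addrACA subrr add0r.
  have -> : y n.+1 * y n.+1 - y n * y n =
      y n.+1 * (y n.+1 - y n) + (y n.+1 - y n) * y n.
    by rewrite mulrBr mulrBl addrA subrK.
  have -> : t n.+2 - t n.+1 =
      2^-1 * (t n.+1 * (t n.+1 - t n) + (t n.+1 - t n) * t n).
    by rewrite (tS n.+1) {2}(tS n); field.
  rewrite ler_wpM2l ?invr_ge0 // (le_trans (cnormD _ _)) //.
  by apply: lerD; apply: le_trans (cnormM _ _) _; rewrite ler_pM ?cnorm_ge0.
have t_mono : {homo t : m n / (m <= n)%N >-> m <= n}.
  apply: homo_leq => [//|???|n]; first exact: le_trans.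
  by rewrite -subr_ge0 (le_trans _ (ytS n)) ?cnorm_ge0.
have /cvg_ex[L tL] : cvgn t.
  apply: nondecreasing_is_cvgn => //; exists 1 => _ [n _ <-].
  by have /andP[] := t01 n.
have [z yz _] := ccvg_dominated ytS tL.
have zE : half *: (h + z * z) = z.
  apply: (@ccvg_unique (fun n => y n.+1)).
    by apply: ccvgZ; apply: ccvgD; [exact: ccvg_cst|exact: ccvgM].
  by under [X in ccvg X]eq_fun => n do rewrite -addn1; exact: ccvg_shift.
(* The fixed point equation [2 z = h + z^2] says that [(1 - z)^2 = 1 - h]. *)
exists (1 - z); split.
- have z2 : z + z = h + z * z.
    have half2 : half + half = 1.
      by rewrite /half -rmorphD /= (_ : 2^-1 + 2^-1 = 1 :> R) //; lra.
    by rewrite -[h + _]scale1r -half2 scalerDl zE.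
  have -> : h = z + z - z * z by rewrite z2 addrK.
  by rewrite mulrBl mul1r mulrBr mulr1 !opprB opprD -[LHS]addrA; congr (_ + _); rewrite addrCA.
- rewrite opprB addrC subrK; apply: (ccvg_norm_le yz) => n.
  by rewrite (le_trans (yt n)) //; have /andP[] := t01 n.
- move=> x xh; apply: commrB; first exact: commr1.
  apply: (commr_ccvg yz); elim=> [|n IHn]; first exact: commr0.
  rewrite yS /GRing.comm -scalerAr -scalerAl; congr (_ *: _).
  by apply: commrD => //; exact: commrM.
- move=> sh; rewrite starB star1; congr (_ - _).
  apply: (ccvg_unique _ yz); have := ccvg_star yz.
  suff sy n : star (y n) = y n by under [X in ccvg X]eq_fun do rewrite sy.
  by elim: n => [|n IHn]; rewrite ?star0 // yS starZr starD starM IHn sh.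
- move=> P [algP clP] Ph; apply: (subalgB algP); first exact: (subalg1 algP).
  apply: (clP y) => //; elim=> [|n IHn]; first exact: (subalg0 algP).
  rewrite yS; apply: (subalgZ algP); apply: (subalgD algP) => //.
  exact: (subalgM algP).
Qed.

End CStarNorm.

(** * States *)

Section States.
Context {R : realType} {A : cstarAlgType R} (phi : {scalar A}).
Hypothesis state_phi : is_state phi.
Implicit Types (x y a h : A) (c : R[i]) (u : nat -> A).

Local Notation nrm := (@cnorm R A).
Let phi1 : phi 1 = 1 := state_phi.1.
Let phi_ge0 x : 0 <= phi (star x * x) := state_phi.2 x.

Lemma phi_alg c : phi c%:A = c.
Proof. by rewrite linearZ /= phi1 mulr1. Qed.

(** Positivity makes [phi (star (c + x) * (c + x))] real for every scalar [c]; the choices 1 and [i]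
    give the imaginary and the real part. *)
Lemma phi_star x : phi (star x) = Num.conj (phi x).
Proof.
have im0 c : complex.Im (Num.conj c * phi x + c * phi (star x)) = 0.
  have := phi_ge0 (c%:A + x).
  rewrite starD star_alg mulrDl !mulrDr -!scalerAl !mul1r -scalerAr mulr1.
  rewrite 3!linearD /= !linearZ /= phi1 mulr1 => /ger0_Im.
  have /ger0_Im h1 := phi_ge0 x.
  have h2 : complex.Im (Num.conj c * c) = 0.
    by apply: ger0_Im; rewrite mulrC mul_conjC_ge0.
  by move: h1 h2; case: (Num.conj c * c) => ? ?; case: (Num.conj c * phi x) => ? ?;
     case: (c * phi (star x)) => ? ?; case: (phi (star x * x)) => ? ? /= -> ->;
     rewrite add0r addr0.
move: (im0 1) (im0 'i%C); rewrite rmorph1 !mul1r.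
rewrite !conjE; case: (phi x) (phi (star x)) => [a b] [a' b'] /=.
rewrite !(mul0r, mul1r, subr0, sub0r, add0r, oppr0, mulNr) => h1 h2.
have -> : a' = a by lra.
by have -> : b' = - b by lra.
Qed.

(* The square of [norm2 phi x] and [norm2 phi x] itself, as real numbers. *)
Definition sqn x : R := complex.Re (phi (star x * x)).
Definition nn x : R := Num.sqrt (sqn x).

Lemma sqnE x : (sqn x)%:C = phi (star x * x).
Proof. exact: ge0_complex. Qed.

Lemma sqn_ge0 x : 0 <= sqn x.
Proof. by rewrite -ler0c sqnE. Qed.

Lemma nn_ge0 x : 0 <= nn x. Proof. exact: sqrtr_ge0. Qed.

Lemma sqr_nn x : nn x ^+ 2 = sqn x.
Proof. by rewrite sqr_sqrtr // sqn_ge0. Qed.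

Lemma norm2E x : norm2 phi x = (nn x)%:C.
Proof.
rewrite /norm2 -sqnE -sqr_nn rmorphXn /=.
by rewrite exprCK // ler0c nn_ge0.
Qed.

Lemma phi_conj x y : Num.conj (phi (star x * y)) = phi (star y * x).
Proof. by rewrite -phi_star starM starK. Qed.

Lemma sqnZ c x : sqn (c *: x) = cabs c ^+ 2 * sqn x.
Proof.
apply: complexI; rewrite rmorphM /= sqr_cabs !sqnE starZ -scalerAl -scalerAr scalerA.
by rewrite linearZ /= (mulrC c).
Qed.

Lemma nnZ c x : nn (c *: x) = cabs c * nn x.
Proof. by rewrite /nn sqnZ sqrtrM ?sqr_ge0 // sqrtr_sqr ger0_norm // cabs_ge0. Qed.

Lemma sqnD x y :
  sqn (x + y) = sqn x + sqn y + 2 * complex.Re (phi (star x * y)).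
Proof.
apply: complexI; rewrite !rmorphD /= !sqnE starD mulrDl !mulrDr !linearD /=.
rewrite -(phi_conj x y) conjE; case: (phi (star x * y)) => a b /=.
case: (phi (star x * x)) => ? ?; case: (phi (star y * y)) => ? ?.
by apply/eqP; rewrite eq_complex /=; apply/andP; split; apply/eqP; ring.
Qed.

Lemma sqnN x : sqn (- x) = sqn x.
Proof. by rewrite -scaleN1r sqnZ cabsN cabs1 expr1n mul1r. Qed.

Lemma phi_cauchy x y : cabs (phi (star x * y)) <= nn x * nn y.
Proof.
set b := phi _; have key (t : R) :
    0 <= sqn y - 2 * t * cabs b ^+ 2 + t ^+ 2 * cabs b ^+ 2 * sqn x.
  have := sqn_ge0 (y + (- (t%:C * b)) *: x).
  rewrite sqnD sqnZ cabsN cabsM cabs_real exprMn real_normK ?num_real //.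
  rewrite -[star y * _]scalerAr linearZ /= -(phi_conj x y) -/b mulNr -(mulrA _ b) -sqr_cabs.
  by rewrite -rmorphM -rmorphN /= mulrN -!mulrA => /le_trans; apply; lra.
have [xx|xx] := eqVneq (sqn x) 0.
  have [->|b0] := eqVneq (cabs b) 0; first by rewrite mulr_ge0 ?nn_ge0.
  (* When [sqn x = 0] the quadratic is affine in [t], and this value makes it negative. *)
  have := key ((sqn y + 1) / cabs b ^+ 2).
  rewrite xx mulr0 addr0 -mulrA divfK ?expf_eq0 //.
  by have := sqn_ge0 y; lra.
have x0 : 0 < sqn x by rewrite lt_neqAle eq_sym xx sqn_ge0.
(* The minimiser of the quadratic in [t]. *)
have := key (sqn x)^-1.
have -> : sqn y - 2 * (sqn x)^-1 * cabs b ^+ 2 +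
          (sqn x)^-1 ^+ 2 * cabs b ^+ 2 * sqn x = sqn y - cabs b ^+ 2 / sqn x.
  by field.
rewrite subr_ge0 ler_pdivrMr // => bxy.
rewrite -(ler_pXn2r (n := 2)) ?nnegrE ?mulr_ge0 ?nn_ge0 ?cabs_ge0 //.
by rewrite exprMn !sqr_nn mulrC.
Qed.

Lemma nnD x y : nn (x + y) <= nn x + nn y.
Proof.
rewrite -(ler_pXn2r (n := 2)) ?nnegrE ?addr_ge0 ?nn_ge0 // sqr_nn sqnD -!sqr_nn.
have := le_trans (ler_norm _) (le_trans (Re_le_cabs _) (phi_cauchy x y)); lra.
Qed.

Lemma nn0 : nn 0 = 0. Proof. by rewrite -(scale0r 0) nnZ cabs0 mul0r. Qed.
Lemma nnN x : nn (- x) = nn x. Proof. by rewrite /nn sqnN. Qed.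
Lemma nnB x y : nn (x - y) <= nn x + nn y.
Proof. by rewrite -(nnN y) nnD. Qed.

Lemma nn_sum I (r : seq I) (P : pred I) (f : I -> A) :
  nn (\sum_(i <- r | P i) f i) <= \sum_(i <- r | P i) nn (f i).
Proof.
elim/big_rec2: _ => [|i y x _ xy]; first by rewrite nn0.
exact: le_trans (nnD _ _) (lerD _ _).
Qed.

(** Writing [1 - h = b * b] with [b] self-adjoint, the difference of the two sides is
    [phi (star (b * x) * (b * x))]. *)
Lemma phi_sandwich_le h x : star h = h -> nrm h <= 1 ->
  complex.Re (phi (star x * h * x)) <= sqn x.
Proof.
move=> sh /cstar_sqrt[b [bb _ _ /(_ sh) sb _]].
rewrite -subr_ge0 -ler0c rmorphB /= sqnE.
have h0 : 0 <= phi (star x * x) - phi (star x * h * x).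
  rewrite -linearB /= -mulrA -mulrBr -{2}[x]mul1r -mulrBl -bb.
  by have := phi_ge0 (b * x); rewrite starM sb !mulrA.
have -> // : (complex.Re (phi (star x * h * x)))%:C = phi (star x * h * x).
apply: RRe_real; rewrite -[phi _](subKr (phi (star x * x))).
by apply: rpredB; rewrite realE ?h0 // phi_ge0.
Qed.

(** This is [phi_sandwich_le] for [star a * a] rescaled to norm 1. It lets [A] act boundedly on
    L^2(phi). *)
Lemma nn_mul a x : nn (a * x) <= nrm a * nn x.
Proof.
have := cnorm_ge0 a; rewrite le_eqVlt => /orP[/eqP a0|a0].
  by rewrite -a0 mul0r (cnorm_eq0 _ (esym a0)) mul0r nn0.
rewrite -(ler_pXn2r (n := 2)) ?nnegrE ?mulr_ge0 ?nn_ge0 ?cnorm_ge0 // exprMn !sqr_nn.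
pose k : R := nrm a ^- 2; have k0 : 0 <= k by rewrite invr_ge0 sqr_ge0.
pose h := k%:C *: (star a * a).
have := @phi_sandwich_le h x; rewrite /h starZr starM starK => /(_ erefl).
rewrite cnormZE cabs_real ger0_norm // cnorm_star mulVf ?expf_eq0 ?gt_eqF //.
move=> /(_ (lexx _)); rewrite -scalerAr -scalerAl linearZ /=.
rewrite mulrA -mulrA -starM -sqnE -rmorphM /= mulrC ler_pdivrMr ?exprn_gt0 //.
by rewrite mulrC.
Qed.

Lemma nn1 : nn 1 = 1.
Proof. by rewrite /nn /sqn star1 mulr1 phi1 sqrtr1. Qed.

Lemma nn_le_cnorm x : nn x <= nrm x.
Proof. by rewrite -[X in nn X]mulr1 (le_trans (nn_mul _ _)) // nn1 mulr1. Qed.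

Lemma cabs_phi_nn x : cabs (phi x) <= nn x.
Proof. by have := phi_cauchy 1 x; rewrite star1 !mul1r nn1 mul1r. Qed.

Lemma cabs_phi x : cabs (phi x) <= nrm x.
Proof. exact: le_trans (cabs_phi_nn x) (nn_le_cnorm x). Qed.

Lemma phi_nn_limit u x c : (fun n => nn (u n - x)) @ \oo --> (0 : R) ->
  (forall n, phi (u n) = c) -> phi x = c.
Proof.
move=> ux uc; apply/eqP; rewrite -subr_eq0 -cabs_eq0 eq_le cabs_ge0 andbT.
apply: (cvgr_to_ge ux); apply: nearW => n.
by rewrite -(uc n) -linearB /= -cabsN -linearN opprB cabs_phi_nn.
Qed.

Lemma ccvg_nn u x : ccvg u x -> (fun n => nn (u n - x)) @ \oo --> (0 : R).
Proof. by apply: cvgn0_le => n; rewrite nn_ge0 nn_le_cnorm. Qed.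

Lemma phi_ccvg_cst u x c : ccvg u x -> (forall n, phi (u n) = c) -> phi x = c.
Proof. by move=> /ccvg_nn; exact: phi_nn_limit. Qed.

End States.

(** * The analytic R-transform *)

Section RealNorm.
Context {R : realType} {V : normedModType R[i]}.
Implicit Types (x y : V) (u v : nat -> V).

Definition rnorm x : R := complex.Re `|x|.

Lemma rnormE x : (rnorm x)%:C = `|x|.
Proof. by rewrite /rnorm ge0_complex. Qed.

Lemma rnorm_ge0 x : 0 <= rnorm x.
Proof. by rewrite -ler0c rnormE. Qed.

Lemma rnormN x : rnorm (- x) = rnorm x.
Proof. by rewrite /rnorm normrN. Qed.

Lemma rnormD x y : rnorm (x + y) <= rnorm x + rnorm y.
Proof. by rewrite -lecR rmorphD /= !rnormE ler_normD. Qed.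

Lemma cvg_rnormP u x : u @ \oo --> x <-> (fun n => rnorm (u n - x)) @ \oo --> (0 : R).
Proof.
split=> [/cvgrPdist_lt ux|/cvgn0P ux].
  apply/cvgn0P => e e0; have [|n0 _ un] := ux e%:C; first by rewrite ltcR.
  exists n0 => n /un; rewrite -normrN opprB -rnormE ltcR ger0_norm //.
  exact: rnorm_ge0.
apply/cvgrPdist_lt => e e0; have [|n0 un] := ux (complex.Re e).
  by rewrite -ltcR ge0_complex // ltW.
exists n0 => // n /un; rewrite ger0_norm ?rnorm_ge0 //.
by rewrite -ltcR (ge0_complex (ltW e0)) rnormE -normrN opprB.
Qed.

Lemma cvg_rnorm u x : u @ \oo --> x -> (fun n => rnorm (u n)) @ \oo --> rnorm x.
Proof.
move=> /cvg_rnormP/cvgn0P ux; apply/cvgrPdist_lt => e /ux[n0 un].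
exists n0 => // n /un; rewrite ger0_norm ?rnorm_ge0 //; apply: le_lt_trans.
have := rnormD (u n - x) x; have := rnormD (x - u n) (u n).
by rewrite !subrK -(rnormN (x - _)) opprB ler_norml; lra.
Qed.

End RealNorm.

Section ComplexLimits.
Context {R : realType}.
Implicit Types (P : R[i] -> Prop) (f : nat -> R[i]).

Lemma near0C P :
  (\forall z \near (0 : R[i]), P z) <-> exists2 e : R, 0 < e & forall z, cabs z < e -> P z.
Proof.
split=> [/nbhs_normP[e e0 eP]|[e e0 eP]].
  exists (complex.Re e); first by rewrite -ltcR ge0_complex // ltW.
  move=> z; rewrite -ltcR cabsE ge0_complex ?ltW // => ze.
  by apply: eP; rewrite /ball_ /= sub0r normrN.
apply/nbhs_normP; exists e%:C => [|z]; first by rewrite /= ltcR.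
by rewrite /ball_ /= sub0r normrN -cabsE ltcR; exact: eP.
Qed.

Lemma dnear0C P : (\forall z \near (0 : R[i])^', P z) <->
  exists2 e : R, 0 < e & forall z, z != 0 -> cabs z < e -> P z.
Proof.
rewrite near_withinE; split=> [/near0C[e e0 eP]|[e e0 eP]].
  by exists e => // z z0 ze; exact: eP.
by apply/near0C; exists e => // z ze z0; exact: eP.
Qed.

Lemma near0C_forall (I : finType) (P : I -> R[i] -> Prop) :
  (forall i, \forall z \near (0 : R[i]), P i z) ->
  \forall z \near (0 : R[i]), forall i, P i z.
Proof.
move=> /(_ _)/near0C nearP.
have /choice[e eP] : forall i, exists e : R, 0 < e /\ forall z, cabs z < e -> P i z.
  by move=> i; have [e e0 eP] := nearP i; exists e.
have s0 J (r : seq J) (Q : pred J) (f : J -> I) : 0 <= \sum_(j <- r | Q j) (e (f j))^-1.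
  by apply: sumr_ge0 => j _; rewrite invr_ge0 ltW //; have [] := eP (f j).
(* [s^-1] is at most every radius [e i]; the summand 1 keeps [s] positive when [I] is empty. *)
pose s := 1 + \sum_i (e i)^-1; have sp : 0 < s by rewrite ltr_wpDr // s0.
apply/near0C; exists s^-1 => [|z zs i]; first by rewrite invr_gt0.
have [ei0 eiP] := eP i; apply: eiP; apply: lt_le_trans zs _.
rewrite -[leRHS]invrK lef_pV2 ?posrE ?invr_gt0 // /s (bigD1 i) //= addrCA lerDl.
by rewrite addr_ge0 // s0.
Qed.

Lemma cvgCP f (l : R[i]) : f @ \oo --> l <-> (fun n => cabs (f n - l)) @ \oo --> (0 : R).
Proof. exact: (@cvg_rnormP R R[i]). Qed.

Lemma limCP f (l : R[i]) : f @ \oo --> l -> limn f = l.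
Proof. exact: (@cvg_lim _ (@norm_hausdorff _ R[i])). Qed.

End ComplexLimits.

Lemma big_triangle (V : nmodType) n (G : nat -> nat -> V) :
  \sum_(m < n) \sum_(j < m.+1) G j (m - j)%N =
  \sum_(j < n) \sum_(k < n | (j + k < n)%N) G j k.
Proof.
transitivity (\sum_(m < n) \sum_(j < n | (j < m.+1)%N) G j (m - j)%N).
  by apply: eq_bigr => m _; apply: (big_ord_widen n (fun j => G j (m - j)%N)).
rewrite (exchange_big_dep predT) //=; apply: eq_bigr => j _.
transitivity (\sum_(j <= m < n) G j (m - j)%N); first by rewrite big_geq_mkord.
rewrite -{1}[j : nat]add0n big_addn big_mkord.
rewrite (big_ord_widen n (fun k => G j (k + j - j)%N)) ?leq_subr //.
by apply: eq_big => k; rewrite ?ltn_subRL // addnK.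
Qed.

Section ResolventSeries.
Context {R : realType} {A : cstarAlgType R} (phi : {scalar A}).
Hypothesis state_phi : is_state phi.
Variable a : A.
Implicit Types (z : R[i]) (U V : A).

Local Notation nrm := (@cnorm R A).
Local Notation u := (resolvent_coef phi a).
Let phi1 : phi 1 = 1 := state_phi.1.

(* The majorant [B_n] of the partial sums satisfies
   [B_(n+1) <= 1 + rho |a| (B_n + B_n^2)]. *)
Lemma resolvent_coef_sum (rho : R) n : 0 <= rho -> 6 * rho * nrm a <= 1 ->
  \sum_(k < n.+1) nrm (u k) * rho ^+ k <= 1 + 6 * rho * nrm a.
Proof.
move=> rho0 rhoa; pose b k := nrm (u k) * rho ^+ k.
have b0 k : 0 <= b k by rewrite mulr_ge0 ?cnorm_ge0 ?exprn_ge0.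
have K0 := cnorm_ge0 a; set K := nrm a in rhoa K0 *.
have bS m : b m.+1 <= rho * K * (b m + \sum_(j < m.+1) b j * b (m - j)%N).
  rewrite /b resolvent_coefS exprSr mulrA mulrC -mulrA ler_wpM2l //.
  rewrite mulrDr mulr_sumr.
  apply: le_trans (_ : (K * nrm (u m) +
    \sum_(j < m.+1) K * nrm (u j) * nrm (u (m - j)%N)) * rho ^+ m <= _).
    rewrite ler_wpM2r ?exprn_ge0 // (le_trans (cnormB _ _)) // lerD ?cnormM //.
    rewrite (le_trans (cnorm_sum _ _ _)) // ler_sum // => j _.
    rewrite cnormZE ler_wpM2r ?cnorm_ge0 // (le_trans (cabs_phi state_phi _)) //.
    exact: cnormM.
  rewrite mulrDl -(mulrA K) lerD // mulr_suml ler_sum // => j _.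
  have -> : rho ^+ m = rho ^+ j * rho ^+ (m - j).
    by rewrite -exprD subnKC // -ltnS.
  by rewrite le_eqVlt; apply/orP; left; apply/eqP; ring.
pose B n := \sum_(k < n) b k.
have BS k : B k.+1 <= 1 + rho * K * (B k + B k * B k).
  rewrite /B big_ord_recl /b cnorm1 expr0 mulr1 lerD2l.
  apply: le_trans (_ : \sum_(i < k) rho * K * (b i +
    \sum_(j < i.+1) b j * b (i - j)%N) <= _); first by apply: ler_sum => i _; exact: bS.
  rewrite -mulr_sumr ler_wpM2l ?mulr_ge0 // big_split lerD2l /=.
  rewrite (big_triangle k (fun i j => b i * b j)) mulr_suml ler_sum // => j _.
  rewrite mulr_sumr big_mkcond ler_sum // => i _; case: ifP => // _.
  by rewrite mulr_ge0 ?b0.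
have B0 k : 0 <= B k by exact: sumr_ge0.
(* If [B k <= 2] then [B k.+1 <= 1 + rho K (2 + 4)], which is at most 2 because [6 rho K <= 1]. One
   more use of [BS] gives the sharper bound of the statement. *)
suff B2 k : B k <= 2.
  rewrite -/(B n.+1) (le_trans (BS n)) // lerD2l -(mulrA 6).
  have : B n * B n <= 2 * 2 by rewrite ler_pM.
  have := B2 n; have : 0 <= rho * K by exact: mulr_ge0.
  move: (rho * K) (B n) (B n * B n) => x y t; nra.
elim: k => [|k IHk]; first by rewrite /B big_ord0.
rewrite (le_trans (BS k)) //.
have : B k * B k <= 2 * 2 by rewrite ler_pM.
have : 0 <= rho * K by exact: mulr_ge0.
move: rhoa; rewrite -(mulrA 6); move: (rho * K) (B k) (B k * B k) IHk => x y t; nra.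
Qed.

(* [U = 1 + z a U - z phi(a U) U] says that [U] is the inverse of
   [1 + r - z a] with [r = z phi(a U)]. *)
Definition resolvent_eq z U := U = 1 + z *: (a * U - phi (a * U) *: U).

(** The 12 is twice the 6 of [resolvent_coef_sum], which is thus available at radius [2 |z|]. Hence
    the terms of total degree at least [n] in a product of two partial sums decay like [2^-n]. *)
Lemma resolvent_series z : 12 * cabs z * nrm a <= 1 ->
  exists U, [/\ ccvg (fun n => \sum_(k < n) z ^+ k *: u k) U, resolvent_eq z U,
    nrm (U - 1) <= 6 * cabs z * nrm a &
    series (fun n => R_coef phi a n * z ^+ n) @ \oo --> z * phi (a * U)].
Proof.
move=> za; set x := cabs z in za *; have x0 : 0 <= x := cabs_ge0 z.
have K0 := cnorm_ge0 a; have xK0 : 0 <= x * nrm a by exact: mulr_ge0.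
pose P n := \sum_(k < n) z ^+ k *: u k.
pose t n := \sum_(k < n) nrm (u k) * x ^+ k.
have PS n : nrm (P n.+1 - P n) <= t n.+1 - t n.
  rewrite /P /t !big_ord_recr /= !(addrAC _ _ (- _)) !subrr !add0r.
  by rewrite cnormZE cabsX mulrC.
have t_mono : {homo t : m n / (m <= n)%N >-> m <= n}.
  apply: homo_leq => [//|???|n]; first exact: le_trans.
  by rewrite -subr_ge0 (le_trans _ (PS n)) ?cnorm_ge0.
have tS n : t n.+1 <= 1 + 6 * x * nrm a by apply: resolvent_coef_sum => //; lra.
have t_le n : t n <= 1 + 6 * x * nrm a by exact: le_trans (t_mono _ _ (leqnSn n)) (tS n).
have /cvg_ex[L tL] : cvgn t.
  apply: nondecreasing_is_cvgn => //; exists (1 + 6 * x * nrm a) => _ [n _ <-].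
  exact: t_le.
have [U PU eU] := ccvg_dominated PS tL; exists U; split=> //.
- pose g j k := phi (a * (z ^+ j *: u j)) *: (z ^+ k *: u k).
  pose tail n := \sum_(j < n) \sum_(k < n | ~~ (j + k < n)%N) g j k.
  (* The coefficient recursion summed below order [n]; [tail n] is the difference between the
     product of partial sums and the truncated Cauchy product. *)
  have Prec n : P n.+1 = 1 + z *: (a * P n - phi (a * P n) *: P n) + z *: tail n.
    have -> : phi (a * P n) *: P n = \sum_(j < n) \sum_(k < n | (j + k < n)%N) g j k + tail n.
      rewrite -big_split /= {1}/P mulr_sumr (linear_sum phi) /= scaler_suml.
      by apply: eq_bigr => j _; rewrite scaler_sumr (bigID (fun k : 'I_n => (j + k < n)%N)).
    rewrite -addrA -scalerDr opprD addrA subrK /P big_ord_recl expr0 scale1r.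
    congr (_ + _); rewrite -big_triangle mulr_sumr -sumrB scaler_sumr.
    apply: eq_bigr => m _; rewrite resolvent_coefS exprS -scalerA; congr (_ *: _).
    rewrite scalerBr -scalerAr; congr (_ - _); rewrite scaler_sumr.
    apply: eq_bigr => j _; rewrite /g -scalerAr [phi (_ *: _)]linearZ /= !scalerA.
    by congr (_ *: _); rewrite mulrAC -exprD subnKC // -ltnS.
  pose b k := nrm (u k) * (2 * x) ^+ k.
  have b0 k : 0 <= b k by rewrite mulr_ge0 ?cnorm_ge0 ?exprn_ge0 ?mulr_ge0.
  have bsum n : \sum_(k < n) b k <= 2.
    apply: le_trans (_ : \sum_(k < n.+1) b k <= _).
      by rewrite big_ord_recr lerDl.
    have h : 6 * (2 * x) * nrm a <= 1 by lra.
    apply: le_trans (resolvent_coef_sum n _ h) _; last by lra.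
    by rewrite mulr_ge0.
  have tail_le n : nrm (tail n) <= nrm a * 4 * 2^-1 ^+ n.
    apply: le_trans (_ : \sum_(j < n) \sum_(k < n) nrm a * 2^-1 ^+ n * (b j * b k) <= _).
      apply: le_trans (cnorm_sum _ _ _) _; apply: ler_sum => j _.
      apply: le_trans (cnorm_sum _ _ _) _.
      rewrite big_mkcond; apply: ler_sum => k _; case: ifP => [|_]; last first.
        by apply: mulr_ge0; [rewrite mulr_ge0 ?exprn_ge0 ?invr_ge0|exact: mulr_ge0].
      rewrite -leqNgt => njk; rewrite cnormZE.
      apply: le_trans (_ : nrm a * (x ^+ j * nrm (u j)) * (x ^+ k * nrm (u k)) <= _).
        rewrite ler_pM ?cabs_ge0 ?cnorm_ge0 //; last by rewrite cnormZE cabsX.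
        rewrite (le_trans (cabs_phi state_phi _)) // (le_trans (cnormM _ _)) //.
        by rewrite cnormZE cabsX.
      have -> : nrm a * (x ^+ j * nrm (u j)) * (x ^+ k * nrm (u k)) =
          nrm a * (b j * b k) * 2^-1 ^+ (j + k).
        by rewrite /b !exprMn !exprVn exprD; field; rewrite !expf_neq0.
      rewrite mulrAC; apply: ler_wpM2r; first exact: mulr_ge0.
      apply: ler_wpM2l => //.
      by rewrite ler_wiXn2l ?invr_ge0 // invf_le1 // ler1n.
    rewrite (eq_bigr (fun j : 'I_n => nrm a * 2^-1 ^+ n * b j * \sum_(k < n) b k)); last first.
      by move=> j _; rewrite mulr_sumr; apply: eq_bigr => k _; rewrite mulrA.
    rewrite -mulr_suml -mulr_sumr.
    have -> : nrm a * 4 * 2^-1 ^+ n = nrm a * 2^-1 ^+ n * (2 * 2) by ring.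
    have S0 : 0 <= \sum_(k < n) b k by exact: sumr_ge0.
    rewrite -mulrA; apply: ler_wpM2l; first by rewrite mulr_ge0 ?exprn_ge0 ?invr_ge0.
    by apply: ler_pM => //; exact: bsum.
  have tail0 : ccvg (fun n => z *: tail n) 0.
    rewrite -(scaler0 _ z); apply: ccvgZ.
    apply: (ccvg_le (t := fun n => nrm a * 4 * 2^-1 ^+ n)) => [n|]; first by rewrite subr0.
    by apply: cvgn0_mull; apply: cvgn_geometric; rewrite ?invr_ge0 // invf_lt1 // ltr1n.
  have PU1 : ccvg (fun n => P n.+1) U.
    by under [X in ccvg X]eq_fun => n do rewrite -addn1; exact: ccvg_shift.
  rewrite /resolvent_eq -[RHS]addr0; apply: (ccvg_unique PU1).
  under [X in ccvg X]eq_fun => n do rewrite Prec.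
  apply: ccvgD => //; apply: ccvgD; first exact: ccvg_cst.
  apply: ccvgZ; apply: ccvgB; first exact: ccvgMl.
  rewrite -[_ *: U]mulr_algl.
  under [X in ccvg X]eq_fun => n do rewrite -[_ *: P n]mulr_algl.
  apply: ccvgM => //; apply: (ccvg_le (t := fun n => nrm (a * P n - a * U))).
    by move=> n; rewrite -scalerBl cnorm_alg -linearB /= cabs_phi.
  exact: ccvgMl.
- have := eU 1%N; rewrite /P /t !big_ord1 !expr0 mulr1 scale1r cnorm1 => /le_trans; apply.
  by rewrite lerBlDl; apply: cvgn_le_cst tL _.
- apply/cvgCP.
  have E n : series (fun n => R_coef phi a n * z ^+ n) n.+1 = z * phi (a * P n).
    rewrite /series /= big_mkord big_ord_recl /= mul0r add0r /P mulr_sumr (linear_sum phi) mulr_sumr.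
    apply: eq_bigr => k _.
    by rewrite exprS -scalerAr [phi (_ *: _)]linearZ /= mulrCA (mulrC (phi _)).
  have sh : (fun n => cabs (series (fun n => R_coef phi a n * z ^+ n) (n + 1)%N -
                  z * phi (a * U))) @ \oo --> (0 : R).
    apply: cvgn0_le (cvgn0_mull x (ccvgMl a PU)) => n.
    rewrite cabs_ge0 /= addn1 E -mulrBr cabsM ler_wpM2l //.
    by rewrite -linearB /= cabs_phi.
  by rewrite -(cvg_shiftn 1).
Qed.

End ResolventSeries.

Section CStarUnits.
Context {R : realType} {A : cstarAlgType R}.
Implicit Types (x y : A) (c : R[i]).

Lemma unit_near1 x : cnorm (1 - x) < 1 -> x \is a GRing.unit.
Proof.
by move=> /neumann[y [xy yx _ _]]; apply/unitrP; exists y; rewrite subKr in xy yx.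
Qed.

Lemma invr_right x y : x \is a GRing.unit -> x * y = 1 -> x^-1 = y.
Proof. by move=> ux xy; rewrite -[LHS]mulr1 -xy mulKr. Qed.

Lemma unit_scale c x : c != 0 -> x \is a GRing.unit ->
  c *: x \is a GRing.unit /\ (c *: x)^-1 = c^-1 *: x^-1.
Proof.
move=> c0 ux.
have l : (c *: x) * (c^-1 *: x^-1) = 1.
  by rewrite -scalerAl -scalerAr scalerA mulfV // scale1r mulrV.
have r : (c^-1 *: x^-1) * (c *: x) = 1.
  by rewrite -scalerAl -scalerAr scalerA mulVf // scale1r mulVr.
have u : c *: x \is a GRing.unit by apply/unitrP; exists (c^-1 *: x^-1).
by split=> //; exact: invr_right.
Qed.

End CStarUnits.

Section AnalyticRTransform.
Context {R : realType} {A : cstarAlgType R} (phi : {scalar A}).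
Hypothesis state_phi : is_state phi.
Implicit Types (z : R[i]) (a U V : A) (Ra : R[i] -> R[i]).

Local Notation nrm := (@cnorm R A).
Let phi1 : phi 1 = 1 := state_phi.1.

Lemma resolvent_eqP a z U :
  resolvent_eq phi a z U <-> ((1 + z * phi (a * U))%:A - z *: a) * U = 1.
Proof.
rewrite mulrBl mulr_algl -scalerAl scalerDl scale1r -scalerA.
split=> [UE|E].
  by rewrite {1}UE scalerBr addrA subrK addrK.
by rewrite /resolvent_eq -E scalerBr addrA subrK addrK.
Qed.

(** [resolvent_eq] only makes [U] a right inverse; for small [z] the other factor is within distance
    less than 1 of the identity, hence a unit. *)
Lemma resolvent_eq_unit a z U : z != 0 -> 12 * cabs z * nrm a <= 1 -> nrm U <= 2 ->
  resolvent_eq phi a z U ->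
  let Ka := z^-1 * (1 + z * phi (a * U)) in
  Ka%:A - a \is a GRing.unit /\ (Ka%:A - a)^-1 = z *: U.
Proof.
move=> z0 za U2 /resolvent_eqP; set M := _ - _ => MU Ka.
have K0 := cnorm_ge0 a.
have zK0 : 0 <= cabs z * nrm a by rewrite mulr_ge0 ?cabs_ge0.
have aU : cabs (phi (a * U)) <= nrm a * 2.
  apply: le_trans (cabs_phi state_phi _) _; apply: le_trans (cnormM _ _) _.
  exact: ler_wpM2l.
have Mu : M \is a GRing.unit.
  apply: unit_near1; have -> : 1 - M = z *: a - (z * phi (a * U))%:A.
    by rewrite /M scalerDl scale1r opprB addrCA opprD addNKr addrC.
  apply: le_lt_trans (cnormB _ _) _; rewrite cnorm_alg cnormZE cabsM.
  have : cabs z * cabs (phi (a * U)) <= cabs z * (nrm a * 2) by rewrite ler_wpM2l ?cabs_ge0.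
  move: za zK0; rewrite -(mulrA 12) (mulrA (cabs z)).
  by move: (cabs z * nrm a) => t; lra.
have -> : Ka%:A - a = z^-1 *: M.
  by rewrite /Ka /M scalerBr !scalerA mulVf // scale1r.
have [|u ->] := @unit_scale _ _ z^-1 M _ Mu; first by rewrite invr_neq0.
by split=> //; rewrite invrK (invr_right Mu MU).
Qed.

(** On the ball of radius 2 the right side of [resolvent_eq] is Lipschitz in [U] with constant
    [|z| |a| (1 + 2 + 2)], which is at most 5/12. *)
Lemma resolvent_eq_unique a z U V : 12 * cabs z * nrm a <= 1 ->
  nrm U <= 2 -> nrm V <= 2 -> resolvent_eq phi a z U -> resolvent_eq phi a z V -> U = V.
Proof.
move=> za U2 V2 UE VE; apply/eqP; rewrite -subr_eq0; apply/eqP/cnorm_eq0.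
have K0 := cnorm_ge0 a; have z0 := cabs_ge0 z.
have E : U - V = z *: (a * (U - V) - (phi (a * (U - V)) *: U + phi (a * V) *: (U - V))).
  rewrite {1}UE {1}VE opprD addrACA subrr add0r -scalerBr; congr (_ *: _).
  rewrite opprD addrACA -opprD mulrBr; congr (_ - _).
  by rewrite linearB /= scalerBl scalerBr addrA subrK.
have d0 := cnorm_ge0 (U - V); set d := nrm (U - V) in d0 *.
have phia x : cabs (phi (a * x)) <= nrm a * nrm x.
  exact: le_trans (cabs_phi state_phi _) (cnormM _ _).
have : d <= cabs z * (nrm a * d + (nrm a * d * 2 + nrm a * 2 * d)).
  rewrite {1}/d E cnormZE ler_wpM2l //.
  apply: le_trans (cnormB _ _) _; apply: lerD; first exact: cnormM.
  apply: le_trans (cnormD _ _) _; rewrite !cnormZE.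
  apply: lerD; apply: ler_pM; rewrite ?cabs_ge0 ?cnorm_ge0 ?phia //.
  by apply: le_trans (phia _) _; rewrite ler_wpM2l.
have -> : cabs z * (nrm a * d + (nrm a * d * 2 + nrm a * 2 * d)) =
  12 * cabs z * nrm a * d * (5 / 12) by field.
have : 12 * cabs z * nrm a * d <= 1 * d by rewrite ler_wpM2r.
by move: (_ * d) => t; lra.
Qed.

(** Only the germ at 0 is meaningful: where the series diverges, [limn] returns a default value. *)
Definition R_series a z : R[i] := limn (series (fun n => R_coef phi a n * z ^+ n)).

Lemma R_seriesP a z : 12 * cabs z * nrm a <= 1 -> exists U,
  [/\ ccvg (fun n => \sum_(k < n) z ^+ k *: resolvent_coef phi a k) U,
      resolvent_eq phi a z U, nrm (U - 1) <= 6 * cabs z * nrm a,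
      nrm U <= 2 & R_series a z = z * phi (a * U)].
Proof.
move=> za; have [U [PU UE U1 /limCP RE]] := resolvent_series state_phi za.
exists U; split=> //; rewrite -[U](subrK 1).
apply: le_trans (cnormD _ _) _; rewrite cnorm1.
have : 0 <= cabs z * nrm a by rewrite mulr_ge0 ?cabs_ge0 ?cnorm_ge0.
by move: U1 za; rewrite -!mulrA; move: (cabs z * nrm a) (nrm _) => s t; lra.
Qed.

(** The 24 is twice the 12 of [resolvent_series], because the Cauchy transform at a large [zeta] has
    modulus at most [2 / |zeta|]. The 1 keeps the bound positive when [a = 0]. *)
Definition R_bound a : R := 24 * nrm a + 1.

Lemma R_bound_gt0 a : 0 < R_bound a.
Proof. by rewrite /R_bound; have := cnorm_ge0 a; lra. Qed.

Lemma R_bound_small a z : cabs z <= (R_bound a)^-1 -> 12 * cabs z * nrm a <= 2^-1.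
Proof.
rewrite -[_^-1]div1r ler_pdivlMr ?R_bound_gt0 // /R_bound mulrDr mulrCA.
have := cabs_ge0 z; rewrite -(mulrA 12); move: (cabs z * nrm a) => t; lra.
Qed.

(** Let [Y] be the Neumann inverse of [1 - zeta^-1 a]. Then [z = phi Y / zeta], and the
    normalisation [U = Y / phi Y] solves [resolvent_eq] at [z]. Since [|a| / |zeta| <= 1/24], one
    has [|Y - 1| <= 1/23], whence the bounds 22/23 and 24/23 on [|phi Y|]. *)
Lemma cauchy_transform_large a zeta : R_bound a <= cabs zeta ->
  let z := cauchy_transform phi a zeta in
  [/\ z != 0, cabs z <= 2 / cabs zeta, 12 * cabs z * nrm a <= 1 &
      exists U, [/\ resolvent_eq phi a z U, nrm U <= 2 & 1 + z * phi (a * U) = zeta * z]].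
Proof.
move=> + z; rewrite /R_bound => zeta_large; set K := nrm a in zeta_large *.
have K0 : 0 <= K := cnorm_ge0 a.
have zeta0 : 0 < cabs zeta by lra.
have zetan0 : zeta != 0 by rewrite -cabs_gt0.
set d := K / cabs zeta; have d0 : 0 <= d by rewrite divr_ge0 ?cabs_ge0.
have d24 : d <= 24^-1 by rewrite ler_pdivrMr // mulrC ler_pdivlMr //; lra.
have xd : nrm (zeta^-1 *: a) = d by rewrite cnormZE cabsV mulrC.
have [|Y [xY Yx _ Y1]] := @neumann R A (zeta^-1 *: a); first by rewrite xd; lra.
rewrite xd in Y1.
have d23 : d / (1 - d) <= 23^-1.
  by rewrite ler_pdivrMr; [|lra]; move: d24; move: (d) => t; lra.
have {}Y1 : nrm (Y - 1) <= 23^-1 by exact: le_trans d23.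
have xu : 1 - zeta^-1 *: a \is a GRing.unit by apply/unitrP; exists Y.
have zE : z = zeta^-1 * phi Y.
  rewrite /z /cauchy_transform.
  have -> : zeta%:A - a = zeta *: (1 - zeta^-1 *: a).
    by rewrite scalerBr scalerA mulfV // scale1r.
  by have [_ ->] := unit_scale zetan0 xu; rewrite (invr_right xu xY) linearZ.
have phiY1 : cabs (phi Y - 1) <= 23^-1.
  by rewrite -phi1 -linearB /= (le_trans (cabs_phi state_phi _)).
have phiY_ge : 22 / 23 <= cabs (phi Y).
  by have := cabsD (1 - phi Y) (phi Y); rewrite subrK cabs1 -cabsN opprB; lra.
have phiY_le : cabs (phi Y) <= 24 / 23.
  by have := cabsD (phi Y - 1) 1; rewrite subrK cabs1; lra.
have phiY0 : phi Y != 0 by rewrite -cabs_gt0; lra.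
have z_le : cabs z <= 2 / cabs zeta.
  by rewrite zE cabsM cabsV mulrC ler_wpM2r ?invr_ge0 ?cabs_ge0 //; lra.
have zK : cabs z * K <= 2 * d.
  have -> : 2 * d = 2 / cabs zeta * K by rewrite /d [RHS]mulrAC mulrA.
  exact: ler_wpM2r.
split=> //; first by rewrite zE mulf_neq0 ?invr_neq0.
  by rewrite -mulrA; move: zK d24; move: (_ * K) (d) => s t; lra.
have MU : (1 + (zeta * z - 1))%:A - z *: a = phi Y *: (1 - zeta^-1 *: a).
  by rewrite [1 + _]addrCA subrr addr0 zE mulrA mulfV // mul1r scalerBr scalerA [phi Y * _]mulrC.
have MY : ((1 + (zeta * z - 1))%:A - z *: a) * ((phi Y)^-1 *: Y) = 1.
  by rewrite MU -scalerAl -scalerAr xY scalerA mulfV // scale1r.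
have zaU : z * phi (a * ((phi Y)^-1 *: Y)) = zeta * z - 1.
  have phiU : phi ((phi Y)^-1 *: Y) = 1 by rewrite linearZ /= mulVf.
  move: MY phiU; move: ((phi Y)^-1 *: Y) => U /(congr1 phi) + phiU.
  rewrite mulrBl mulr_algl -scalerAl linearB /= 2!linearZ /= phiU phi1 mulr1 => E.
  by rewrite -[in RHS]E; ring.
exists ((phi Y)^-1 *: Y); split.
- by apply/resolvent_eqP; rewrite zaU.
- rewrite cnormZE cabsV mulrC ler_pdivrMr ?cabs_gt0 //.
  have := cnormD (Y - 1) 1; rewrite subrK cnorm1; lra.
- by rewrite zaU addrC subrK.
Qed.

Lemma R_series_transform a : R_transform phi a (R_series a).
Proof.
have e0 : 0 < (R_bound a)^-1 by rewrite invr_gt0 R_bound_gt0.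
have small z : cabs z < (R_bound a)^-1 -> 12 * cabs z * nrm a <= 1.
  by move=> /ltW /R_bound_small; lra.
split.
- exists (R_coef phi a) => //; apply/near0C; exists (R_bound a)^-1 => // z /small za.
  have [U [_ _ _ H]] := resolvent_series state_phi za.
  by rewrite /R_series (limCP H).
- apply/dnear0C; exists (R_bound a)^-1 => // z z0 /small za.
  have [U [PU UE _ U2 RE]] := R_seriesP za.
  rewrite /cauchy_transform /K_of RE.
  have [_ ->] := resolvent_eq_unit z0 za U2 UE; rewrite linearZ /=.
  (* The shift by one skips the empty partial sum, whose expectation is 0 instead of 1. *)
  rewrite (phi_ccvg_cst state_phi (ccvg_shift 1 PU) (c := 1)) ?mulr1 // => n.
  rewrite addn1 linear_sum big_ord_recl expr0 scale1r /= phi1 big1 ?addr0 // => k _.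
  by rewrite linearZ /= phi_resolvent_coef // mulr0.
(* The solution built from [zeta] and the sum of the power series at [z] agree by
   [resolvent_eq_unique], so [K (G zeta) = zeta]. *)
exists (R_bound a)%:C => zeta; rewrite -cabsE ltcR => /ltW zl.
have [z0 _ za [U [UE U2 Uz]]] := cauchy_transform_large zl.
have [V [_ VE _ V2 RE]] := R_seriesP za.
rewrite /K_of RE (resolvent_eq_unique za V2 U2 VE UE) Uz mulrCA mulVf ?mulr1 //.
Qed.

Lemma R_transform_of_germ a Rb :
  (\forall z \near (0 : R[i]), Rb z = R_series a z) -> R_transform phi a Rb.
Proof.
have [[c c0 cR] /dnear0C[d d0 GK] _] := R_series_transform a.
move=> /near0C[e e0 eE]; split.
- exists c; first exact: c0.
  move/near0C: cR => [f f0 fR]; apply/near0C.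
  exists (Num.min e f) => [|z]; first by rewrite lt_min e0.
  by rewrite lt_min => /andP[ze zf]; rewrite eE //; exact: fR.
- apply/dnear0C; exists (Num.min d e) => [|z z0]; first by rewrite lt_min d0.
  by rewrite lt_min => /andP[zd ze]; rewrite /K_of eE //; exact: GK.
(* The bound [2 / e] brings [|G zeta| <= 2 / |zeta|] below [e], where the two germs agree. *)
exists (Num.max (R_bound a) (2 / e))%:C => zeta.
rewrite -cabsE ltcR gt_max => /andP[/ltW zl ze].
have [z0 zle za [U [UE U2 Uz]]] := cauchy_transform_large zl.
have [V [_ VE _ V2 RE]] := R_seriesP za.
have zeta0 : 0 < cabs zeta by exact: lt_le_trans (R_bound_gt0 a) zl.
rewrite /K_of eE; last first.
  by rewrite (le_lt_trans zle) // ltr_pdivrMr // mulrC -ltr_pdivrMr.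
by rewrite RE (resolvent_eq_unique za V2 U2 VE UE) Uz mulrCA mulVf ?mulr1.
Qed.

(** Convergence at [z0] bounds the terms there; at half that radius the series is dominated by a
    geometric one of ratio [q <= 1/2], and the vanishing constant term leaves a factor [|z|]. *)
Lemma power_series_bound (c : nat -> R[i]) (z0 : R[i]) (l0 : R[i]) :
  c 0%N = 0 -> z0 != 0 -> series (fun n => c n * z0 ^+ n) @ \oo --> l0 ->
  exists2 B : R, 0 < B & forall z l, 2 * cabs z <= cabs z0 ->
    series (fun n => c n * z ^+ n) @ \oo --> l -> cabs l <= B * cabs z.
Proof.
move=> c0 z00 cz0.
have /cvgCP/cvgn0P/(_ 1 ltr01)[n0 cn0] : (fun n => c n * z0 ^+ n) @ \oo --> (0 : R[i]).
  by apply: cvg_series_cvg_0; apply: cvgP cz0.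
pose B := 1 + \sum_(k < n0) cabs (c k * z0 ^+ k).
have S0 : 0 <= \sum_(k < n0) cabs (c k * z0 ^+ k).
  by apply: sumr_ge0 => k _; exact: cabs_ge0.
have B0 : 0 < B by rewrite /B; lra.
have cB n : cabs (c n) * cabs z0 ^+ n <= B.
  rewrite -cabsX -cabsM; have [n0n|nn0] := leqP n0 n.
    by have := cn0 n n0n; rewrite subr0 ger0_norm ?cabs_ge0 // /B; lra.
  rewrite /B (bigD1 (Ordinal nn0)) //= addrCA lerDl addr_ge0 //.
  by apply: sumr_ge0 => k _; exact: cabs_ge0.
have z0p : 0 < cabs z0 by rewrite cabs_gt0.
exists (2 * B / cabs z0) => [|z l zz0 cz]; first by rewrite divr_gt0 ?mulr_gt0.
set q := cabs z / cabs z0; have q0 : 0 <= q by rewrite divr_ge0 ?cabs_ge0.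
have q2 : q * 2 <= 1 by rewrite /q mulrAC ler_pdivrMr // mul1r mulrC.
have -> : 2 * B / cabs z0 * cabs z = 2 * B * q by rewrite /q; ring.
have term n : cabs (c n * z ^+ n) <= B * q ^+ n.
  rewrite cabsM cabsX (_ : cabs z = cabs z0 * q); last first.
    by rewrite /q mulrCA mulfV ?mulr1 ?gt_eqF.
  by rewrite exprMn mulrA ler_wpM2r ?exprn_ge0.
have part n : cabs (series (fun n => c n * z ^+ n) n.+1) <= 2 * B * q - 2 * B * q ^+ n.+1.
  elim: n => [|n IHn].
    by rewrite /series /= big_nat1 c0 mul0r cabs0 expr1 subrr.
  rewrite /series /= big_nat_recr //= -/(series (fun n => c n * z ^+ n) n.+1).
  apply: le_trans (cabsD _ _) _; apply: le_trans (lerD IHn (term _)) _.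
  have : 0 <= B * q ^+ n.+1 by rewrite mulr_ge0 ?exprn_ge0 // ltW.
  rewrite (exprSr q n.+1) -!(mulrA 2) !(mulrA B); move: (B * q ^+ n.+1) => t; nra.
have cl : (fun n => cabs (series (fun n => c n * z ^+ n) (n + 1)%N - l) + 2 * B * q)
    @ \oo --> 2 * B * q.
  rewrite -[X in _ --> X]add0r; apply: cvgD; last exact: cvg_cst.
  by move/cvgCP : cz; rewrite -(cvg_shiftn 1).
apply: (cvgr_to_ge cl); apply: nearW => n.
set s := series _ _; have := cabsD (s - l) (- s).
rewrite addrAC subrr add0r !cabsN => /le_trans; apply; rewrite lerD2l /s addn1.
apply: le_trans (part n) _; rewrite lerBlDr lerDl mulr_ge0 ?exprn_ge0 //.
by rewrite mulr_ge0 ?ltW.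
Qed.

(* Near 0, [K(z)] is large since [Rb] vanishes at 0, so the left inverse of the
   Cauchy transform given by [R_series] can be applied to [G(K(z)) = z]. *)
Lemma R_transform_germ a (c : nat -> R[i]) Rb : c 0%N = 0 ->
  (\forall z \near (0 : R[i]), series (fun n => c n * z ^+ n) @ \oo --> Rb z) ->
  (\forall z \near (0 : R[i])^', cauchy_transform phi a (K_of Rb z) = z) ->
  \forall z \near (0 : R[i]), Rb z = R_series a z.
Proof.
move=> c0 /near0C[e e0 cR] /dnear0C[d d0 GK].
pose w : R[i] := (e / 2)%:C.
have e20 : 0 < e / 2 by rewrite divr_gt0.
have cw : cabs w = e / 2 by rewrite cabs_real gtr0_norm.
have w0 : w != 0 by rewrite -cabs_gt0 cw.
have we : cabs w < e by rewrite cw; lra.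
have [B B0 RB] := power_series_bound c0 w0 (cR w we).
have b0 := R_bound_gt0 a.
(* In turn: [G (K z) = z] holds; [2 |z| <= |w|]; [|Rb z| <= 1/2]; and then
   [|K z| >= 1 / (2 |z|) >= R_bound a]. *)
pose r := Num.min (Num.min d (e / 4)) (Num.min (B^-1 / 2) ((R_bound a)^-1 / 2)).
have r0 : 0 < r.
  by rewrite !lt_min d0 !divr_gt0 ?invr_gt0.
apply/near0C; exists r => // z; rewrite !lt_min => /andP[/andP[zd ze] /andP[zB zb]].
have [->|z0] := eqVneq z 0.
  have r0E : R_series a 0 = 0.
    have [|U [_ _ _ _ ->]] := @R_seriesP a 0; last by rewrite mul0r.
    by rewrite cabs0 mulr0 mul0r ler01.
  apply/eqP; rewrite r0E -cabs_eq0 eq_le cabs_ge0 andbT.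
  by have := RB 0 (Rb 0); rewrite cabs0 mulr0 mulr0; apply; rewrite ?cabs_ge0 //; apply: cR;
    rewrite cabs0.
have zp : 0 < cabs z by rewrite cabs_gt0.
have Rz : cabs (Rb z) <= 2^-1.
  apply: le_trans (RB z _ _ (cR z _)) _; [rewrite cw; lra|lra|].
  by rewrite mulrC -ler_pdivlMr //; lra.
have Kz : R_bound a <= cabs (K_of Rb z).
  rewrite /K_of cabsM cabsV mulrC ler_pdivlMr //.
  have := cabsD (1 + Rb z) (- Rb z); rewrite addrK cabs1 cabsN.
  have : R_bound a * cabs z <= 2^-1 by rewrite mulrC -ler_pdivlMr //; lra.
  by move: (_ * cabs z) => t; lra.
have := GK z z0 zd => GKz.
have [_ _ za [U [UE U2 Uz]]] := cauchy_transform_large Kz.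
rewrite GKz in za UE Uz.
have [V [_ VE _ V2 ->]] := R_seriesP za.
rewrite (resolvent_eq_unique za V2 U2 VE UE); apply: (addrI 1).
by rewrite Uz /K_of mulrAC mulVf // mul1r.
Qed.

Lemma R_transform_germE a Rb : R_transform phi a Rb ->
  \forall z \near (0 : R[i]), Rb z = R_series a z.
Proof. by case=> [[c c0 cR] GK _]; exact: R_transform_germ cR GK. Qed.

End AnalyticRTransform.

(** * The resolvent of a free sum near 0 *)

Section AlternatingSpan.
Context {F : fieldType} {A : algType F} (phi : {scalar A}) {N : nat}.
Variables (B : 'I_N -> set A) (S : 'I_N -> A).
Hypothesis BS : forall i, B i (S i).
Hypothesis phiS : forall i, phi (S i) = 0.

Lemma alt_head_span n i : head_span phi B i (alt_head S n i).
Proof.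
elim: n i => [|n IHn] i /=; first exact: head_span1.
by rewrite mulr_sumr; apply: lin_span_sum => j ij; exact: head_spanM (IHn j).
Qed.

Lemma phi_alt_psum n : free_sets phi B -> phi 1 = 1 -> phi (alt_psum S n) = 1.
Proof.
move=> freeB phi1; elim: n => [|n IHn]; first by rewrite alt_psum0.
rewrite alt_psumS linearD /= IHn linear_sum big1 ?addr0 // => i _.
exact: head_span0 freeB (alt_head_span n i).
Qed.

End AlternatingSpan.

Section NormClosure.
Context {R : realType} {A : cstarAlgType R}.
Implicit Types (S : set A) (x y : A).

Definition norm_closure S : set A :=
  [set x | exists2 u : nat -> A, (forall n, S (u n)) & ccvg u x].

Lemma sub_norm_closure S : S `<=` norm_closure S.
Proof. by move=> x Sx; exists (fun=> x) => //; exact: ccvg_cst. Qed.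

Lemma norm_closure_subalgebra S : subalgebra S -> subalgebra (norm_closure S).
Proof.
move=> algS; split; first exact/sub_norm_closure/(subalg1 algS).
  move=> c x y [u Su ux] [v Sv vy]; exists (fun n => c *: u n + v n) => [n|].
    exact: (subalgZD algS).
  by apply: ccvgD => //; exact: ccvgZ.
move=> x y [u Su ux] [v Sv vy]; exists (fun n => u n * v n) => [n|].
  exact: (subalgM algS).
exact: ccvgM.
Qed.

Lemma norm_closureP S x : norm_closure S x <->
  forall e, 0 < e -> exists2 y, S y & cnorm (y - x) < e.
Proof.
split=> [[u Su /cvgn0P ux] e /ux[n un]|Sx].
  by exists (u n) => //; have := un n (leqnn n); rewrite ger0_norm ?cnorm_ge0.
have /choice[u uP] : forall n, exists y, S y /\ cnorm (y - x) < n.+1%:R^-1.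
  by move=> n; have [|y Sy yx] := Sx n.+1%:R^-1; [rewrite invr_gt0|exists y].
exists u => [n|]; first by have [] := uP n.
apply: (ccvg_le (t := fun n => n.+1%:R^-1)) => [n|]; last exact: cvg_harmonic.
by apply: ltW; have [] := uP n.
Qed.

Lemma norm_closure_closed S : subalgebra S -> closed_subalgebra (norm_closure S).
Proof.
move=> algS; split=> [|u x Su /cvgn0P ux]; first exact: norm_closure_subalgebra.
apply/norm_closureP => e e0; have [|n un] := ux (e / 2); first by rewrite divr_gt0.
have [|y Sy yu] := (norm_closureP S (u n)).1 (Su n) (e / 2).
  by rewrite divr_gt0.
exists y => //; apply: le_lt_trans (cnorm_dist _ (u n) _) _.
have := un n (leqnn n); rewrite ger0_norm ?cnorm_ge0 //.
by move: (cnorm (u n - x)) yu => t; lra.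
Qed.

Lemma norm_closure_star S : (forall x, S x -> S (star x)) ->
  forall x, norm_closure S x -> norm_closure S (star x).
Proof.
move=> starS x [u Su ux]; exists (fun n => star (u n)) => [n|]; first exact: starS.
exact: ccvg_star.
Qed.

(** The approximants of a centred element are recentred by subtracting their expectations, which
    tend to 0; products and [phi] then pass to the limit. *)
Lemma norm_closure_free (phi : {scalar A}) (I : eqType) (B : I -> set A) :
  is_state phi -> (forall i, subalgebra (B i)) -> free_sets phi B ->
  free_sets phi (fun i => norm_closure (B i)).
Proof.
move=> state_phi algB freeB n i a Ba i_neq.
have phi1 : phi 1 = 1 := state_phi.1.
have /choice[v vP] : forall j, exists v : nat -> A, (j <= n)%N ->
    (forall k, B (i j) (v k) /\ phi (v k) = 0) /\ ccvg v (a j).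
  move=> j; have [jn|_] := leqP j n; last by exists (fun=> 0).
  have [[u Bu ua] a0] := Ba j jn.
  exists (fun k => u k - (phi (u k))%:A) => _; split=> [k|].
    split; last by rewrite linearB /= phi_alg // subrr.
    by apply: (subalgB (algB _)) => //; exact: (subalg_alg (algB _)).
  rewrite -[a j]subr0; apply: ccvgB => //.
  apply: (ccvg_le (t := fun k => cnorm (u k - a j))) => // k.
  rewrite subr0 cnorm_alg (_ : phi (u k) = phi (u k - a j)) ?cabs_phi //.
  by rewrite linearB /= a0 subr0.
apply: (phi_ccvg_cst state_phi (u := fun k => \prod_(0 <= j < n.+1) v j k)); last first.
  move=> k; apply: (freeB n i (v^~ k)) => // j jn.
  by have [/(_ k)] := vP j jn.
have : (n.+1 <= n.+1)%N by [].
move: {1 3 4}n.+1 => m; elim: m => [|m IHm] mn.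
  under [X in ccvg X]eq_fun => k do rewrite big_nil.
  by rewrite big_nil; exact: ccvg_cst.
under [X in ccvg X]eq_fun => k do rewrite big_nat_recr //=.
rewrite big_nat_recr //=; apply: ccvgM; first exact/IHm/ltnW.
by have [] := vP m mn.
Qed.

End NormClosure.

Lemma gen_subalgebra_star (R : realType) (A : cstarAlgType R) (G : set A) :
  (forall x, G x -> gen_subalgebra G (star x)) ->
  forall x, gen_subalgebra G x -> gen_subalgebra G (star x).
Proof.
move=> starG x; have algG := gen_subalgebraP G.
apply: (@gen_subalgebra_min _ _ _ [set y | gen_subalgebra G (star y)]) => //.
split=> [|c u v Gu Gv|u v Gu Gv] /=.
- by rewrite star1; exact: (subalg1 algG).
- by rewrite starD starZ; exact: (subalgZD algG).
- by rewrite starM; exact: (subalgM algG).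
Qed.

Section ResolventOfSum.
Context {R : realType} {A : cstarAlgType R} {N : nat}.
Variables (z : R[i]) (r : 'I_N -> R[i]) (T S : 'I_N -> A).
Let X i : A := z *: ((z^-1 * (1 + r i))%:A - T i).
Hypothesis z0 : z != 0.
Hypothesis XS : forall i, X i * (1 + S i) = 1.
Let res : A := (z^-1 * (1 + \sum_i r i))%:A - \sum_i T i.

Lemma sum_resolventE : res = z^-1 *: (1 + \sum_i (X i - 1)).
Proof.
have XE i : X i - 1 = (r i)%:A - z *: T i.
  rewrite /X scalerBr scalerA mulrA mulfV // mul1r scalerDl scale1r.
  by rewrite -[1 + _ - _]addrA [LHS]addrAC subrr add0r.
rewrite /res (eq_bigr _ (fun i _ => XE i)) sumrB scalerDr scalerBr.
rewrite -scaler_suml -scaler_sumr !scalerA mulVf // scale1r addrA -scalerDl.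
by rewrite mulrDr mulr1.
Qed.

Lemma sum_resolvent_psum n :
  res * (z *: alt_psum S n) = 1 - \sum_i X i * alt_head S n i.
Proof.
rewrite sum_resolventE -scalerAl -scalerAr scalerA mulVf // scale1r.
exact: alt_psum_inverse.
Qed.

End ResolventOfSum.

Section AnalyticSum.
Context {R : realType} {A : cstarAlgType R} (phi : {scalar A}).
Context {N : nat} (T : 'I_N -> A) (Rf : 'I_N -> R[i] -> R[i]).
Hypothesis state_phi : is_state phi.
Hypothesis freeT : freely_independent phi T.
Hypothesis RT : forall i, R_transform phi (T i) (Rf i).

Local Notation nrm := (@cnorm R A).
Let phi1 : phi 1 = 1 := state_phi.1.
Let K (z : R[i]) := K_of (fun w => \sum_i Rf i w) z.
Let S (z : R[i]) (i : 'I_N) := S_of (Rf i) (T i) z.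
Let res (z : R[i]) : A := (K z)%:A - \sum_i T i.
Let X z i : A := z *: ((K_of (Rf i) z)%:A - T i).

Let alt_head_norm z n i (s := \sum_j nrm (S z j)) :
  nrm (alt_head (S z) n i) <= nrm (S z i) * s ^+ n.
Proof.
have s0 : 0 <= s by apply: sumr_ge0 => j _; exact: cnorm_ge0.
elim: n i => [|n IHn] i /=; first by rewrite mulr1.
apply: le_trans (cnormM _ _) _; rewrite exprS ler_wpM2l ?cnorm_ge0 //.
apply: le_trans (cnorm_sum _ _ _) _; rewrite mulr_suml big_mkcond.
apply: ler_sum => j _; case: ifP => // _.
by rewrite mulr_ge0 ?cnorm_ge0 ?exprn_ge0.
Qed.

(** Near 0 the element [1 + S z i] is the sum of the resolvent series, a norm limit of polynomials
    in [T i] alone; without adjoints, plain freeness applies to it. *)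
Let near_component : \forall z \near (0 : R[i])^', forall i,
  [/\ (K_of (Rf i) z)%:A - T i \is a GRing.unit,
      norm_closure (gen_subalgebra [set T i]) (S z i), phi (S z i) = 0 &
      nrm (S z i) <= 6 * cabs z * nrm (T i)].
Proof.
apply: filter_forall => i.
have /near0C[e e0 RE] := R_transform_germE state_phi (RT i).
apply/dnear0C; exists (Num.min e (R_bound (T i))^-1) => [|z z0].
  by rewrite lt_min e0 invr_gt0 R_bound_gt0.
rewrite lt_min => /andP[ze /ltW /R_bound_small za'].
have za : 12 * cabs z * nrm (T i) <= 1 by lra.
have [U [PU UE U1 U2 RU]] := R_seriesP state_phi za.
have KE : K_of (Rf i) z = z^-1 * (1 + z * phi (T i * U)) by rewrite /K_of RE // RU.
have [Ku KV] := resolvent_eq_unit state_phi z0 za U2 UE.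
have SE : S z i = U - 1.
  by rewrite /S /S_of KE KV scalerA mulVf // scale1r.
have algT := gen_subalgebraP [set T i].
have uT n : gen_subalgebra [set T i] (resolvent_coef phi (T i) n).
  elim/ltn_ind: n => -[|m] IH; first by rewrite resolvent_coef0; exact: (subalg1 algT).
  rewrite resolvent_coefS; apply: (subalgB algT).
    by apply: (subalgM algT); [exact: gen_subalgebra_gen|exact: IH].
  apply: (subalg_sum algT) => j _; apply: (subalgZ algT); apply: IH.
  by rewrite ltnS leq_subr.
split; rewrite ?SE ?KE //.
  apply: (subalgB (norm_closure_subalgebra algT)); last by apply: sub_norm_closure; exact: (subalg1 algT).
  exists (fun n => \sum_(k < n) z ^+ k *: resolvent_coef phi (T i) k) => // n.
  by apply: (subalg_sum algT) => k _; exact: (subalgZ algT).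
rewrite linearB /= phi1 (phi_ccvg_cst state_phi (ccvg_shift 1 PU) (c := 1)) ?subrr // => n.
rewrite addn1 linear_sum big_ord_recl expr0 scale1r /= phi1 big1 ?addr0 // => k _.
by rewrite linearZ /= phi_resolvent_coef // mulr0.
Qed.

(** The radius makes [s], the sum of the norms of the [S z i], less than 1/4. Then
    [|X z i - 1| <= 2 |S z i|], so [1 + sum_i (X z i - 1)] is within 1/2 of the identity, and the
    errors of the partial sums decay like [s^n]. *)
Lemma resolvent_sum_near0 : \forall z \near (0 : R[i])^',
  [/\ forall i, ((K_of (Rf i) z)%:A - T i \is a GRing.unit) /\ phi (S z i) = 0,
      res z \is a GRing.unit,
      ccvg (fun n => z *: alt_psum (S z) n) (res z)^-1 &
      phi (res z)^-1 = z].
Proof.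
have /dnear0C[d d0 comp] := near_component.
pose M := \sum_i nrm (T i); have M0 : 0 <= M by apply: sumr_ge0 => i _; exact: cnorm_ge0.
apply/dnear0C; exists (Num.min d (24 * M + 1)^-1) => [|z z0].
  by rewrite lt_min d0 invr_gt0; lra.
rewrite lt_min => /andP[zd zM].
have {}comp := comp z z0 zd.
pose s := \sum_i nrm (S z i).
have s0 : 0 <= s by apply: sumr_ge0 => i _; exact: cnorm_ge0.
have s4 : s < 4^-1.
  have : s <= 6 * (cabs z * M).
    by rewrite mulrA mulr_sumr; apply: ler_sum => i _; have [] := comp i.
  have : cabs z * (24 * M + 1) < 1 by rewrite -ltr_pdivlMr ?div1r //; lra.
  rewrite mulrDr mulrCA; have := cabs_ge0 z; move: (cabs z * M) => t; lra.
have sn0 : (fun n => s ^+ n) @ \oo --> (0 : R) by apply: cvgn_geometric => //; lra.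
have XE i : X z i * (1 + S z i) = 1 /\ nrm (X z i - 1) <= 2 * nrm (S z i).
  have [Ku _ _ _] := comp i.
  have E1 : 1 + S z i = z^-1 *: ((K_of (Rf i) z)%:A - T i)^-1.
    by rewrite /S /S_of addrC subrK.
  have XS1 : X z i * (1 + S z i) = 1.
    by rewrite E1 /X -scalerAl -scalerAr scalerA mulfV // scale1r mulrV.
  have si : nrm (S z i) <= s.
    by rewrite /s (bigD1 i) //= lerDl; apply: sumr_ge0 => j _; exact: cnorm_ge0.
  have [|Y [_ YS _ Y1]] := @neumann R A (- S z i); first by rewrite cnormN; lra.
  rewrite cnormN opprK in YS Y1; split=> //.
  have -> : X z i = Y.
    have SX1 : (1 + S z i) * X z i = 1.
      by rewrite E1 /X -scalerAl -scalerAr scalerA mulVf // scale1r mulVr.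
    by rewrite -[LHS]mul1r -YS -mulrA SX1 mulr1.
  apply: le_trans Y1 _; rewrite ler_pdivrMr; last by lra.
  by have := cnorm_ge0 (S z i); move: si s4; move: (nrm _) => t; nra.
have XS i : X z i * (1 + S z i) = 1 by have [] := XE i.
have resE : res z = z^-1 *: (1 + \sum_i (X z i - 1)).
  exact: (@sum_resolventE R A N z (fun i => Rf i z) T z0).
have resu : res z \is a GRing.unit.
  rewrite resE; have [||//] := @unit_scale _ A z^-1 (1 + \sum_i (X z i - 1)).
    by rewrite invr_neq0.
  apply: unit_near1; rewrite opprD addrA subrr add0r cnormN.
  apply: le_lt_trans (cnorm_sum _ _ _) _.
  apply: le_lt_trans (_ : 2 * s < 1); last by lra.
  by rewrite mulr_sumr; apply: ler_sum => i _; have [] := XE i.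
have resP n : res z * (z *: alt_psum (S z) n) = 1 - \sum_i X z i * alt_head (S z) n i.
  exact: (@sum_resolvent_psum R A N z (fun i => Rf i z) T (S z) z0 XS).
have psum_cvg : ccvg (fun n => z *: alt_psum (S z) n) (res z)^-1.
  have E n : z *: alt_psum (S z) n = (res z)^-1 * (1 - \sum_i X z i * alt_head (S z) n i).
    by rewrite -resP mulKr.
  rewrite -(mulr1 (res z)^-1).
  under [X in ccvg X]eq_fun => n do rewrite E.
  apply: ccvgMl.
  apply: (ccvg_le (t := fun n => (\sum_i nrm (X z i) * nrm (S z i)) * s ^+ n)) => [n|].
    rewrite addrAC subrr add0r cnormN (le_trans (cnorm_sum _ _ _)) // mulr_suml.
    apply: ler_sum => i _; apply: le_trans (cnormM _ _) _; rewrite -mulrA.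
    by rewrite ler_wpM2l ?cnorm_ge0.
  exact: cvgn0_mull.
split=> // [i|]; first by have [] := comp i.
apply: (phi_ccvg_cst state_phi psum_cvg) => n.
rewrite linearZ /= (@phi_alt_psum _ _ phi _
  (fun i => norm_closure (gen_subalgebra [set T i]))) ?mulr1 //.
- by move=> i; have [] := comp i.
- by move=> i; have [] := comp i.
by apply: norm_closure_free => // i; exact: gen_subalgebraP.
Qed.

(** Only [G (K z) = z] is proved directly, as the expectation of the resolvent. [R_transform_germ]
    then identifies the germ with that of [R_series], from which the composition in the other order
    is inherited. *)
Lemma R_transform_sum : R_transform phi (\sum_i T i) (fun w => \sum_i Rf i w).
Proof.
apply: R_transform_of_germ => //.
have /choice[c cP] : forall i, exists c : nat -> R[i], c 0%N = 0 /\
    \forall z \near (0 : R[i]), series (fun n => c n * z ^+ n) @ \oo --> Rf i z.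
  by move=> i; have [[c c0 cR] _ _] := RT i; exists c.
apply: (@R_transform_germ _ _ _ state_phi _ (fun n => \sum_i c i n)).
- by rewrite big1 // => i _; have [] := cP i.
- have /near0C[e e0 ce] : \forall z \near (0 : R[i]), forall i,
      series (fun n => c i n * z ^+ n) @ \oo --> Rf i z.
    apply: near0C_forall => i; have [] := cP i; by [].
  apply/near0C; exists e => // z /ce cz.
  apply/cvgCP; apply: (cvgn0_le (v := fun n =>
    \sum_i cabs (series (fun n => c i n * z ^+ n) n - Rf i z))) => [n|].
    rewrite cabs_ge0 /=.
    have -> : series (fun n => (\sum_i c i n) * z ^+ n) n - \sum_i Rf i z =
        \sum_i (series (fun n => c i n * z ^+ n) n - Rf i z).
      rewrite sumrB; congr (_ - _); rewrite /series /= exchange_big /=.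
      by apply: eq_bigr => k _; rewrite mulr_suml.
    elim/big_rec2: _ => [|i y x _ xy]; first by rewrite cabs0.
    by apply: le_trans (cabsD _ _) _; apply: lerD.
  by apply: cvgn0_sum => i _; apply/cvgCP; exact: cz.
have /dnear0C[e e0 H] := resolvent_sum_near0.
by apply/dnear0C; exists e => // z z0 ze; have [_ _ _] := H z z0 ze.
Qed.

End AnalyticSum.

Lemma R_transform_add (R : realType) (A : cstarAlgType R) (phi : {scalar A})
    (a b : A) (Ra Rb Rab : R[i] -> R[i]) : is_state phi ->
  freely_independent phi (fun c : bool => if c then a else b) ->
  R_transform phi a Ra -> R_transform phi b Rb -> R_transform phi (a + b) Rab ->
  \forall z \near (0 : R[i]), Rab z = Ra z + Rb z.
Proof.
move=> state_phi freeab Ra_a Rb_b /(R_transform_germE state_phi)/near0C[e e0 eE].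
pose f (i : 'I_2) : bool := i == ord0.
pose T (i : 'I_2) := if f i then a else b.
pose Rf (i : 'I_2) := if f i then Ra else Rb.
have freeT : freely_independent phi T.
  move=> n i x xB i_neq; apply: (freeab n (f \o i)) => // j jn.
  apply: contra (i_neq j jn); rewrite /f /=.
  by case: (i j) (i j.+1) => [[|[|?]] ?] [[|[|?]] ?].
have RT i : R_transform phi (T i) (Rf i) by rewrite /T /Rf; case: (f i).
have := R_transform_sum state_phi freeT RT.
have -> : \sum_i T i = a + b by rewrite big_ord_recl big_ord1.
move=> /(R_transform_germE state_phi)/near0C[d d0 dE].
apply/near0C; exists (Num.min e d) => [|z]; first by rewrite lt_min e0.
rewrite lt_min => /andP[ze zd]; rewrite eE // -dE //.
by rewrite big_ord_recl big_ord1.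
Qed.

(** * The alternating series of squared norms *)

Section RealAlternatingSeries.
Context {R : realType} {N : nat} (q : 'I_N -> R).
Hypothesis q0 : forall i, 0 <= q i.
Let s := \sum_i q i / (1 + q i).
Let F n i := \sum_(k < n) alt_head q k i.

Lemma alt_head_ge0 n i : 0 <= alt_head q n i.
Proof.
by elim: n i => [|n IHn] i //=; rewrite mulr_ge0 ?sumr_ge0.
Qed.

Lemma alt_psum_nondecreasing : {homo alt_psum q : m n / (m <= n)%N >-> m <= n}.
Proof.
apply: homo_leq => [//|???|n]; first exact: le_trans.
by rewrite alt_psumS lerDl; apply: sumr_ge0 => i _; exact: alt_head_ge0.
Qed.

Let alt_psumF n : alt_psum q n = 1 + \sum_i F n i.
Proof.
elim: n => [|n IHn].
  by rewrite alt_psum0 /F big1 ?addr0 // => i _; rewrite big_ord0.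
rewrite alt_psumS IHn -addrA -big_split; congr (_ + _); apply: eq_bigr => i _.
by rewrite /F big_ord_recr.
Qed.

(** A word starting with [i] is [i] followed by a word, possibly empty, not starting with [i]. In
    the limit [L i = q i * (P - L i)], which is the origin of the weights [q i / (1 + q i)]. *)
Let FS n i : F n.+1 i = q i * (alt_psum q n - F n i).
Proof.
rewrite {1}/F big_ord_recl /= -mulr_sumr exchange_big /=.
by rewrite -/(F n _) (sum_neq (F n)) alt_psumF; ring.
Qed.

Let F_mono i : {homo F^~ i : m n / (m <= n)%N >-> m <= n}.
Proof.
apply: homo_leq => [//|???|n]; first exact: le_trans.
by rewrite /F big_ord_recr lerDl alt_head_ge0.
Qed.

Let q1 i : 0 < 1 + q i. Proof. by rewrite ltr_pwDl. Qed.

(** Monotonicity of [F] turns [FS] into [(1 + q i) * F n i <= q i * alt_psum q n]; summed over [i],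
    this reads [P - 1 <= s P] for the partial sum [P]. *)
Lemma alt_psum_le n : s < 1 -> alt_psum q n <= (1 - s)^-1.
Proof.
move=> s1; rewrite -div1r ler_pdivlMr ?subr_gt0 // mulrBr mulr1 lerBlDr -lerBlDl.
rewrite {1}alt_psumF addrAC subrr add0r /s mulr_sumr; apply: ler_sum => i _.
have : F n i <= F n.+1 i by apply: F_mono.
by rewrite mulrA ler_pdivlMr // FS; move: (F n i) (alt_psum q n) => x y; lra.
Qed.

(** Passing to the limit in [FS] gives [P * (1 - s) = 1] for the limit [P >= 1], so boundedness
    alone forces [s < 1]. *)
Lemma alt_psum_bounded_cvg b : (forall n, alt_psum q n <= b) ->
  s < 1 /\ alt_psum q @ \oo --> (1 - s)^-1.
Proof.
move=> qb.
have Fc i : cvgn (F^~ i).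
  apply: nondecreasing_is_cvgn; first exact: F_mono.
  exists b => _ [n _ <-]; apply: le_trans (qb n); rewrite alt_psumF (bigD1 i) //=.
  rewrite addrCA lerDl addr_ge0 // sumr_ge0 // => j _.
  by apply: sumr_ge0 => k _; exact: alt_head_ge0.
pose L i := limn (F^~ i); pose P := 1 + \sum_i L i.
have pP : alt_psum q @ \oo --> P.
  have -> : alt_psum q = (fun n => 1 + \sum_i F n i) by apply/funext => n; exact: alt_psumF.
  apply: cvgD; first exact: cvg_cst.
  have H : (fun n => \sum_i (F n i - L i)) @ \oo --> (0 : R).
    apply: (@cvgn0_sum _ _ _ _ (fun i n => F n i - L i)) => i _.
    by rewrite -(subrr (L i)); apply: cvgB; [exact: Fc|exact: cvg_cst].
  have -> : (fun n => \sum_i F n i) = (fun n => \sum_i (F n i - L i) + \sum_i L i).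
    by apply/funext => n; rewrite sumrB subrK.
  by rewrite -[X in _ --> X]add0r; apply: cvgD => //; exact: cvg_cst.
have LE i : L i = P * (q i / (1 + q i)).
  have : q i * (P - L i) = L i.
    apply: (@cvg_unique _ (@norm_hausdorff _ R) ((fun n => F n.+1 i) @ \oo)).
      have -> : (fun n => F n.+1 i) = (fun n => q i * (alt_psum q n - F n i)).
        by apply/funext => n; exact: FS.
      by apply: cvgM; [exact: cvg_cst|apply: cvgB => //; exact: Fc].
    have -> : (fun n => F n.+1 i) = (fun n => F (n + 1)%N i).
      by apply/funext => n; rewrite addn1.
    have := Fc i; rewrite -(cvg_shiftn 1); exact.
  move=> E; apply: (mulIf (lt0r_neq0 (q1 i))).
  by rewrite -mulrA divfK ?lt0r_neq0 // mulrDr mulr1 -{1}E; ring.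
have P1 : 1 <= P.
  apply: (cvgr_to_ge pP); apply: nearW => n.
  by rewrite -(alt_psum0 q); exact: alt_psum_nondecreasing.
have sP : P * (1 - s) = 1.
  by rewrite mulrBr mulr1 {1}/P (eq_bigr _ (fun i _ => LE i)) -mulr_sumr addrK.
have P0 : P != 0 by rewrite lt0r_neq0 //; lra.
have sE : 1 - s = P^-1 by apply: (mulfI P0); rewrite sP mulfV.
by split; [rewrite -subr_gt0 sE invr_gt0; lra|rewrite sE invrK].
Qed.

End RealAlternatingSeries.

(** * Inverses in the norm closure of a self-adjoint subalgebra *)

Section InverseInClosure.
Context {R : realType} {A : cstarAlgType R}.
Implicit Types (x b w : A).
Local Notation nrm := (@cnorm R A).

(* [b + i w] is unitary, and [b] is its real part. *)
Lemma norm_real_part b w : star b = b -> star w = w -> GRing.comm b w ->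
  b * b + w * w = 1 -> nrm b <= 1.
Proof.
move=> sb sw bw bw1; pose U := b + 'i%C *: w.
have sU : star U = b - 'i%C *: w.
  rewrite /U starD starZ sb sw -[in RHS]scaleNr; congr (_ + _ *: _).
  by rewrite complexiE conjCi.
have UU : star U * U = 1.
  rewrite sU /U mulrBl !mulrDr -!scalerAl -!scalerAr scalerA bw.
  rewrite (_ : 'i%C * 'i%C = -1); last by rewrite -expr2 sqr_i.
  by rewrite scaleN1r opprD opprK addrA addrK.
have U1 : nrm U = 1.
  have := cnorm_star U; rewrite UU cnorm1 => /esym/eqP.
  by rewrite sqrf_eq1 => /orP[/eqP//|/eqP E]; have := cnorm_ge0 U; rewrite E; lra.
have -> : b = (2^-1 : R)%:C *: (U + star U).
  rewrite sU addrACA subrr addr0 scalerDr -scalerDl -rmorphD /=.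
  by rewrite (_ : 2^-1 + 2^-1 = 1 :> R) ?scale1r //; lra.
rewrite cnormZE cabs_real ger0_norm ?invr_ge0 //.
by have := cnormD U (star U); rewrite cnorm_starE U1; lra.
Qed.

(** A square root [b] of [1 - w^2] commutes with [w], so [norm_real_part] bounds it by 1. This
    replaces the positivity of [w^2]. *)
Lemma norm_sub_square w : star w = w -> nrm w <= 1 -> nrm (1 - w * w) <= 1.
Proof.
move=> sw w1.
have [|b [bb _ cb sb _]] := @cstar_sqrt R A (w * w).
  by rewrite (le_trans (cnormM _ _)) // mulr_ile1 ?cnorm_ge0.
have {}sb : star b = b by apply: sb; rewrite starM sw.
have bw : GRing.comm b w by apply/commr_sym/cb/commrM.
have b1 : nrm b <= 1.
  by apply: (norm_real_part sb sw bw); rewrite bb subrK.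
by rewrite -bb (le_trans (cnormM _ _)) // mulr_ile1 ?cnorm_ge0.
Qed.

(* A self-adjoint contraction [w] that is invertible satisfies [w^2 >= eta] for
   small [eta], which makes the Neumann series of [w^-2] converge. *)
Lemma norm_sub_square_lt w : star w = w -> nrm w <= 1 -> w \is a GRing.unit ->
  nrm (1 - w * w) < 1.
Proof.
move=> sw w1 uw; set v := w^-1.
have wv : w * v = 1 by rewrite mulrV.
have sv : star v = v.
  by rewrite -[LHS]mulr1 -wv mulrA -{1}sw -starM wv star1 mul1r.
(* Since [eta |v|^2 <= 1], the root [d] of [1 - eta v^2] exists, and [(w d)^2 = w^2 - eta]. With
   [b^2 = 1 - w^2] this gives [b^2 + (w d)^2 = 1 - eta], so [b] and [w d], divided by the root of
   [1 - eta], satisfy [norm_real_part]. The 2 makes [eta < 1]. *)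
pose eta : R := (2 + nrm v ^+ 2)^-1.
have eta_gt0 : 0 < eta by rewrite invr_gt0; have := sqr_ge0 (nrm v); lra.
have eta_lt1 : eta < 1.
  by rewrite invf_lt1; have := sqr_ge0 (nrm v); lra.
have vw : GRing.comm v w by apply/commr_sym/commrV.
have [|d [dd _ cd sd _]] := @cstar_sqrt R A (eta%:C *: (v * v)).
  rewrite cnormZE cabs_real gtr0_norm // mulrC /eta ler_pdivrMr; last first.
    by have := sqr_ge0 (nrm v); lra.
  by apply: le_trans (cnormM _ _) _; rewrite -expr2; lra.
have comm_d x : GRing.comm x v -> GRing.comm x d.
  move=> xv; apply: cd; rewrite /GRing.comm -scalerAr -scalerAl.
  by congr (_ *: _); exact: commrM.
have {}sd : star d = d by apply: sd; rewrite starZr starM sv.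
have wd : GRing.comm w d by apply/comm_d/commr_sym.
have [|b [bb _ cb sb _]] := @cstar_sqrt R A (w * w).
  by rewrite (le_trans (cnormM _ _)) // mulr_ile1 ?cnorm_ge0.
have {}sb : star b = b by apply: sb; rewrite starM sw.
have bw : GRing.comm b w by apply/commr_sym/cb/commrM.
have bd : GRing.comm b d by apply/comm_d/commrV.
have wdwd : (w * d) * (w * d) = w * w - (eta%:C)%:A.
  rewrite mulrA -(mulrA w d w) -wd mulrA -mulrA dd mulrBr mulr1 -scalerAr.
  by rewrite mulrA -(mulrA w w v) wv mulr1 wv.
pose c : R := (Num.sqrt (1 - eta))^-1.
have eta1 : 0 < 1 - eta by rewrite subr_gt0.
have c2 : c ^+ 2 = (1 - eta)^-1 by rewrite exprVn sqr_sqrtr // ltW.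
have c0 : 0 < c by rewrite invr_gt0 sqrtr_gt0.
have : nrm (c%:C *: b) <= 1.
  apply: (@norm_real_part _ (c%:C *: (w * d))).
  - by rewrite starZr sb.
  - by rewrite starZr starM sw sd wd.
  - rewrite /GRing.comm -!scalerAl -!scalerAr; congr (_ *: (_ *: _)).
    exact: commrM.
  - rewrite -!scalerAl -!scalerAr -!scalerDr wdwd bb addrA subrK.
    rewrite -[1 - _]/(1 - _) -{1}[1]scale1r -scalerBl !scalerA.
    rewrite -{1}(rmorph1 (real_complex R)) -rmorphB /= -!rmorphM /=.
    by rewrite -expr2 c2 mulVf ?lt0r_neq0 // rmorph1 scale1r.
rewrite cnormZE cabs_real gtr0_norm // -ler_pdivlMl // mulr1 => bc.
rewrite -bb; apply: le_lt_trans (cnormM _ _) _; rewrite -expr2.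
apply: le_lt_trans (_ : c^-1 ^+ 2 < 1).
  by rewrite ler_pXn2r ?nnegrE ?cnorm_ge0 // invr_ge0 ltW.
by rewrite exprVn c2 invrK ltrBlDr ltrDl.
Qed.

(** Spectral permanence: [x^-1 = h^-1 * star x] with [h = star x * x], and for a self-adjoint
    contraction [w] proportional to [h], the inverse is [w] times the Neumann series of [w^-2] in
    powers of [1 - w^2]. *)
Lemma norm_closure_inv (S : set A) x : subalgebra S ->
  (forall y, S y -> S (star y)) -> S x -> x \is a GRing.unit -> norm_closure S x^-1.
Proof.
move=> algS starS Sx ux; have algC := norm_closure_subalgebra algS.
have usx : star x \is a GRing.unit.
  by apply/unitrP; exists (star x^-1); rewrite -!starM mulrV // mulVr // star1.
set h := star x * x; have uh : h \is a GRing.unit by rewrite unitrMl.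
have Sh : S h by apply: (subalgM algS) => //; exact: starS.
have sh : star h = h by rewrite /h starM starK.
have -> : x^-1 = h^-1 * star x.
  by apply: (mulIr ux); rewrite mulVr // -mulrA mulVr.
apply: (subalgM algC); last by apply: sub_norm_closure; exact: starS.
pose k : R := (1 + nrm h)^-1; have h0 := cnorm_ge0 h.
have k0 : 0 < k by rewrite invr_gt0; lra.
have kC : k%:C != 0 by rewrite (inj_eq (@complexI R) k 0) gt_eqF.
have [uw wE] := unit_scale kC uh; set w := k%:C *: h in uw wE.
have Sw : S w by exact: (subalgZ algS).
have sw : star w = w by rewrite /w starZr sh.
have w1 : nrm w <= 1.
  by rewrite cnormZE cabs_real gtr0_norm // mulrC /k ler_pdivrMr; lra.
have [y [yE _ yc _]] := neumann (norm_sub_square_lt sw w1 uw).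
rewrite subKr in yE.
have -> : h^-1 = k%:C *: (w * y).
  rewrite -[LHS]scale1r -(mulfV kC) -scalerA -wE; congr (_ *: _).
  by apply: (mulrI uw); rewrite mulrV // mulrA.
apply: (subalgZ algC); apply: (subalgM algC); first exact: sub_norm_closure.
exists (fun n => \sum_(k < n) (1 - w * w) ^+ k) => // n.
apply: (subalg_sum algS) => j _; elim: (j : nat) => [|i IHi].
  by rewrite expr0; exact: (subalg1 algS).
rewrite exprS; apply: (subalgM algS) => //; apply: (subalgB algS); first exact: (subalg1 algS).
exact: (subalgM algS).
Qed.

End InverseInClosure.

(** * Orthogonality of free words *)

Section FreeOrthogonality.
Context {R : realType} {A : cstarAlgType R} (phi : {scalar A}) {I : eqType}.
Variable B : I -> set A.
Hypothesis state_phi : is_state phi.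
Hypothesis algB : forall i, subalgebra (B i).
Hypothesis B_star : forall i x, B i x -> B i (star x).
Hypothesis freeB : free_sets phi B.
Implicit Types (x y a b : A).

Local Notation head_span := (head_span phi B).
Let phi1 : phi 1 = 1 := state_phi.1.

(** The complement of [head_span i] among all words. Up to closure, L^2 of the free product is L^2
    of [B i] tensored with this space, as [sqn_co_mul] reflects. *)
Definition co_span i : set A :=
  lin_span [set w | w = 1 \/ exists2 j, i != j & free_word phi B j w].

Lemma co_span1 i : co_span i 1.
Proof. by apply: lin_span_gen; left. Qed.

Lemma co_span_head i j x : i != j -> head_span j x -> co_span i x.
Proof.
move=> ij; elim=> [|c w {}x jw _ IHx]; first exact: lin_span0.
by apply: lin_spanD => //; right; exists j.
Qed.

Lemma head_span_co i a x : B i a -> phi a = 0 -> co_span i x -> head_span i (a * x).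
Proof.
move=> ia a0; elim=> [|c w {}x iw _ IHx]; first by rewrite mulr0; exact: lin_span0.
rewrite mulrDr -scalerAr; apply: lin_spanD => //.
case: iw => [->|[j ij jw]]; first by rewrite mulr1; exact: free_word1.
exact: free_wordS jw.
Qed.

(** [star w] ends with a letter of [B i], which meets the first letter of [w'] in [B j]: the
    concatenation is still a reduced word. *)
Let star_free_word i j w w' : i != j -> free_word phi B i w -> free_word phi B j w' ->
  exists k, free_word phi B k (star w * w').
Proof.
move=> ij iw; elim: iw j w' ij => {i w} [i a ia a0|i k a w ik ia a0 _ IHw] j w' ij jw'.
  by exists i; apply: free_wordS jw' => //; [exact: B_star|rewrite phi_star // a0 rmorph0].
rewrite starM -mulrA; apply: (IHw i); first by rewrite eq_sym.
by apply: free_wordS jw' => //; [exact: B_star|rewrite phi_star // a0 rmorph0].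
Qed.

Lemma head_span_orth i j x y : i != j -> head_span i x -> head_span j y ->
  phi (star x * y) = 0.
Proof.
move=> ij ix jy; elim: ix => [|c w {}x iw _ IHx]; first by rewrite star0 mul0r linear0.
rewrite starD mulrDl linearD /= {}IHx addr0 starZ -scalerAl linearZ /=.
elim: jy => [|d v {}y jv _ IHy]; first by rewrite mulr0 linear0 mulr0.
rewrite mulrDr linearD /= mulrDr IHy addr0 -scalerAr linearZ /=.
by have [k /free_word0->] := star_free_word ij iw jv; rewrite ?mulr0.
Qed.

Lemma phi_head_co i x y : head_span i x -> co_span i y -> phi (star x * y) = 0.
Proof.
move=> ix; elim=> [|c w {}y iw _ IHy]; first by rewrite mulr0 linear0.
rewrite mulrDr linearD /= IHy addr0 -scalerAr linearZ /=; case: iw => [->|[j ij jw]].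
  by rewrite mulr1 phi_star // (head_span0 freeB ix) rmorph0 mulr0.
by rewrite (head_span_orth ij ix (lin_span_gen jw)) mulr0.
Qed.

Lemma phi_co_head i x y : co_span i x -> head_span i y -> phi (star x * y) = 0.
Proof.
by move=> ix iy; rewrite -(phi_conj state_phi) (phi_head_co iy ix) rmorph0.
Qed.

(** The centred part of [a] sends [y] into [head_span i], which is orthogonal to [x]; only the
    scalar part of [a] survives. *)
Lemma phi_co_sandwich i a x y : B i a -> co_span i x -> co_span i y ->
  phi (star x * a * y) = phi a * phi (star x * y).
Proof.
move=> ia ix iy; set a' := a - (phi a)%:A.
have ia' : B i a' by apply: (subalgB (algB i)) => //; exact: (subalg_alg (algB i)).
have a'0 : phi a' = 0 by rewrite linearB /= phi_alg // subrr.
have -> : star x * a * y = star x * (a' * y) + phi a *: (star x * y).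
  by rewrite -[a in LHS](subrK (phi a)%:A) -/a' mulrDr mulrDl -mulrA mulr_algr -scalerAl.
by rewrite linearD /= (phi_co_head ix (head_span_co ia' a'0 iy)) add0r linearZ.
Qed.

Lemma sqn_co_mul i a x : B i a -> co_span i x ->
  sqn phi (a * x) = sqn phi a * sqn phi x.
Proof.
move=> ia ix; apply: complexI; rewrite rmorphM /= !sqnE //.
rewrite starM !mulrA -(mulrA (star x)) (phi_co_sandwich _ ix ix) //.
by apply: (subalgM (algB i)) => //; exact: B_star.
Qed.

Lemma nn_co_mul i a x : B i a -> co_span i x -> nn phi (a * x) = nn phi a * nn phi x.
Proof. by move=> ia ix; rewrite /nn (sqn_co_mul ia ix) sqrtrM ?sqn_ge0. Qed.

Lemma sqn_orthD x y : phi (star x * y) = 0 -> sqn phi (x + y) = sqn phi x + sqn phi y.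
Proof. by move=> xy; rewrite sqnD // xy mulr0 addr0. Qed.

End FreeOrthogonality.

Section AlternatingOrthogonality.
Context {R : realType} {A : cstarAlgType R} (phi : {scalar A}) {N : nat}.
Variables (B : 'I_N -> set A) (S : 'I_N -> A).
Hypothesis state_phi : is_state phi.
Hypothesis algB : forall i, subalgebra (B i).
Hypothesis B_star : forall i x, B i x -> B i (star x).
Hypothesis freeB : free_sets phi B.
Hypothesis BS : forall i, B i (S i).
Hypothesis phiS : forall i, phi (S i) = 0.
Let phi1 : phi 1 = 1 := state_phi.1.
Let q i : R := sqn phi (S i).
Let head n i : head_span phi B i (alt_head S n i) := alt_head_span BS phiS n i.

Let co_head n i : co_span phi B i (\sum_(j | i != j) alt_head S n j).
Proof. by apply: lin_span_sum => j ij; apply: co_span_head ij (head n j). Qed.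

(** [phi_co_sandwich] replaces [star (S i) * S i] in the middle by [q i], so both words lose their
    first letter. With unequal lengths one of them runs out first, leaving the expectation of a
    centred sum. *)
Let phi_alt_head m n i :
  phi (star (alt_head S m i) * alt_head S n i) = ((m == n)%:R * alt_head q n i)%:C.
Proof.
elim: m n i => [|m IHm] [|n] i /=.
- by rewrite mul1r sqnE.
- rewrite mul0r mulrA -[star _ * _]mul1r -[1]star1.
  rewrite (phi_co_sandwich state_phi algB B_star freeB _ (co_span1 _ _ i) (co_head n i)).
    rewrite star1 mul1r linear_sum big1 ?mulr0 // => j _.
    exact: head_span0 freeB (head n j).
  by apply: (subalgM (algB i)) => //; exact: B_star.
- rewrite mul0r starM -mulrA -[X in phi X]mulr1.
  rewrite (phi_co_sandwich state_phi algB B_star freeB _ (co_head m i) (co_span1 _ _ i)).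
    rewrite mulr1 phi_star // linear_sum big1 ?rmorph0 ?mulr0 // => j _.
    exact: head_span0 freeB (head m j).
  by apply: (subalgM (algB i)) => //; exact: B_star.
have -> (x y : A) : star (S i * x) * (S i * y) = star x * (star (S i) * S i) * y.
  by rewrite starM !mulrA.
rewrite (phi_co_sandwich state_phi algB B_star freeB _ (co_head m i) (co_head n i)); last first.
  by apply: (subalgM (algB i)) => //; exact: B_star.
rewrite eqSS mulrCA rmorphM /= sqnE //; congr (_ * _).
rewrite star_sum mulr_suml linear_sum mulr_sumr rmorph_sum; apply: eq_bigr => j ij.
rewrite mulr_sumr linear_sum (bigD1 j) //= IHm big1 ?addr0 // => k /andP[_ kj].
by apply: (head_span_orth state_phi B_star freeB _ (head m j) (head n k)); rewrite eq_sym.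
Qed.

Lemma phi_alt_sum m n :
  phi (star (\sum_i alt_head S m i) * \sum_i alt_head S n i) =
  ((m == n)%:R * \sum_i alt_head q n i)%:C.
Proof.
rewrite star_sum mulr_suml linear_sum mulr_sumr rmorph_sum; apply: eq_bigr => j _.
rewrite mulr_sumr linear_sum (bigD1 j) //= phi_alt_head big1 ?addr0 // => k kj.
by apply: (head_span_orth state_phi B_star freeB _ (head m j) (head n k)); rewrite eq_sym.
Qed.

Let alt_psum_orth m n : (m <= n)%N ->
  phi (star (alt_psum S m) * \sum_i alt_head S n i) = 0.
Proof.
elim: m => [|m IHm] mn.
  rewrite alt_psum0 star1 mul1r linear_sum big1 // => i _.
  exact: head_span0 freeB (head n i).
rewrite alt_psumS starD mulrDl linearD /= IHm ?(ltnW mn) // add0r phi_alt_sum.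
by rewrite ltn_eqF // mul0r.
Qed.

Lemma sqn_alt_head n : sqn phi (\sum_i alt_head S n i) = \sum_i alt_head q n i.
Proof. by apply: complexI; rewrite sqnE // phi_alt_sum eqxx mul1r. Qed.

Lemma sqn_alt_psum n : sqn phi (alt_psum S n) = alt_psum q n.
Proof.
elim: n => [|n IHn].
  by rewrite !alt_psum0 /sqn star1 mulr1 phi1.
by rewrite !alt_psumS sqn_orthD ?alt_psum_orth // IHn sqn_alt_head.
Qed.

Lemma sqn_alt_psumB m n : (m <= n)%N ->
  sqn phi (alt_psum S n - alt_psum S m) = alt_psum q n - alt_psum q m.
Proof.
move=> /subnK <-; elim: (n - m)%N => [|d IHd].
  by rewrite !subrr /sqn star0 mul0r linear0.
rewrite addSn !alt_psumS addrAC sqn_orthD //; last first.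
  rewrite starB mulrBl linearB /= !alt_psum_orth ?subrr ?leq_addl //.
by rewrite IHd sqn_alt_head addrAC.
Qed.

Lemma sqn_alt_head_le n i :
  sqn phi (alt_head S n i) <= alt_psum q n.+1 - alt_psum q n.
Proof.
have -> : sqn phi (alt_head S n i) = alt_head q n i.
  by apply: complexI; rewrite sqnE // phi_alt_head eqxx mul1r.
rewrite alt_psumS addrAC subrr add0r (bigD1 i) //= lerDl.
by apply: sumr_ge0 => j _; apply: alt_head_ge0 => k; exact: sqn_ge0.
Qed.

End AlternatingOrthogonality.

(** * The L^2 completion *)

Section L2Completion.
Context {R : realType} {A : cstarAlgType R} (phi : {scalar A}).
Context (H : completeNormedModType R[i]) (iota : {linear A -> H}).
Hypothesis state_phi : is_state phi.
Hypothesis L2_iota : is_L2 phi iota.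
Implicit Types (u v : nat -> A) (a x : A) (h : H).

Let rnorm_iota x : rnorm (iota x) = nn phi x.
Proof. by apply: complexI; rewrite rnormE L2_iota.1 norm2E. Qed.

Lemma cvg_iota u h :
  (fun n => iota (u n)) @ \oo --> h <-> (fun n => rnorm (iota (u n) - h)) @ \oo --> (0 : R).
Proof. exact: cvg_rnormP. Qed.

Let cvg_iota0 u : (fun n => nn phi (u n)) @ \oo --> (0 : R) ->
  (fun n => iota (u n)) @ \oo --> (0 : H).
Proof.
move=> u0; apply/cvg_iota; under eq_fun do rewrite subr0 rnorm_iota.
exact: u0.
Qed.

Lemma nn_cauchy_cvg u :
  (forall e, 0 < e -> exists n0, forall m n, (n0 <= m)%N -> (n0 <= n)%N ->
     nn phi (u m - u n) < e) ->
  exists h, (fun n => iota (u n)) @ \oo --> h.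
Proof.
move=> uc; suff /cvg_ex : cvg ((fun n => iota (u n)) @ \oo) by [].
apply/cauchy_cvgP/cauchy_exP => e e0.
have e0' : 0 < complex.Re e by rewrite -ltcR ge0_complex // ltW.
have [n0 un] := uc _ e0'; exists (iota (u n0)); exists n0 => // n /= n0n.
rewrite -ball_normE /= -linearB -rnormE rnorm_iota.
by rewrite -(ge0_complex (ltW e0)) ltcR un.
Qed.

Lemma iota_dense h : exists u, (fun n => iota (u n)) @ \oo --> h.
Proof.
have key n : exists x, rnorm (iota x - h) < n.+1%:R^-1.
  have n0 : (0 : R[i]) < (n.+1%:R^-1 : R)%:C by rewrite ltcR.
  have [] := L2_iota.2 (ball h (n.+1%:R^-1 : R)%:C).
  - by exists h; exact: ballxx.
  - exact: ball_open.
  move=> y [hy [x _ xy]]; exists x; rewrite -xy in hy; move: hy.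
  by rewrite -ball_normE /= -normrN opprB -rnormE ltcR.
have [u uP] := choice key; exists u; apply/cvg_iota.
apply: (cvgn0_le (v := fun n => n.+1%:R^-1)) => [n|]; last exact: cvg_harmonic.
by rewrite rnorm_ge0 ltW.
Qed.

Let iota_cauchy u h : (fun n => iota (u n)) @ \oo --> h ->
  forall e, 0 < e -> exists n0, forall m n, (n0 <= m)%N -> (n0 <= n)%N ->
     nn phi (u m - u n) < e.
Proof.
move=> /cvg_iota/cvgn0P uh e e0; have [|n0 un] := uh (e / 2); first by rewrite divr_gt0.
exists n0 => m n /un um {}/un un; rewrite -rnorm_iota linearB /=.
rewrite -[_ - _](subrKA h) (le_lt_trans (rnormD _ _)) //.
rewrite -(rnormN (h - _)) opprB; move: um un; rewrite !ger0_norm ?rnorm_ge0 //; lra.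
Qed.

Let iota_diff u v h : (fun n => iota (u n)) @ \oo --> h ->
  (fun n => iota (v n)) @ \oo --> h -> (fun n => nn phi (u n - v n)) @ \oo --> (0 : R).
Proof.
move=> /cvg_iota uh /cvg_iota vh.
apply: (cvgn0_le (v := fun n => rnorm (iota (u n) - h) + rnorm (iota (v n) - h))) => [n|].
  rewrite nn_ge0 -rnorm_iota linearB /= -[iota _ - iota _](subrKA h).
  by rewrite (le_trans (rnormD _ _)) // lerD2l -[leLHS]rnormN opprB.
by rewrite -(addr0 0); exact: cvgD.
Qed.

(* [L h] is the common limit of [iota (a u_n)] over all [u] with [iota u_n --> h]. *)
Lemma left_mul_extension a : exists2 L : {linear H -> H}, continuous L /\
  (forall x, L (iota x) = iota (a * x)) &
  forall u h, (fun n => iota (u n)) @ \oo --> h -> (fun n => iota (a * u n)) @ \oo --> L h.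
Proof.
have [u uP] := choice iota_dense.
have a0 := cnorm_ge0 a.
have auP h : exists k : H, (fun n => iota (a * u h n)) @ \oo --> k.
  apply: (nn_cauchy_cvg (u := fun n => a * u h n)) => e e0.
  have [|n0 un] := iota_cauchy (uP h) (e := e / (1 + cnorm a)).
    by rewrite divr_gt0 // ltr_wpDr.
  exists n0 => m n n0m n0n; rewrite -mulrBr (le_lt_trans (nn_mul state_phi _ _)) //.
  have := un m n n0m n0n; rewrite ltr_pdivlMr ?ltr_wpDr // => {}un.
  by have := nn_ge0 phi (u h m - u h n); move: (nn _ _) un => t; lra.
have [L LP] := choice auP.
have Lv v h : (fun n => iota (v n)) @ \oo --> h -> (fun n => iota (a * v n)) @ \oo --> L h.
  move=> vh; have -> : (fun n => iota (a * v n)) =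
      (fun n => iota (a * (v n - u h n)) + iota (a * u h n)).
    by apply/funext => n; rewrite -linearD -mulrDr subrK.
  rewrite -[X in _ --> X]add0r; apply: cvgD; last exact: LP.
  apply: cvg_iota0; apply: (cvgn0_le (v := fun n => cnorm a * nn phi (v n - u h n))).
    by move=> n; rewrite nn_ge0 nn_mul.
  by apply: cvgn0_mull; apply: iota_diff (uP h).
have Llin : linear L.
  move=> c h k; apply: (@cvg_unique _ (@norm_hausdorff _ H)
    ((fun n => iota (a * (c *: u h n + u k n))) @ \oo)).
    apply: Lv; under eq_fun do rewrite linearP.
    by apply: cvgD => //; apply: cvgZ => //; exact: cvg_cst.
  have -> : (fun n => iota (a * (c *: u h n + u k n))) =
      (fun n => c *: iota (a * u h n) + iota (a * u k n)).
    by apply/funext => n; rewrite mulrDr -scalerAr linearP.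
  by apply: cvgD => //; apply: cvgZ => //; exact: cvg_cst.
pose Lm := GRing.isLinear.Build _ _ _ _ L Llin.
pose LL : {linear H -> H} := HB.pack L Lm.
exists LL => //; split; last first.
  move=> x; apply: (@cvg_unique _ (@norm_hausdorff _ H) ((fun n : nat => iota (a * x)) @ \oo)).
    by apply: Lv; exact: cvg_cst.
  exact: cvg_cst.
apply/linear_bounded_continuous/linear_boundedP.
exists (cnorm a)%:C; split; first by rewrite complex_real.
move=> r ar h; apply: le_trans (_ : (cnorm a)%:C * `|h| <= _); last first.
  by rewrite ler_wpM2r // ltW.
rewrite -!rnormE -rmorphM /= lecR.
have c1 := cvg_rnorm (Lv _ _ (uP h)).
have c2 : (fun n => cnorm a * rnorm (iota (u h n))) @ \oo --> cnorm a * rnorm h.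
  by apply: cvgM; [exact: cvg_cst|exact: cvg_rnorm].
apply: (ler_cvg_to c1 c2); apply: nearW => n.
by rewrite !rnorm_iota nn_mul.
Qed.

End L2Completion.

(** * A lower bound for the resolvent *)

Section WeightedEstimates.
Context {R : realType} {N : nat} (q r : 'I_N -> R).
Hypothesis qr : forall i, q i = r i ^+ 2.
Let s := \sum_i q i / (1 + q i).
Hypothesis s1 : s < 1.

Let q0 i : 0 <= q i. Proof. by rewrite qr sqr_ge0. Qed.
Let q1 i : 0 < 1 + q i. Proof. by rewrite ltr_pwDl. Qed.
Let s0 : 0 <= s. Proof. by apply: sumr_ge0 => i _; rewrite divr_ge0 // ltW. Qed.

(* With the weights [1 + q_i] the off-diagonal part [f_i |-> sqrt q_i sum_(j != i) f_j]
   has norm at most [(1 + s) / 2]. *)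
Lemma weighted_annihilation_bound (e k : 'I_N -> R) (V : R) :
  (forall i, k i ^+ 2 = \sum_j ((1 + q j) * e j) ^+ 2 - ((1 + q i) * e i) ^+ 2) ->
  \sum_i (1 + q i) * e i ^+ 2 <=
    \sum_i (1 + q i) * e i * V + \sum_i r i * k i * e i ->
  \sum_i (1 + q i) * e i ^+ 2 <= 4 * (\sum_i (1 + q i)) / (1 - s) ^+ 2 * V ^+ 2.
Proof.
move=> kE; set E := \sum_i _; set Q := \sum_j _ in kE.
have s1' : 0 < 1 - s by rewrite subr_gt0.
have H1 : \sum_i r i * k i * e i <= (1 + s) / 2 * E.
  (* Young's inequality for [r i * k i] and [(1 + q i) * e i], with [k i ^+ 2] written as [Q] minus
     its own term. *)
  have rk i : r i * k i * e i <= ((1 + q i) * e i ^+ 2 + q i / (1 + q i) * Q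
      - q i * (1 + q i) * e i ^+ 2) / 2.
    have -> : ((1 + q i) * e i ^+ 2 + q i / (1 + q i) * Q
      - q i * (1 + q i) * e i ^+ 2) / 2 = r i * k i * e i +
        ((1 + q i) * e i - r i * k i) ^+ 2 / (2 * (1 + q i)).
      have -> : Q = k i ^+ 2 + ((1 + q i) * e i) ^+ 2 by rewrite kE subrK.
      by have := lt0r_neq0 (q1 i); rewrite qr => ?; field.
    by rewrite lerDl divr_ge0 ?sqr_ge0 // mulr_ge0 // ltW.
  apply: le_trans (ler_sum _ (fun i _ => rk i)) _.
  rewrite -mulr_suml mulrAC ler_wpM2r ?invr_ge0 // sumrB big_split /= -/E -mulr_suml -/s.
  rewrite mulrDl mul1r -addrA lerD2l lerBlDr !mulr_sumr -big_split ler_sum // => i _.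
  have -> : s * ((1 + q i) * e i) ^+ 2 = s * ((1 + q i) * e i ^+ 2) +
      q i * (1 + q i) * e i ^+ 2 - (1 + q i) * e i ^+ 2 * ((1 - s) * q i) by ring.
  rewrite /= lerBlDr lerDl; apply: mulr_ge0; apply: mulr_ge0;
    by rewrite ?sqr_ge0 ?q0 ?(ltW (q1 i)) ?(ltW s1').
(* Young's inequality again; the share [(1 - s) / 4] of [E] is half of the gap [(1 - s) / 2] left by
   [H1]. *)
have H2 : \sum_i (1 + q i) * e i * V <=
    (1 - s) / 4 * E + (\sum_i (1 + q i)) / (1 - s) * V ^+ 2.
  rewrite mulr_sumr !mulr_suml -big_split ler_sum // => i _ /=.
  have -> : (1 - s) / 4 * ((1 + q i) * e i ^+ 2) + (1 + q i) / (1 - s) * V ^+ 2 =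
      (1 + q i) * e i * V + (1 + q i) * ((1 - s) * e i / 2 - V) ^+ 2 / (1 - s).
    by have := lt0r_neq0 s1' => ?; field.
  by rewrite lerDl divr_ge0 ?(ltW s1') // mulr_ge0 ?sqr_ge0 ?(ltW (q1 i)).
move=> EV; have {H1 H2}EV : E <= (1 - s) / 4 * E + (\sum_i (1 + q i)) / (1 - s) * V ^+ 2 +
  (1 + s) / 2 * E by exact: le_trans EV (lerD H2 H1).
have -> : 4 * (\sum_i (1 + q i)) / (1 - s) ^+ 2 * V ^+ 2 =
    4 / (1 - s) * ((\sum_i (1 + q i)) / (1 - s) * V ^+ 2).
  by have := lt0r_neq0 s1' => ?; field.
move: EV; set Z := (\sum_i (1 + q i)) / (1 - s) * V ^+ 2 => EV.
rewrite -(ler_pM2l s1') (_ : _ * (4 / _ * Z) = 4 * Z).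
  by move: EV; move: (E) (Z) (s) => x y w; lra.
by have := lt0r_neq0 s1' => ?; field.
Qed.

(** As [m i ^+ 2 = E - b i ^+ 2], moving [q i * b i ^+ 2] to the left leaves [E] with the factor
    [q i / (1 + q i)], whose sum is [s]. The choice [eps = (1 - s) / 2] keeps [1 - (1 + eps) * s] at
    least [(1 - s) / 2]. *)
Lemma creation_bound (b m : 'I_N -> R) (V : R) :
  (forall i, 0 <= b i) -> (forall i, m i ^+ 2 = \sum_j b j ^+ 2 - b i ^+ 2) ->
  (forall i, b i <= V + r i * m i) ->
  \sum_i b i ^+ 2 <= 2 / (1 - s) * (N%:R * (1 + 2 / (1 - s))) * V ^+ 2.
Proof.
move=> b0 mE bV; set E := \sum_j _ in mE *.
have s1' : 0 < 1 - s by rewrite subr_gt0.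
have E0 : 0 <= E by apply: sumr_ge0 => i _; exact: sqr_ge0.
set eps := (1 - s) / 2; have eps0 : 0 < eps by rewrite divr_gt0.
have bE i : b i ^+ 2 <= (1 + eps^-1) * V ^+ 2 + (1 + eps) * E * (q i / (1 + q i)).
  have h1 : b i ^+ 2 <= (1 + eps^-1) * V ^+ 2 + (1 + eps) * (q i * m i ^+ 2).
    apply: le_trans (_ : (V + r i * m i) ^+ 2 <= _).
      by rewrite ler_pXn2r ?nnegrE // (le_trans (b0 i)).
    rewrite qr -exprMn -subr_ge0.
    have -> : (1 + eps^-1) * V ^+ 2 + (1 + eps) * (r i * m i) ^+ 2 - (V + r i * m i) ^+ 2
      = (V - eps * (r i * m i)) ^+ 2 / eps by have := lt0r_neq0 eps0 => ?; field.
    by rewrite divr_ge0 ?sqr_ge0 // ltW.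
  have V0 : 0 <= (1 + eps^-1) * V ^+ 2.
    by rewrite mulr_ge0 ?sqr_ge0 // addr_ge0 // invr_ge0 ltW.
  have key : (1 + q i) * b i ^+ 2 <= (1 + eps^-1) * V ^+ 2 + (1 + eps) * E * q i.
    have : (1 + eps) * (q i * m i ^+ 2) <= (1 + eps) * E * q i - q i * b i ^+ 2.
      rewrite mE; have : 0 <= eps * (q i * b i ^+ 2).
        by rewrite mulr_ge0 ?(ltW eps0) // mulr_ge0 ?sqr_ge0.
      by move: (b i ^+ 2) (E) (q i) => x y w; nra.
    by move: h1; rewrite mulrDl mul1r; move: (b i ^+ 2) => x; lra.
  rewrite -(ler_pM2l (q1 i)) (le_trans key) //.
  have -> : (1 + q i) * ((1 + eps^-1) * V ^+ 2 + (1 + eps) * E * (q i / (1 + q i))) =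
    (1 + eps^-1) * V ^+ 2 + (1 + eps) * E * q i + q i * ((1 + eps^-1) * V ^+ 2).
    by have := lt0r_neq0 (q1 i) => ?; field; rewrite ?lt0r_neq0.
  by rewrite lerDl mulr_ge0.
have EE : E <= N%:R * ((1 + eps^-1) * V ^+ 2) + (1 + eps) * E * s.
  apply: le_trans (ler_sum _ (fun i _ => bE i)) _.
  by rewrite big_split /= sumr_const card_ord mulr_natl -[X in _ + X <= _]mulr_sumr.
have epsE : eps^-1 = 2 / (1 - s) by rewrite /eps invf_div.
have : (1 - s) / 2 * E <= N%:R * ((1 + eps^-1) * V ^+ 2).
  move: EE; set Z := N%:R * _; have : 0 <= (1 - s) * ((1 - s) * E).
    by rewrite !mulr_ge0 ?(ltW s1').
  by rewrite /eps; move: (E) (Z) (s) => x y w; nra.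
have -> : 2 / (1 - s) * (N%:R * (1 + 2 / (1 - s))) * V ^+ 2 =
    (N%:R * ((1 + eps^-1) * V ^+ 2)) / ((1 - s) / 2).
  by rewrite epsE; have := lt0r_neq0 s1' => ?; field.
by rewrite ler_pdivlMr // mulrC.
Qed.

End WeightedEstimates.

Section Coercivity.
Context {R : realType} {A : cstarAlgType R} (phi : {scalar A}).
Hypothesis state_phi : is_state phi.
Hypothesis faithful_phi : faithful phi.
Implicit Types (x y h : A).
Local Notation nrm := (@cnorm R A).

Lemma faithful_nn x : nn phi x = 0 -> x = 0.
Proof.
by move=> x0; apply: faithful_phi; rewrite -sqnE // -sqr_nn // x0 expr0n.
Qed.

(* With [t = |x| = r^2] and [m = t - x], one has [m t m = - m x m], so that both
   [phi (m t m)] and [phi (m x m)] vanish; hence [r m = 0] and [m = 0]. *)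
Lemma positive_of_form (P : set A) x : closed_subalgebra P -> P x -> star x = x ->
  nrm x <= 1 -> (forall y, P y -> 0 <= complex.Re (phi (star y * x * y))) ->
  exists r, [/\ star r = r, r * r = x & nrm (1 - x) <= 1].
Proof.
move=> clP Px sx x1 form; have algP := clP.1.
have [|t [tt t1 ct st Pt]] := @cstar_sqrt R A (1 - x * x).
  exact: norm_sub_square.
rewrite subKr in tt.
have sxx : star (1 - x * x) = 1 - x * x by rewrite starB star1 starM sx.
have {}st := st sxx.
have {}Pt : P t.
  apply: Pt => //; apply: (subalgB algP); first exact: (subalg1 algP).
  exact: (subalgM algP).
have xt : GRing.comm x t.
  by apply: ct; apply: commrB; [exact: commr1|exact: commrM].
have [r [rr _ cr sr Pr]] := cstar_sqrt t1; rewrite subKr in rr.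
have {}sr : star r = r by apply: sr; rewrite starB star1 st.
set m := t - x; have sm : star m = m by rewrite starB st sx.
have Pm : P m by exact: (subalgB algP).
have tm : t * m = - (x * m) by rewrite /m !mulrBr tt xt opprB.
have mtm : phi (star (r * m) * (r * m)) = - phi (star m * x * m).
  transitivity (phi (star m * (t * m))); first by rewrite starM sr -rr !mulrA.
  by rewrite tm mulrN linearN /= mulrA.
have rm0 : r * m = 0.
  apply: faithful_nn; apply/eqP; rewrite sqrtr_eq0 /sqn mtm raddfN.
  by rewrite oppr_le0 form.
have tm0 : t * m = 0 by rewrite -rr -mulrA rm0 mulr0.
have xm0 : x * m = 0 by apply/eqP; rewrite -oppr_eq0 -tm tm0.
have m0 : m = 0.
  apply: cnorm_eq0; apply/eqP; rewrite -sqrf_eq0 -cnorm_star sm {1}/m mulrBl.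
  by rewrite tm0 xm0 subrr cnorm0.
have xE : x = t by apply/eqP; rewrite eq_sym -subr_eq0 -/m m0.
by exists r; split=> //; rewrite xE.
Qed.

(** The form of [x = h - d] is nonnegative, so [|1 - x / k| <= 1] for [k = 1 + |x|]. Hence
    [h / (d + k)] is within [k / (d + k) < 1] of the identity. *)
Lemma unit_of_coercive (P : set A) h (d : R) : closed_subalgebra P -> P h ->
  star h = h -> 0 < d ->
  (forall y, P y -> d * sqn phi y <= complex.Re (phi (star y * h * y))) ->
  h \is a GRing.unit.
Proof.
move=> clP Ph sh d0 coer; have algP := clP.1.
set x := h - (d%:C)%:A; have sx : star x = x by rewrite starB sh star_alg conj_real.
have Px : P x by apply: (subalgB algP) => //; exact: (subalg_alg algP).
set k : R := 1 + nrm x; have x0 := cnorm_ge0 x.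
have k0 : 0 < k by rewrite /k; lra.
have ki0 : 0 < k^-1 by rewrite invr_gt0.
have [||||r [sr rr r1]] := @positive_of_form P (k^-1%:C *: x) clP.
- exact: (subalgZ algP).
- by rewrite starZr sx.
- by rewrite cnormZE cabs_real gtr0_norm // mulrC ler_pdivrMr // /k; lra.
- move=> y Py; rewrite -scalerAr -scalerAl linearZ /=.
  have -> : phi (star y * x * y) = phi (star y * h * y) - d%:C * phi (star y * y).
    by rewrite /x mulrBr mulrBl linearB /= mulr_algr -scalerAl linearZ.
  have ReM (w : R) (v : R[i]) : complex.Re (w%:C * v) = w * complex.Re v.
    by case: v => ? ? /=; rewrite mul0r subr0.
  have ReB (v w : R[i]) : complex.Re (v - w) = complex.Re v - complex.Re w.
    by case: v w => [? ?] [? ?].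
  rewrite ReM mulr_ge0 ?(ltW ki0) // -sqnE // ReB ReM subr_ge0.
  exact: coer.
have hE : h = (d%:C)%:A + k%:C *: (k^-1%:C *: x).
  by rewrite scalerA -rmorphM /= mulfV ?lt0r_neq0 // scale1r /x addrC subrK.
set c : R := d + k; have c0 : 0 < c by rewrite /c; lra.
have cC (w : R) : 0 < w -> w%:C != 0 by move=> w0; rewrite -cabs_gt0 cabs_real gtr0_norm.
have -> : h = c%:C *: (c^-1%:C *: h).
  by rewrite scalerA -rmorphM /= mulfV ?lt0r_neq0 // scale1r.
apply: (unit_scale (cC _ c0) _).1; apply: unit_near1.
have -> : 1 - c^-1%:C *: h = (c^-1 * k)%:C *: (1 - k^-1%:C *: x).
  have c1 : (1 : A) = (c^-1%:C * c%:C) *: 1.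
    by rewrite -rmorphM /= mulVf ?lt0r_neq0 // rmorph1 scale1r.
  rewrite {1}c1 {1}hE rmorphM /= -!scalerA -scalerBr; congr (_ *: _).
  rewrite /c rmorphD /= scalerDl opprD addrACA subrr add0r.
  by rewrite [RHS]scalerBr.
rewrite cnormZE cabs_real gtr0_norm ?mulr_gt0 ?invr_gt0 //.
apply: le_lt_trans (_ : c^-1 * k < 1).
  by rewrite ler_piMr // ltW // mulr_gt0 ?invr_gt0.
by rewrite mulrC ltr_pdivrMr // /c; lra.
Qed.

End Coercivity.

Section FullSpan.
Context {R : realType} {A : cstarAlgType R} (phi : {scalar A}) {I : eqType}.
Variable B : I -> set A.
Hypothesis state_phi : is_state phi.
Hypothesis algB : forall i, subalgebra (B i).
Implicit Types (x y a b : A).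
Local Notation head_span := (head_span phi B).
Local Notation co_span := (co_span phi B).

Definition full_span : set A :=
  lin_span [set w | w = 1 \/ exists j, free_word phi B j w].

Lemma full_span_head i y : head_span i y -> full_span y.
Proof.
elim=> [|c w x iw _ IHx]; first exact: lin_span0.
by apply: lin_spanD => //; right; exists i.
Qed.

Lemma full_span_split i y : full_span y ->
  exists x x', [/\ head_span i x, co_span i x' & y = x + x'].
Proof.
elim=> [|c w x Ww _ [u [u' [iu iu' ->]]]].
  by exists 0, 0; split; [exact: lin_span0|exact: lin_span0|rewrite addr0].
case: Ww => [->|[j jw]].
  exists u, (c *: 1 + u'); split=> //; last by rewrite addrCA.
  by apply: lin_spanD => //; left.
have [ji|ij] := eqVneq j i.
  exists (c *: w + u), u'; split=> //; last by rewrite addrA.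
  by apply: lin_spanD => //; rewrite -ji.
exists u, (c *: w + u'); split=> //; last by rewrite addrCA.
by apply: lin_spanD => //; right; exists j => //; rewrite eq_sym.
Qed.

(** A letter of [B i] is put in front of a word starting elsewhere, or merged with the first letter
    of a word starting in [B i]; after recentring, its scalar part leaves the rest of the word. *)
Lemma full_span_mul i b y : B i b -> full_span y -> full_span (b * y).
Proof.
move=> ib.
have center a : B i a -> exists a', [/\ B i a', phi a' = 0 & a = a' + (phi a)%:A].
  move=> ia; exists (a - (phi a)%:A); split; last by rewrite subrK.
    by apply: (subalgB (algB i)) => //; exact: (subalg_alg (algB i)).
  by rewrite linearB /= phi_alg // subrr.
have full1 : full_span 1 by apply: lin_span_gen; left.
have full_w j w : free_word phi B j w -> full_span w.
  by move=> jw; apply: lin_span_gen; right; exists j.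
have full_B a : B i a -> full_span a.
  move=> /center[a' [ia' a'0 ->]].
  by apply: lin_span_add; [apply: (full_w i); exact: free_word1|exact: lin_span_scale].
have full_Bw a j w : B i a -> i != j -> free_word phi B j w -> full_span (a * w).
  move=> /center[a' [ia' a'0 ->]] ij jw; rewrite mulrDl mulr_algl.
  apply: lin_span_add; last by apply/lin_span_scale/(full_w j).
  by apply: (full_w i); exact: free_wordS jw.
elim=> [|c w x Ww _ IHx]; first by rewrite mulr0; exact: lin_span0.
rewrite mulrDr -scalerAr; apply: lin_span_add => //; apply: lin_span_scale.
case: Ww => [->|[j jw]]; first by rewrite mulr1; exact: full_B.
have [ij|ij] := eqVneq i j; last exact: full_Bw jw.
case: jw ij => {j w} [j a ja a0|j k a w jk ja a0 kw] ij; rewrite -ij in ja.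
  by apply: full_B; exact: (subalgM (algB i)).
rewrite mulrA; apply: full_Bw kw; last by rewrite ij.
exact: (subalgM (algB i)).
Qed.

End FullSpan.

Section LowerBound.
Context {R : realType} {A : cstarAlgType R} (phi : {scalar A}) {N : nat}.
Variables (B : 'I_N -> set A) (S X : 'I_N -> A).
Hypothesis state_phi : is_state phi.
Hypothesis algB : forall i, subalgebra (B i).
Hypothesis B_star : forall i x, B i x -> B i (star x).
Hypothesis freeB : free_sets phi B.
Hypothesis BS : forall i, B i (S i).
Hypothesis BX : forall i, B i (X i).
Hypothesis phiS : forall i, phi (S i) = 0.
Hypothesis SX : forall i, (1 + S i) * X i = 1.
Hypothesis tracial_phi : tracial phi.
Implicit Types (x y : A).

Local Notation nn := (nn phi).
Local Notation sqn := (sqn phi).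
Local Notation head_span := (head_span phi B).
Local Notation co_span := (co_span phi B).
Let r i := nn (S i).
Let q i := sqn (S i).
Let s : R := \sum_i q i / (1 + q i).
Hypothesis s1 : s < 1.
Let phi1 : phi 1 = 1 := state_phi.1.

Let Re_phi_cauchy x y : complex.Re (phi (star x * y)) <= nn x * nn y.
Proof.
exact: le_trans (ler_norm _) (le_trans (Re_le_cabs _) (phi_cauchy state_phi x y)).
Qed.

Let head_orth i j x y : i != j -> head_span i x -> head_span j y ->
  phi (star x * y) = 0.
Proof. exact: (head_span_orth state_phi B_star freeB). Qed.

Let sqn_head_sum (P : pred 'I_N) (f : 'I_N -> A) : (forall i, head_span i (f i)) ->
  sqn (\sum_(i | P i) f i) = \sum_(i | P i) sqn (f i).
Proof.
move=> fi; apply: complexI; rewrite sqnE // star_sum mulr_suml linear_sum rmorph_sum.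
apply: eq_bigr => i Pi; rewrite mulr_sumr linear_sum (bigD1 i) //= sqnE //.
by rewrite big1 ?addr0 // => j /andP[_ ji]; apply: head_orth (fi i) (fi j); rewrite eq_sym.
Qed.

Let sqn_neq (f : 'I_N -> A) i : (forall j, head_span j (f j)) ->
  nn (\sum_(j | i != j) f j) ^+ 2 = \sum_j nn (f j) ^+ 2 - nn (f i) ^+ 2.
Proof.
move=> fj; rewrite sqr_nn // sqn_head_sum // (sum_neq (fun j => sqn (f j))) sqr_nn //.
by congr (_ - _); apply: eq_bigr => j _; rewrite sqr_nn.
Qed.

(** Traciality enters here: the removal of a letter by [S i] is governed by the L^2 norm of its
    adjoint, while the hypothesis [s < 1] concerns [S i] itself. *)
Let nn_starS i : nn (star (S i)) = r i.
Proof. by rewrite /r /nn /sqn starK tracial_phi. Qed.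

Let tau i : R := 1 + q i.
(** [c1] and [c4] are the square roots of the constants of [weighted_annihilation_bound] and
    [creation_bound]; [c3] bounds the inhomogeneous term of the second system, once the first is
    solved. *)
Let c1 : R := Num.sqrt (4 * (\sum_i tau i) / (1 - s) ^+ 2).
Let M : R := \sum_i cnorm (S i).
Let c3 : R := M * c1 + (\sum_i r i) * (1 + M * c1 + c1).
Let c4 : R := Num.sqrt (2 / (1 - s) * (N%:R * (1 + 2 / (1 - s)))).

Let q0 i : 0 <= q i. Proof. exact: sqn_ge0. Qed.
Let qr i : q i = r i ^+ 2. Proof. by rewrite sqr_nn. Qed.
Let tau1 i : 1 <= tau i. Proof. by rewrite lerDl. Qed.

Let le_sum (f : 'I_N -> R) i : (forall j, 0 <= f j) -> f i <= \sum_j f j.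
Proof. by move=> f0; rewrite (bigD1 i) //= lerDl sumr_ge0. Qed.

(* Solve [y = v - sum_i u_i] with [u_i = (X_i - 1) y = - S_i X_i y]: the component
   of [u_i] off [B_i] is controlled by that of [X_i y] on [B_i], which satisfies a
   contractive system; the components on [B_i] then satisfy the adjoint system. *)
Lemma resolvent_lower_bound : exists2 c : R, 0 < c &
  forall y, full_span phi B y -> nn y <= c * nn ((1 + \sum_i (X i - 1)) * y).
Proof.
have M0 : 0 <= M by apply: sumr_ge0 => i _; exact: cnorm_ge0.
have c10 : 0 <= c1 by exact: sqrtr_ge0.
have c40 : 0 <= c4 by exact: sqrtr_ge0.
have r0 i : 0 <= r i by exact: nn_ge0.
have c30 : 0 <= c3.
  have Mc : 0 <= M * c1 by exact: mulr_ge0.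
  apply: addr_ge0 => //; apply: mulr_ge0; first exact: sumr_ge0.
  by apply: addr_ge0 => //; exact: addr_ge0.
exists (1 + M * c1 + N%:R * (c4 * c3)).
  have Mc : 0 <= M * c1 by exact: mulr_ge0.
  by rewrite -addrA ltr_pwDl // addr_ge0 // mulr_ge0 // mulr_ge0.
move=> y fy; set v := _ * y; set V := nn v; have V0 : 0 <= V by exact: nn_ge0.
have /choice[eta etaP] : forall i, exists p : A * A,
    [/\ head_span i p.1, co_span i p.2 & X i * y = p.1 + p.2].
  move=> i; have := full_span_split i (full_span_mul state_phi algB (BX i) fy).
  by move=> [x [x' [? ? ?]]]; exists (x, x').
have /choice[kap kapP] : forall i, exists p : A * A,
    [/\ head_span i p.1, co_span i p.2 & S i * (eta i).1 = p.1 + p.2].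
  move=> i; have [eta_i _ _] := etaP i.
  have := full_span_split i (full_span_mul state_phi algB (BS i) (full_span_head eta_i)).
  by move=> [x [x' [? ? ?]]]; exists (x, x').
(* In [u i = beta i - (kap i).2] the first term lies in [head_span i]. The second comes from
   [(eta i).1] alone, because [S i] puts a letter in front of [(eta i).2]. *)
pose u i := X i * y - y.
pose beta i := - ((kap i).1 + S i * (eta i).2).
have uE i : u i = beta i - (kap i).2.
  have SXE : S i * X i = 1 - X i by rewrite -(SX i) mulrDl mul1r addrAC subrr add0r.
  have -> : u i = - (S i * (X i * y)) by rewrite mulrA SXE mulrBl mul1r opprB.
  have [_ _ ->] := etaP i; have [_ _ kE] := kapP i.
  by rewrite mulrDr kE /beta addrAC opprD.
have vE : v = y + \sum_i u i.
  by rewrite /v mulrDl mul1r mulr_suml; congr (_ + _); apply: eq_bigr => i _; rewrite mulrBl mul1r.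
have wE i : X i * y = v - \sum_(j | i != j) u j.
  by rewrite sum_neq vE opprB addrA addrAC addrK /u addrC subrK.
have head_eta i : head_span i (eta i).1 by have [] := etaP i.
have co_eta i : co_span i (eta i).2 by have [] := etaP i.
have head_kap i : head_span i (kap i).1 by have [] := kapP i.
have co_kap i : co_span i (kap i).2 by have [] := kapP i.
have head_beta i : head_span i (beta i).
  apply: lin_span_opp; apply: lin_span_add; first exact: head_kap.
  exact: head_span_co (BS i) (phiS i) (co_eta i).
pose e i := nn (eta i).1; have e0 i : 0 <= e i by exact: nn_ge0.
pose h i := \sum_(j | i != j) (tau j)%:C *: (eta j).1.
(* Tested against [(eta i).1], the [beta j] with [j != i] vanish by orthogonality: the first system
   involves no [beta], which is why the two systems are triangular. *)
have etaE i : sqn (eta i).1 = complex.Re (phi (star (eta i).1 * v)) +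
    \sum_(j | i != j) complex.Re (phi (star (eta i).1 * (kap j).2)).
  have E : (sqn (eta i).1)%:C = phi (star (eta i).1 * v) +
      \sum_(j | i != j) phi (star (eta i).1 * (kap j).2).
    have -> : (sqn (eta i).1)%:C = phi (star (eta i).1 * (X i * y)).
      have [_ _ ->] := etaP i; rewrite mulrDr linearD /= sqnE //.
      by rewrite (phi_head_co state_phi B_star freeB (head_eta i) (co_eta i)) addr0.
    rewrite wE mulrBr linearB /=; congr (_ + _); rewrite mulr_sumr linear_sum -sumrN.
    apply: eq_bigr => j ij; rewrite uE mulrBr linearB /=.
    by rewrite (head_orth ij (head_eta i) (head_beta j)) sub0r opprK.
  have -> : sqn (eta i).1 = complex.Re ((sqn (eta i).1)%:C) by [].
  by rewrite E raddfD raddf_sum.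
(* Summing over [i] gives an inner product of [h j] with [S j * (eta j).1], as [h j] does not see
   [(kap j).1]. Then [star (S j)] is moved onto [h j], which lies in [co_span j], so the norms
   multiply. *)
have hE j : \sum_(i | j != i) tau i * complex.Re (phi (star (eta i).1 * (kap j).2)) <=
    r j * nn (h j) * e j.
  have -> : \sum_(i | j != i) tau i * complex.Re (phi (star (eta i).1 * (kap j).2)) =
      complex.Re (phi (star (star (S j) * h j) * (eta j).1)).
    rewrite starM starK -mulrA; have [_ _ ->] := kapP j.
    have co_h : co_span j (h j).
      apply: lin_span_sum => i ji; apply: lin_span_scale.
      exact: co_span_head ji (head_eta i).
    rewrite mulrDr linearD /= (phi_co_head state_phi B_star freeB co_h (head_kap j)) add0r.
    rewrite /h star_sum mulr_suml linear_sum raddf_sum; apply: eq_bigr => i _.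
    rewrite starZr -scalerAl linearZ /=; case: (phi _) => a b /=.
    by rewrite mul0r subr0.
  apply: le_trans (Re_phi_cauchy _ _) _; rewrite ler_wpM2r ?e0 //.
  have co_h : co_span j (h j).
    apply: lin_span_sum => i ji; apply: lin_span_scale.
    exact: co_span_head ji (head_eta i).
  by rewrite (nn_co_mul state_phi algB B_star freeB (B_star (BS j)) co_h) nn_starS.
have Ebound : \sum_i tau i * e i ^+ 2 <= 4 * (\sum_i tau i) / (1 - s) ^+ 2 * V ^+ 2.
  apply: (weighted_annihilation_bound qr s1 (e := e) (k := fun i => nn (h i))) => [i|].
    rewrite /h sqn_neq; last by move=> j; apply: lin_span_scale; exact: head_eta.
    by rewrite !nnZ // !cabs_real ger0_norm ?(le_trans ler01) //;
       congr (_ - _); apply: eq_bigr => j _; rewrite nnZ // cabs_real ger0_norm ?(le_trans ler01).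
  have -> : \sum_i tau i * e i ^+ 2 =
      \sum_i tau i * complex.Re (phi (star (eta i).1 * v)) +
      \sum_j \sum_(i | j != i) tau i * complex.Re (phi (star (eta i).1 * (kap j).2)).
    rewrite (exchange_big_dep predT) //= -big_split; apply: eq_bigr => i _ /=.
    rewrite /e sqr_nn // etaE mulrDr mulr_sumr; congr (_ + _).
    by apply: eq_bigl => j; rewrite eq_sym.
  apply: lerD; last by apply: ler_sum => j _; exact: hE.
  apply: ler_sum => i _; apply: le_trans (_ : tau i * (e i * V) <= _).
    by apply: ler_wpM2l; [exact: le_trans (tau1 i)|exact: Re_phi_cauchy].
  by rewrite mulrA.
have sqrt_bound (x C z : R) : 0 <= x -> 0 <= z -> 0 <= C -> x ^+ 2 <= C * z ^+ 2 ->
    x <= Num.sqrt C * z.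
  move=> x0 z0 C0 xz; rewrite -(@ler_pXn2r _ 2) ?nnegrE ?mulr_ge0 ?sqrtr_ge0 //.
  by rewrite exprMn sqr_sqrtr.
have s1' : 0 < 1 - s by rewrite subr_gt0.
have e_le i : e i <= c1 * V.
  apply: sqrt_bound => //.
    by rewrite divr_ge0 ?sqr_ge0 // mulr_ge0 // sumr_ge0 // => j _; exact: le_trans (tau1 j).
  apply: le_trans Ebound; apply: le_trans (_ : tau i * e i ^+ 2 <= _).
    by rewrite ler_peMl ?sqr_ge0.
  apply: (le_sum i (f := fun i => tau i * e i ^+ 2)) => j.
  by rewrite mulr_ge0 ?sqr_ge0 // (le_trans ler01).
have kap_le i : nn (kap i).1 <= cnorm (S i) * (c1 * V) /\
    nn (kap i).2 <= cnorm (S i) * (c1 * V).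
  have SE : nn (S i * (eta i).1) <= cnorm (S i) * (c1 * V).
    apply: le_trans (nn_mul state_phi _ _) _.
    by apply: ler_wpM2l; [exact: cnorm_ge0|exact: e_le].
  have [_ _ kE] := kapP i; move: SE; rewrite kE => SE.
  have orth := phi_head_co state_phi B_star freeB (head_kap i) (co_kap i).
  by split; apply: le_trans SE; rewrite ler_wsqrtr // sqn_orthD // ?lerDl ?lerDr sqn_ge0.
have kap_sum (P : pred 'I_N) : \sum_(i | P i) nn (kap i).2 <= M * (c1 * V).
  apply: le_trans (_ : \sum_(i | P i) cnorm (S i) * (c1 * V) <= _).
    by apply: ler_sum => i _; have [] := kap_le i.
  rewrite mulr_suml big_mkcond; apply: ler_sum => i _; case: ifP => // _.
  by rewrite mulr_ge0 ?cnorm_ge0 ?mulr_ge0.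
(* [(eta i).2] is recovered from [X i * y = v - sum_(j != i) u j]; all its terms but the [beta j]
   are already bounded by multiples of [V]. *)
have beta_le i : nn (beta i) <= c3 * V + r i * nn (\sum_(j | i != j) beta j).
  set m := nn (\sum_(j | i != j) beta j).
  have eta'_le : nn (eta i).2 <= (1 + M * c1 + c1) * V + m.
    have -> : (eta i).2 = v + \sum_(j | i != j) (kap j).2 - (eta i).1 - \sum_(j | i != j) beta j.
      have [_ _ ] := etaP i; rewrite wE => /(congr1 (fun x => x - (eta i).1)).
      rewrite [in RHS]addrAC subrr add0r => <-; rewrite (eq_bigr _ (fun j _ => uE j)) sumrB.
      by rewrite opprB addrA -!addrA; congr (_ + (_ + _)); rewrite addrC.
    apply: le_trans (nnB state_phi _ _) _; rewrite lerD2r.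
    apply: le_trans (nnB state_phi _ _) _; rewrite [leRHS]mulrDl; apply: lerD; last exact: e_le.
    apply: le_trans (nnD state_phi _ _) _; rewrite mulrDl mul1r lerD2l -mulrA.
    exact: le_trans (nn_sum state_phi _ _ _) (kap_sum _).
  rewrite /beta nnN //; apply: le_trans (nnD state_phi _ _) _.
  rewrite (nn_co_mul state_phi algB B_star freeB (BS i) (co_eta i)) -/(r i).
  have h1 : nn (kap i).1 <= M * c1 * V.
    have [hk _] := kap_le i; apply: le_trans hk _; rewrite mulrA.
    apply: ler_wpM2r => //; apply: ler_wpM2r => //.
    by apply: (le_sum i (f := fun i => cnorm (S i))) => j; exact: cnorm_ge0.
  have h2 : r i * nn (eta i).2 <= (\sum_j r j) * ((1 + M * c1 + c1) * V) + r i * m.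
    apply: le_trans (ler_wpM2l (r0 i) eta'_le) _; rewrite mulrDr lerD2r.
    by apply: ler_wpM2r; [rewrite mulr_ge0 ?addr_ge0 ?mulr_ge0|exact: le_sum].
  apply: le_trans (lerD h1 h2) _; rewrite addrA lerD2r /c3 [leRHS]mulrDl.
  by rewrite (mulrA _ _ V).
have cV : 0 <= c3 * V by rewrite mulr_ge0.
have beta_bound i : nn (beta i) <= c4 * c3 * V.
  have := creation_bound qr s1 (b := fun i => nn (beta i)) (fun i => nn_ge0 phi _)
    (fun i => sqn_neq i head_beta) beta_le.
  move=> H; rewrite -mulrA; apply: sqrt_bound => //; first exact: nn_ge0.
    by rewrite mulr_ge0 ?divr_ge0 ?(ltW s1') // mulr_ge0 // addr_ge0 // divr_ge0 // ltW.
  apply: le_trans H; apply: (le_sum i (f := fun i => nn (beta i) ^+ 2)) => j.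
  exact: sqr_ge0.
have yE : y = v + \sum_i (kap i).2 - \sum_i beta i.
  rewrite -[y in LHS](addrK (\sum_i u i)) -vE (eq_bigr _ (fun j _ => uE j)) sumrB.
  by rewrite opprB addrA addrAC -!addrA.
rewrite yE; apply: le_trans (nnB state_phi _ _) _; rewrite [leRHS]mulrDl.
apply: lerD.
  apply: le_trans (nnD state_phi _ _) _; rewrite mulrDl mul1r lerD2l -mulrA.
  exact: le_trans (nn_sum state_phi _ _ _) (kap_sum _).
apply: le_trans (nn_sum state_phi _ _ _) _.
apply: le_trans (_ : \sum_(i < N) c4 * c3 * V <= _).
  by apply: ler_sum => i _; exact: beta_bound.
by rewrite sumr_const card_ord -[leLHS]mulr_natl mulrA.
Qed.

End LowerBound.

(** * The resolvent of a *-free sum *)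

Section StarFreeResolvent.
Context {R : realType} {A : cstarAlgType R} (phi : {scalar A}).
Context {N : nat} (T : 'I_N -> A) (Rf : 'I_N -> R[i] -> R[i]) (z : R[i]).
Hypothesis state_phi : is_state phi.
Hypothesis freeT : star_freely_independent phi T.
Hypothesis z0 : z != 0.
Hypothesis Kz : forall i, ((K_of (Rf i) z)%:A - T i \is a GRing.unit)
  /\ cauchy_transform phi (T i) (K_of (Rf i) z) = z.

Local Notation nrm := (@cnorm R A).
Local Notation nn := (nn phi).
Local Notation sqn := (sqn phi).
Let phi1 : phi 1 = 1 := state_phi.1.
Let S i := S_of (Rf i) (T i) z.
Let psum n : A := z *: alt_psum S n.
Let res : A := (K_of (fun w => \sum_i Rf i w) z)%:A - \sum_i T i.
Let X i : A := z *: ((K_of (Rf i) z)%:A - T i).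
Let q i : R := sqn (S i).
Let s : R := \sum_i q i / (1 + q i).
Let starT i := gen_subalgebra [set T i; star (T i)].
Let B i := norm_closure (starT i).

Let algT i : subalgebra (starT i). Proof. exact: gen_subalgebraP. Qed.

Let starT_star i x : starT i x -> starT i (star x).
Proof.
by apply: gen_subalgebra_star => _ [->|->]; apply: gen_subalgebra_gen;
  [right|left; rewrite starK].
Qed.

Lemma star_closure_subalgebra i : subalgebra (B i).
Proof. exact: norm_closure_subalgebra. Qed.

Lemma star_closure_star i x : B i x -> B i (star x).
Proof. by apply: norm_closure_star => y; exact: starT_star. Qed.

Lemma star_closure_free : free_sets phi B.
Proof. exact: (norm_closure_free state_phi algT freeT). Qed.

Lemma star_closure_gen i : B i (T i).
Proof. by apply: sub_norm_closure; apply: gen_subalgebra_gen; left. Qed.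

Let S1 i : 1 + S i = z^-1 *: ((K_of (Rf i) z)%:A - T i)^-1.
Proof. by rewrite /S /S_of addrC subrK. Qed.

Lemma X_inverse i : X i * (1 + S i) = 1 /\ (1 + S i) * X i = 1.
Proof.
have [Ku _] := Kz i; rewrite S1 /X.
by split; rewrite -scalerAl -scalerAr scalerA ?mulfV ?mulVf // scale1r ?mulrV ?mulVr.
Qed.

Lemma X_closure i : B i (X i).
Proof.
have algB := star_closure_subalgebra i.
apply: (subalgZ algB); apply: (subalgB algB); first exact: (subalg_alg algB).
exact: star_closure_gen.
Qed.

(** For a general [z] no power series for [S i] is at hand; membership comes from
    [norm_closure_inv], which requires adjoints in the generating algebra. *)
Lemma S_closure i : B i (S i).
Proof.
have algB := star_closure_subalgebra i.
apply: (subalgB algB); last exact: (subalg1 algB).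
apply: (subalgZ algB); apply: norm_closure_inv; [by []|by move=> y; exact: starT_star| |by have [] := Kz i].
apply: (subalgB (algT i)); first exact: (subalg_alg (algT i)).
by apply: gen_subalgebra_gen; left.
Qed.

Lemma phi_S i : phi (S i) = 0.
Proof.
have [_ Gz] := Kz i; rewrite linearB linearZ /= phi1.
by move: Gz; rewrite /cauchy_transform => ->; rewrite mulVf // subrr.
Qed.

Lemma resolvent_sumE : z *: res = 1 + \sum_i (X i - 1).
Proof.
have -> : res = z^-1 *: (1 + \sum_i (X i - 1)).
  exact: (@sum_resolventE _ _ _ z (fun i => Rf i z) T z0).
by rewrite scalerA mulfV // scale1r.
Qed.

Let res_psum n : res * psum n = 1 - \sum_i X i * alt_head S n i.
Proof.
apply: (@sum_resolvent_psum _ _ _ z (fun i => Rf i z) T S z0) => i.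
by have [] := X_inverse i.
Qed.

Let q0 i : 0 <= q i. Proof. exact: sqn_ge0. Qed.

Let alt_psumE n : sqn (alt_psum S n) = alt_psum q n :=
  sqn_alt_psum state_phi star_closure_subalgebra star_closure_star star_closure_free
    S_closure phi_S n.

Lemma sqn_psum n : sqn (psum n) = cabs z ^+ 2 * alt_psum q n.
Proof. by rewrite sqnZ // alt_psumE. Qed.

Lemma phi_psum n : phi (psum n) = z.
Proof.
by rewrite linearZ /= (phi_alt_psum S_closure phi_S n star_closure_free phi1) mulr1.
Qed.

Let nn_sqn_cvg0 (u : nat -> A) : (fun n => sqn (u n)) @ \oo --> (0 : R) ->
  (fun n => nn (u n)) @ \oo --> (0 : R).
Proof.
move=> /cvgn0P u0; apply/cvgn0P => e e0; have [|n0 un] := u0 (e ^+ 2).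
  by rewrite exprn_gt0.
exists n0 => n /un; rewrite ger0_norm ?sqn_ge0 // ger0_norm ?nn_ge0 //.
by rewrite -sqr_nn // ltr_pXn2r ?nnegrE ?nn_ge0 // ltW.
Qed.

Section Bounded.
Variable b : R.
Hypothesis q_bounded : forall n, alt_psum q n <= b.

Let q_cvg := (alt_psum_bounded_cvg q0 q_bounded).2.

Lemma sum_weights_lt1 : s < 1.
Proof. by have [] := alt_psum_bounded_cvg q0 q_bounded. Qed.

(** The error is a sum of bounded multiples of the heads of length [n + 1], whose squared norms are
    at most the increments of the convergent series [alt_psum q]. *)
Lemma res_psum_cvg : (fun n => nn (res * psum n - 1)) @ \oo --> (0 : R).
Proof.
have q_diff : (fun n => alt_psum q n.+1 - alt_psum q n) @ \oo --> (0 : R).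
  rewrite -(subrr (1 - s)^-1); apply: cvgB => //.
  have -> : (fun n => alt_psum q n.+1) = (fun n => alt_psum q (n + 1)%N).
    by apply/funext => n; rewrite addn1.
  by have := q_cvg; rewrite -(cvg_shiftn 1).
apply: (cvgn0_le (v := fun n => \sum_i nrm (X i) * nn (alt_head S n i))) => [n|].
  rewrite nn_ge0 res_psum addrAC subrr add0r nnN //.
  apply: le_trans (nn_sum state_phi _ _ _) _; apply: ler_sum => i _.
  exact: nn_mul.
apply: cvgn0_sum => i _; apply: cvgn0_mull; apply: nn_sqn_cvg0.
apply: (cvgn0_le _ q_diff) => n; rewrite sqn_ge0 //.
exact: (sqn_alt_head_le state_phi star_closure_subalgebra star_closure_star
  star_closure_free S_closure phi_S).
Qed.

Lemma psum_cauchy e : 0 < e -> exists n0, forall m n, (n0 <= m)%N -> (n0 <= n)%N ->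
  nn (psum m - psum n) < e.
Proof.
move=> e0; have zp : 0 < cabs z by rewrite cabs_gt0.
have /cvgrPdist_lt/(_ ((e / cabs z) ^+ 2)) qe := q_cvg.
have [|n0 _ qn] := qe; first by rewrite exprn_gt0 ?divr_gt0.
have key m n : (n0 <= m)%N -> (m <= n)%N -> nn (psum n - psum m) < e.
  move=> n0m mn; rewrite -scalerBr nnZ // mulrC -ltr_pdivlMr //.
  rewrite -(@ltr_pXn2r _ 2) ?nnegrE ?nn_ge0 ?ltW ?divr_gt0 // sqr_nn //.
  rewrite (sqn_alt_psumB state_phi star_closure_subalgebra star_closure_star
    star_closure_free S_closure phi_S mn) -/q.
  have := qn m n0m; have := alt_psum_le q0 n sum_weights_lt1; rewrite -/s.
  move=> pn; apply: le_lt_trans; apply: le_trans (ler_norm _).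
  by rewrite lerD2r.
exists n0 => m n n0m n0n; have [mn|/ltnW nm] := leqP m n.
  by rewrite -nnN // opprB key.
exact: key.
Qed.

Lemma nn_psum_inverse : res \is a GRing.unit ->
  (fun n => nn (psum n - res^-1)) @ \oo --> (0 : R) /\ phi res^-1 = z.
Proof.
move=> ures; suff psum_cvg : (fun n => nn (psum n - res^-1)) @ \oo --> (0 : R).
  split=> //; exact: (phi_nn_limit state_phi psum_cvg phi_psum).
apply: (cvgn0_le _ (cvgn0_mull (nrm res^-1) res_psum_cvg)) => n.
rewrite nn_ge0 (_ : psum n - res^-1 = res^-1 * (res * psum n - 1)) ?nn_mul //.
by rewrite mulrBr mulr1 mulKr.
Qed.

(* A left inverse [p] of the resolvent satisfies [psum_n - p = p (res psum_n - 1)],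
   so it is also a right inverse. *)
Lemma resolvent_unit : faithful phi -> tracial phi -> res \is a GRing.unit.
Proof.
move=> faithful_phi tracial_phi.
have [c c0 lb] := resolvent_lower_bound state_phi star_closure_subalgebra
  star_closure_star star_closure_free S_closure X_closure phi_S
  (fun i => (X_inverse i).2) tracial_phi sum_weights_lt1.
(* [D] consists of combinations of words, where the lower bound holds. Its norm closure [P] is
   needed for [unit_of_coercive], whose proof takes square roots. *)
set G := [set x | exists i, B i x]; pose D := gen_subalgebra G.
have algD : subalgebra D by exact: gen_subalgebraP.
have D_star x : D x -> D (star x).
  apply: gen_subalgebra_star => {}x [i ix]; apply: gen_subalgebra_gen; exists i.
  exact: star_closure_star.
have D_full x : D x -> full_span phi B x.
  move=> Dx; rewrite -[x]mulr1.
  have : full_span phi B 1 by apply: lin_span_gen; left.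
  move: {1 2}1; apply: (@gen_subalgebra_min _ _ G
    [set x | forall y, full_span phi B y -> full_span phi B (x * y)]) Dx.
    split=> [y fy|k u v fu fv y fy|u v fu fv y fy] /=.
    - by rewrite mul1r.
    - rewrite mulrDl -scalerAl; apply: lin_span_add; last exact: fv.
      by apply: lin_span_scale; exact: fu.
    - by rewrite -mulrA; apply/fu/fv.
  by move=> u [i iu] y fy; exact: (full_span_mul state_phi star_closure_subalgebra iu fy).
have D_res : D res.
  apply: (subalgB algD); first exact: (subalg_alg algD).
  apply: (subalg_sum algD) => i _; apply: gen_subalgebra_gen; exists i.
  exact: star_closure_gen.
pose P := norm_closure D; have clP : closed_subalgebra P by exact: norm_closure_closed.
pose c' := c * cabs z; have c'0 : 0 < c' by rewrite mulr_gt0 ?cabs_gt0.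
have lbD y : D y -> nn y <= c' * nn (res * y).
  move=> /D_full/lb; rewrite -resolvent_sumE -scalerAl nnZ //.
  by rewrite mulrA.
have lbP y : P y -> nn y <= c' * nn (res * y).
  move=> /norm_closureP Py; apply/ler_addgt0Pr => e e0.
  (* [nn y - c' * nn (res * y)] varies by at most [k] times the distance in [nn], so an
     approximation within [e / k] costs at most [e]. *)
  pose k := 1 + c' * nrm res; have k0 : 0 < k.
    by rewrite ltr_pwDl // mulr_ge0 ?cnorm_ge0 // ltW.
  have [|u Du uy] := Py (e / k); first by rewrite divr_gt0.
  have uy' : nn (u - y) <= e / k.
    exact: le_trans (nn_le_cnorm state_phi _) (ltW uy).
  have h1 : nn y <= nn u + nn (u - y).
    by rewrite -{1}[y](subKr u) nnB.
  have h2 : nn (res * u) <= nn (res * y) + nrm res * nn (u - y).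
    rewrite -{1}[u](subrK y) mulrDr addrC (le_trans (nnD state_phi _ _)) // lerD2l.
    exact: nn_mul.
  have h3 := lbD u Du.
  have h4 : nn (u - y) + c' * (nrm res * nn (u - y)) <= e.
    by rewrite mulrA -[X in X + _]mul1r -mulrDl mulrC -ler_pdivlMr.
  have h5 : c' * nn (res * u) <= c' * nn (res * y) + c' * (nrm res * nn (u - y)).
    by rewrite -mulrDr ler_wpM2l // ltW.
  move: h1 h3 h4 h5; move: (c' * nn (res * u)) (c' * nn (res * y)) (c' * (_ * _)).
  by move=> a1 a2 a3; lra.
have uh : star res * res \is a GRing.unit.
  apply: (@unit_of_coercive _ _ phi state_phi faithful_phi P _ (c' ^- 2)) => //.
  - by apply: sub_norm_closure; apply: (subalgM algD) => //; exact: D_star.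
  - by rewrite starM starK.
  - by rewrite invr_gt0 exprn_gt0.
  move=> y /lbP ly.
  have -> : star y * (star res * res) * y = star (res * y) * (res * y).
    by rewrite starM !mulrA.
  rewrite -/(sqn (res * y)) mulrC ler_pdivrMr ?exprn_gt0 // -!sqr_nn //.
  rewrite mulrC -exprMn ler_pXn2r ?nnegrE ?nn_ge0 // mulr_ge0 ?nn_ge0 //.
  exact: ltW.
set p := (star res * res)^-1 * star res.
have pres : p * res = 1 by rewrite /p -mulrA mulVr.
suff resp : res * p = 1 by apply/unitrP; exists p.
apply/eqP; rewrite -subr_eq0; apply/eqP; apply: (faithful_nn state_phi faithful_phi).
apply/le_anti; rewrite nn_ge0 andbT.
have lim0 := cvgn0_mull (1 + nrm res * nrm p) res_psum_cvg.
apply: (cvgr_to_ge lim0); apply: nearW => n.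
have -> : res * p - 1 = (res * psum n - 1) - res * (p * (res * psum n - 1)).
  have -> : p * (res * psum n - 1) = psum n - p.
    by rewrite mulrBr mulr1 mulrA pres mul1r.
  by rewrite [res * (_ - _)]mulrBr opprB [RHS]addrC addrA subrK.
apply: le_trans (nnB state_phi _ _) _; rewrite [leRHS]mulrDl mul1r lerD2l.
apply: le_trans (nn_mul state_phi _ _) _; rewrite -mulrA ler_wpM2l ?cnorm_ge0 //.
exact: nn_mul.
Qed.

Lemma L2_resolvent (H : completeNormedModType R[i]) (iota : {linear A -> H}) :
  is_L2 phi iota -> exists xi : H,
  [/\ (fun n => iota (psum n)) @ \oo --> xi, L2_inverse iota res xi,
      res \is a GRing.unit -> xi = iota res^-1 &
      rnorm xi ^+ 2 = cabs z ^+ 2 * (1 - s)^-1].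
Proof.
move=> L2; have [xi xiP] := nn_cauchy_cvg state_phi L2 psum_cauchy.
have rnorm_iota x : rnorm (iota x) = nn x.
  by apply: complexI; rewrite rnormE L2.1 norm2E.
have iota_cvg (u : nat -> A) x : (fun n => nn (u n - x)) @ \oo --> (0 : R) ->
    (fun n => iota (u n)) @ \oo --> iota x.
  move=> ux; apply/cvg_rnormP.
  by under eq_fun do rewrite -linearB rnorm_iota.
exists xi; split=> //.
- have [L [Lc La] Lu] := left_mul_extension state_phi L2 res.
  exists L => //; apply: (@cvg_unique _ (@norm_hausdorff _ H)
    ((fun n => iota (res * psum n)) @ \oo)); first exact: Lu.
  exact/iota_cvg/res_psum_cvg.
- move=> ures; apply: (@cvg_unique _ (@norm_hausdorff _ H)
    ((fun n => iota (psum n)) @ \oo)); first exact: xiP.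
  by apply: iota_cvg; have [] := nn_psum_inverse ures.
apply: (@cvg_unique _ (@norm_hausdorff _ R)
    ((fun n => rnorm (iota (psum n)) ^+ 2) @ \oo)).
  exact: (cvgM (cvg_rnorm xiP) (cvg_rnorm xiP)).
have -> : (fun n => rnorm (iota (psum n)) ^+ 2) =
    (fun n => cabs z ^+ 2 * alt_psum q n).
  by apply/funext => n; rewrite rnorm_iota sqr_nn // sqn_psum.
by apply: cvgM; [exact: cvg_cst|exact: q_cvg].
Qed.

End Bounded.
End StarFreeResolvent.

(** * From real to complex series, and the assembly of the statements *)

Section ComplexWeights.
Context {R : realType} {N : nat} (q : 'I_N -> R).

Lemma alternating_sumC n :
  alternating_sum (fun i => (q i)%:C) n = (alternating_sum q n)%:C.
Proof.
by rewrite /alternating_sum rmorph_sum; apply: eq_bigr => w _; rewrite rmorph_prod.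
Qed.

Lemma sum_weightsC :
  \sum_i (q i)%:C / (1 + (q i)%:C) = (\sum_i q i / (1 + q i))%:C.
Proof.
rewrite rmorph_sum; apply: eq_bigr => i _.
by rewrite rmorphM fmorphV rmorphD rmorph1.
Qed.

Lemma alternating_series n :
  series (fun n => alternating_sum q n.+1) n = alt_psum q n - 1.
Proof.
by rewrite /alt_psum addrAC subrr add0r /series /= big_add1.
Qed.

Lemma alternating_seriesC (l : R) : alt_psum q @ \oo --> l ->
  series (fun n => alternating_sum (fun i => (q i)%:C) n.+1) @ \oo --> (l - 1)%:C.
Proof.
move=> ql; apply/cvgCP.
have -> : (fun n => cabs (series (fun n => alternating_sum (fun i => (q i)%:C) n.+1) n -
    (l - 1)%:C)) = (fun n => `|alt_psum q n - l|).
  apply/funext => n; rewrite -cabs_real; congr cabs.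
  have -> : series (fun n => alternating_sum (fun i => (q i)%:C) n.+1) n =
      (series (fun n => alternating_sum q n.+1) n)%:C.
    by rewrite /series /= rmorph_sum; apply: eq_bigr => k _; exact: alternating_sumC.
  by rewrite -rmorphB alternating_series /=; congr (_%:C); ring.
have : (fun n => alt_psum q n - l) @ \oo --> (0 : R).
  by rewrite -(subrr l); apply: cvgB => //; exact: cvg_cst.
by move=> /cvgn0P H; apply/cvgn0P => e /H[n0 Hn]; exists n0 => n /Hn; rewrite normr_id.
Qed.

End ComplexWeights.

Theorem theorem3p3 (R : realType) :
  (* the formal identity, in an arbitrary non-commutative probability space *)
  (forall (A : algType R[i]) (phi : {scalar A}) (N : nat) (T : 'I_N -> A),
     phi 1 = 1 -> freely_independent phi T ->
     (forall a : A, exists! r, formal_R_transform phi a r) /\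
     forall (r : 'I_N -> nat -> R[i]) (s : 'I_N -> nat -> A),
       (forall i, [/\ r i 0%N = 0,
          fps_inverse (fps_zKsub (r i) (T i)) (fun n => fps_one n + s i n) &
          forall n, phi (s i n) = 0]) ->
       [/\ fps_inverse (fps_zKsub (fun n => \sum_i r i n) (\sum_i T i))
                       (fps_alternating_sum s),
           forall n, phi (fps_alternating_sum s n) = fps_one n &
           formal_R_transform phi (\sum_i T i) (fun n => \sum_i r i n)])
  /\
  (* the analytic statements, in a C*-probability space *)
  (forall (A : cstarAlgType R) (phi : {scalar A}), is_state phi ->
    [/\ (forall a : A, exists Ra : R[i] -> R[i], R_transform phi a Ra),
        (forall (a b : A) (Ra Rb Rab : R[i] -> R[i]),
           freely_independent phi (fun c : bool => if c then a else b) ->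
           R_transform phi a Ra -> R_transform phi b Rb ->
           R_transform phi (a + b) Rab ->
           \forall z \near (0 : R[i]), Rab z = Ra z + Rb z) &
        forall (N : nat) (T : 'I_N -> A) (Rf : 'I_N -> R[i] -> R[i]),
        freely_independent phi T ->
        (forall i, R_transform phi (T i) (Rf i)) ->
        let Ksum (z : R[i]) := K_of (fun w => \sum_i Rf i w) z in
        let S (z : R[i]) (i : 'I_N) := S_of (Rf i) (T i) z in
        let psum (z : R[i]) (n : nat) : A :=
          z *: (1 + \sum_(1 <= m < n.+1) alternating_sum (S z) m) in
        let res (z : R[i]) : A := (Ksum z)%:A - \sum_i T i in
        R_transform phi (\sum_i T i) (fun w => \sum_i Rf i w)
        /\
        (\forall z \near (0 : R[i])^',
           [/\ forall i, ((K_of (Rf i) z)%:A - T i \is a GRing.unit)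
                         /\ phi (S z i) = 0,
               res z \is a GRing.unit,
               (fun n => cnorm (psum z n - (res z)^-1)) @ \oo --> (0 : R) &
               phi (res z)^-1 = z])
        /\
        (star_freely_independent phi T ->
         forall z : R[i], z != 0 ->
         (forall i, ((K_of (Rf i) z)%:A - T i \is a GRing.unit)
            /\ cauchy_transform phi (T i) (K_of (Rf i) z) = z) ->
         let q (i : 'I_N) : R[i] := norm2 phi (S z i) ^+ 2 in
         (\sum_i q i / (1 + q i) < 1 ->
          forall (H : completeNormedModType R[i]) (iota : {linear A -> H}),
          is_L2 phi iota ->
          exists xi : H,
            [/\ (fun n => iota (psum z n)) @ \oo --> xi,
                L2_inverse iota (res z) xi,
                res z \is a GRing.unit ->
                  xi = iota (res z)^-1 /\ phi (res z)^-1 = z,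
                cvg (series (fun n => alternating_sum q n.+1) @ \oo) &
                [/\ `|xi| ^+ 2 = `|z| ^+ 2 *
                      (1 + limn (series (fun n => alternating_sum q n.+1))),
                    `|xi| ^+ 2 = `|z| ^+ 2 * (1 - \sum_i q i / (1 + q i))^-1 &
                    `|xi| ^+ 2 = `|z| ^+ 2 *
                      (1 - \sum_i (1 - `|z| ^+ 2 /
                         norm2 phi ((K_of (Rf i) z)%:A - T i)^-1 ^+ 2))^-1]])
         /\
         (faithful phi -> tracial phi ->
          (exists M : R[i], forall n, norm2 phi (psum z n) <= M) ->
          res z \is a GRing.unit /\
          (fun n => norm2 phi (psum z n - (res z)^-1)) @ \oo --> (0 : R[i])))]).
Proof.
split.
  move=> A phi N T phi1 freeT; split=> [a|r s rs]; first exact: formal_R_transform_unique.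
  have r0 i : r i 0%N = 0 by have [] := rs i.
  have zKs i : fps_inverse (fps_zKsub (r i) (T i)) (fun n => fps_one n + s i n).
    by have [] := rs i.
  have phis i n : phi (s i n) = 0 by have [_ _] := rs i.
  have inv := fps_alternating_sum_inverse r0 zKs.
  have phiE := phi_fps_alternating_sum phi1 freeT r0 zKs phis.
  split=> //; split; first by rewrite big1.
  by exists (fps_alternating_sum s).
move=> A phi state_phi; split.
- by move=> a; exists (R_series phi a); exact: R_series_transform.
- by move=> a b Ra Rb Rab; exact: R_transform_add.
move=> N T Rf freeT RT Ksum S psum res; split; first exact: R_transform_sum.
split; first exact: resolvent_sum_near0.
move=> star_freeT z z0 Kz q.
have phi1 : phi 1 = 1 := state_phi.1.
pose qR i : R := sqn phi (S z i).
have qE : q = (fun i => (qR i)%:C).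
  by apply/funext => i; rewrite /q norm2E // -rmorphXn /= sqr_nn.
have qR0 i : 0 <= qR i by exact: sqn_ge0.
have sqn_psum_z n := sqn_psum state_phi star_freeT z0 Kz n.
split.
  rewrite qE sum_weightsC -(rmorph1 (real_complex R)) ltcR => s1 H iota L2.
  have qb n := alt_psum_le qR0 n s1.
  have [_ qcvg] := alt_psum_bounded_cvg qR0 qb.
  have [xi [psum_xi inv_xi unit_xi norm_xi]] :=
    L2_resolvent state_phi star_freeT z0 Kz qb L2.
  have scvg := alternating_seriesC qcvg.
  have xiE : `|xi| ^+ 2 = `|z| ^+ 2 * (1 - (\sum_i qR i / (1 + qR i))%:C)^-1.
    rewrite -rnormE -cabsE -!rmorphXn /= norm_xi rmorphM fmorphV rmorphB rmorph1.
    by [].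
  exists xi; split; [exact: psum_xi|exact: inv_xi| | |].
  - move=> ures; split; first exact: unit_xi.
    by have [] := nn_psum_inverse state_phi star_freeT z0 Kz qb ures.
  - by apply/cvg_ex; exists ((1 - \sum_i qR i / (1 + qR i))^-1 - 1)%:C.
  split; [|exact: xiE|].
    rewrite (limCP scvg) xiE; congr (_ * _).
    by rewrite [in RHS]rmorphB rmorph1 [RHS]addrCA subrr addr0 fmorphV rmorphB rmorph1.
  rewrite xiE rmorph_sum; congr (_ * (1 - _)^-1); apply: eq_bigr => i _.
  have SE : ((K_of (Rf i) z)%:A - T i)^-1 = z *: (1 + S z i).
    by rewrite /S /S_of [1 + _]addrC subrK scalerA mulfV // scale1r.
  have zp : 0 < cabs z by rewrite cabs_gt0.
  (* As [phi (S z i) = 0], the elements 1 and [S z i] are orthogonal, so [1 + S z i] has squared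
     norm [1 + qR i]. *)
  have nE : norm2 phi ((K_of (Rf i) z)%:A - T i)^-1 ^+ 2 =
      (cabs z ^+ 2 * (1 + qR i))%:C.
    rewrite norm2E // -rmorphXn /= sqr_nn // SE sqnZ // sqnD //.
    rewrite star1 !mul1r (phi_S state_phi z0 Kz i) /= mulr0 addr0.
    by rewrite {1}/sqn star1 mulr1 phi1.
  have E : qR i / (1 + qR i) = 1 - cabs z ^+ 2 / (cabs z ^+ 2 * (1 + qR i)).
    have := lt0r_neq0 zp; have : 1 + qR i != 0 by rewrite lt0r_neq0 // ltr_pwDl.
    by move=> ? ?; field; apply/andP; split.
  by rewrite nE -cabsE [in LHS]E rmorphB rmorph1 rmorphM fmorphV rmorphXn.
move=> faithful_phi tracial_phi [M psumM].
(* The bound on the partial sums bounds the real alternating series, which by [alt_psum_bounded_cvg]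
   forces the weights to sum to less than 1. *)
have qb n : alt_psum qR n <= complex.Re M ^+ 2 / cabs z ^+ 2.
  have := psumM n; rewrite norm2E // lecE => /andP[_ /= nM].
  rewrite ler_pdivlMr ?exprn_gt0 ?cabs_gt0 // mulrC -sqn_psum_z -sqr_nn //.
  by rewrite ler_pXn2r ?nnegrE ?nn_ge0 // (le_trans (nn_ge0 phi _) nM).
have ures := resolvent_unit state_phi star_freeT z0 Kz qb faithful_phi tracial_phi.
split=> //; apply/cvgCP.
have [H _] := nn_psum_inverse state_phi star_freeT z0 Kz qb ures.
apply: cvgn0_le H => n.
by rewrite subr0 norm2E // cabs_real ger0_norm ?nn_ge0 // lexx.
Qed.
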